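(* The isoperimetric conjecture on the $n$-dimensional cube is false for all $n\ge10$. That is, for every integer $n\ge10$ there exists $\bar v\in(0,1)$ such that for no $k\in\{0,1,\ldots,n-1\}$ and $r\in(0,1]$ is the $r$-tubular neighborhood of a $k$-dimensional face of $\mathbf{Q}^n$, or its complement, an isoperimetric minimizer in $\mathbf{Q}^n$ of volume $\bar v$.
   Context: $\mathbf{Q}^n=[0,1]^n$ with the Euclidean metric and Lebesgue measure $\mu$. For Borel $E\subset\mathbf{Q}^n$, $V(E)=\mu(E)$ and $A(E)=\mathcal{H}^{n-1}(\partial^*E\cap(0,1)^n)$ if $E$ has locally finite perimeter ($A(E)=\infty$ otherwise), where $\partial^*E$ is the reduced boundary. $E$ is an isoperimetric minimizer of volume $\bar v$ if $V(E)=\bar v$ and $A(E)\le A(F)$ for all Borel $F\subset\mathbf{Q}^n$ with $V(F)=\bar v$. The $r$-tubular neighborhood of a face $F$ of $\mathbf{Q}^n$ is $\{x\in\mathbf{Q}^n: \mathrm{dist}(x,F)\le r\}$. The isoperimetric conjecture on the $n$-dimensional cube states: for every $\bar v\in(0,1)$, there exist $k\in\{0,1,\ldots,n-1\}$ and $r\in(0,1]$ such that the $r$-tubular neighborhood of a $k$-dimensional face of $\mathbf{Q}^n$ or its complement is an isoperimetric minimizer of volume $\bar v$. *)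

(* Defs.v *)
From HB Require Import structures.
From mathcomp Require Import all_boot all_order all_algebra.
From mathcomp Require Import all_classical all_reals all_analysis.
From mathcomp Require Import measurable_realfun.

Set Implicit Arguments.
Unset Strict Implicit.
Unset Printing Implicit Defensive.

Import Order.TTheory GRing.Theory Num.Theory.
Import numFieldNormedType.Exports.

Local Open Scope classical_set_scope.
Local Open Scope ring_scope.

Section borel_matrix.
Context (R : realType) (m n : nat).

HB.instance Definition _ := @isMeasurable.Build
  (sigma_display (@open 'M[R]_(m, n))) 'M[R]_(m, n) <<s open >>
  (@sigma_algebra0 _ setT open) (@sigma_algebraC _ open)
  (@sigma_algebra_bigcup _ setT open).

End borel_matrix.

Section lebesgue_rV.
Context (R : realType).

Definition rV_cons n (p : measurableTypeR R * 'rV[R]_n) : 'rV[R]_n.+1 :=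
  \row_i (if unlift ord0 i is Some j then p.2 0 j else p.1).

Definition rV_uncons n (v : 'rV[R]_n.+1) : measurableTypeR R * 'rV[R]_n :=
  (v 0 0, \row_i v 0 (lift ord0 i)).

Fixpoint lebesgue_rV n : set 'rV[R]_n -> \bar R :=
  match n with
  | 0 => \d_(0 : 'rV[R]_0)
  | n'.+1 => pushforward (lebesgue_measure \x @lebesgue_rV n')%E (@rV_cons n')
  end.

Lemma rV_consK n : cancel (@rV_cons n) (@rV_uncons n).
Proof.
move=> [x v]; rewrite /rV_uncons /rV_cons /= mxE unlift_none; congr pair.
by apply/rowP => i; rewrite !mxE liftK.
Qed.

Lemma rV_unconsK n : cancel (@rV_uncons n) (@rV_cons n).
Proof.
move=> v; apply/rowP => i; rewrite /rV_uncons /rV_cons /= mxE.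
by case: unliftP => [j ->|->]; rewrite ?mxE.
Qed.

Definition rV_box n (q : {ffun 'I_n -> rat * rat}) : set 'rV[R]_n :=
  [set v | forall i, ratr (q i).1 < v 0 i < ratr (q i).2].

Lemma open_rV_box n (U : set 'rV[R]_n) : open U ->
  U = \bigcup_(q in [set q | rV_box q `<=` U]) rV_box q.
Proof.
move=> oU; apply/seteqP; split; last by move=> v [q] /= /[apply].
move=> v Uv.
have : nbhs v U by apply: open_nbhs_nbhs.
move=> /nbhs_ballP[e /= e0 eU].
have h i : exists p : rat * rat, [/\ v 0 i - e < ratr p.1 < v 0 i &
   v 0 i < ratr p.2 < v 0 i + e].
  have /rat_in_itvoo[a] : v 0 i - e < v 0 i by rewrite ltrBlDr ltrDl.
  have /rat_in_itvoo[b] : v 0 i < v 0 i + e by rewrite ltrDl.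
  by rewrite !in_itv /= => hb ha; exists (a, b).
have [f hf] := choice h.
exists [ffun i => f i]; last first.
  by move=> i; rewrite ffunE; have [/andP[_ ->] /andP[->]] := hf i.
move=> w /= hw; apply: eU; split => //= i j; rewrite (ord1 i).
have := hw j; rewrite ffunE => /andP[w1 w2].
have [/andP[a1 a2] /andP[b1 b2]] := hf j.
rewrite /ball /= ltr_distlC; apply/andP; split.
  exact: lt_trans a1 w1.
exact: lt_trans w2 b2.
Qed.

Lemma open_rV_boxP n (q : {ffun 'I_n -> rat * rat}) : open (rV_box q).
Proof.
rewrite openE => v hv.
apply: (@filter_forall _ 'I_n
  (fun i => [set w : 'rV[R]_n | ratr (q i).1 < w 0 i < ratr (q i).2]) (nbhs v)
  (nbhs_filter v)) => i.
have : nbhs (v 0 i) [set` `](ratr (q i).1 : R), ratr (q i).2[ ].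
  by apply: near_in_itvoo; rewrite in_itv /=; exact: hv.
by move=> /(@coord_continuous R 1 n 0 i v).
Qed.

Lemma measurable_rV_cons n : measurable_fun setT (@rV_cons n).
Proof.
apply: (@measurability _ _ _ _ _ _ (@open 'rV[R]_n.+1)) => //.
move=> _ [U oU <-]; rewrite setTI (open_rV_box oU) preimage_bigcup.
rewrite bigcup_mkcond; apply: countable_bigcupT_measurable => // q.
case: ifP => // _.
pose q' := [ffun i : 'I_n => q (lift ord0 i)].
rewrite [X in measurable X](_ : _ =
  [set` `](ratr (q ord0).1 : R), ratr (q ord0).2[ ] `*` rV_box q').
  apply: measurableX; first exact: measurable_itv.
  by apply: sub_sigma_algebra; exact: open_rV_boxP.
apply/seteqP; split=> [p hp|p [/= hp1 hp2]].
  have E : rV_uncons (rV_cons p) = p by rewrite rV_consK.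
  split=> [/=|i].
    by rewrite in_itv /= -[in p.1]E; exact: (hp ord0).
  by rewrite -[in p.2]E /= mxE ffunE; exact: (hp (lift ord0 i)).
move=> /= i; have E : rV_uncons (rV_cons p) = p by rewrite rV_consK.
case: (unliftP ord0 i) => [j ->|->].
  by have := hp2 j; rewrite -[in p.2]E /= mxE ffunE.
by move: hp1; rewrite in_itv /= -[in p.1]E.
Qed.

Lemma measurable_rV_coord n (i : 'I_n) :
  measurable_fun setT (fun v : 'rV[R]_n => v 0 i : measurableTypeR R).
Proof.
apply: (measurability _ (RGenOInfty.measurableE R)).
move=> _ [_ [a ->] <-]; rewrite setTI; apply: sub_sigma_algebra.
by apply: open_comp; [move=> v _; exact: coord_continuous|exact: interval_open].
Qed.

Lemma measurable_rV_uncons n : measurable_fun setT (@rV_uncons n).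
Proof.
apply/measurable_fun_pairP; split; first exact: measurable_rV_coord.
apply: (@measurability _ _ _ _ _ _ (@open 'rV[R]_n)) => //.
move=> _ [U oU <-]; rewrite setTI; apply: sub_sigma_algebra.
apply: open_comp => // v _.
move=> A /nbhs_ballP[e /= e0 eA]; apply/nbhs_ballP; exists e => //= w [_ hw].
apply: eA; split=> // i j; rewrite !mxE; exact: hw.
Qed.

Section rV_cons_measure.
Context n (m : {sigma_finite_measure set 'rV[R]_n -> \bar R}).

Definition rV_cons_measure : set 'rV[R]_n.+1 -> \bar R :=
  pushforward (lebesgue_measure \x m)%E (@rV_cons n).

Let mu : {measure set 'rV[R]_n.+1 -> \bar R} :=
  measure_function_pushforward__canonical__measure_function_Measure
    (lebesgue_measure \x m)%E (@measurable_rV_cons n).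

HB.instance Definition _ := isMeasure.Build _ _ _ rV_cons_measure
  (measure0 mu) (measure_ge0 mu) (@measure_semi_sigma_additive _ _ _ mu).

Let rV_cons_measure_sigma_finite : sigma_finite setT rV_cons_measure.
Proof.
have [F FT Ffin] := isSigmaFinite.sigma_finiteT
  (lebesgue_integral_fubini.measure_function_Measure_isSigmaFinite__to__measure_function_isSigmaFinite
    (@lebesgue_measure R) m).
exists (fun k => @rV_uncons n @^-1` F k).
  by rewrite -preimage_bigcup -FT preimage_setT.
move=> k; have [mF Fk] := Ffin k; split.
  by rewrite -[X in measurable X]setTI; exact: measurable_rV_uncons.
rewrite /rV_cons_measure /pushforward -comp_preimage.
by rewrite (_ : _ \o _ = id) //; apply/funext => p /=; rewrite rV_consK.
Qed.

HB.instance Definition _ := Measure_isSigmaFinite.Build _ _ _ rV_cons_measure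
  rV_cons_measure_sigma_finite.

End rV_cons_measure.

Lemma lebesgue_rV_sigma_finiteE n :
  exists m : {sigma_finite_measure set 'rV[R]_n -> \bar R},
    @lebesgue_rV n = m.
Proof.
elim: n => [|n [m ih]]; first by exists \d_(0 : 'rV[R]_0).
by exists (rV_cons_measure m : {sigma_finite_measure set _ -> \bar R}); rewrite /= ih.
Qed.

Section lebesgue_rV_measure.
Context (n : nat).

Let mu := projT1 (cid (lebesgue_rV_sigma_finiteE n)).
Let muE : @lebesgue_rV n = mu := projT2 (cid (lebesgue_rV_sigma_finiteE n)).

Let lebesgue_rV0 : lebesgue_rV (set0 : set 'rV[R]_n) = 0%E.
Proof. by rewrite muE measure0. Qed.

Let lebesgue_rV_ge0 (A : set 'rV[R]_n) : (0 <= lebesgue_rV A)%E.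
Proof. by rewrite muE measure_ge0. Qed.

Let lebesgue_rV_sigma_additive : semi_sigma_additive (@lebesgue_rV n).
Proof. by rewrite muE; exact: measure_semi_sigma_additive. Qed.

HB.instance Definition _ := isMeasure.Build _ _ _ (@lebesgue_rV n)
  lebesgue_rV0 lebesgue_rV_ge0 lebesgue_rV_sigma_additive.

Let lebesgue_rV_sigma_finite : sigma_finite setT (@lebesgue_rV n).
Proof. by rewrite muE; exact: sigma_finiteT. Qed.

HB.instance Definition _ := Measure_isSigmaFinite.Build _ _ _ (@lebesgue_rV n)
  lebesgue_rV_sigma_finite.

End lebesgue_rV_measure.

End lebesgue_rV.

Section euclidean.
Context (R : realType) (n : nat).
Implicit Types (x y : 'rV[R]_n) (A : set 'rV[R]_n) (r : R).

Definition edot x y : R := \sum_i x 0 i * y 0 i.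

(* The norm `|x| provided by the library on 'rV[R]_n is the sup norm; it
   induces the same topology as enorm. *)
Definition enorm x : R := Num.sqrt (edot x x).

Definition eball x r : set 'rV[R]_n := [set y | enorm (y - x) < r].

Definition edist x A : R := inf [set enorm (x - y) | y in A].

(* -oo when A is empty *)
Definition ediam A : \bar R :=
  ereal_sup [set (enorm (x - y))%:E | x in A & y in A].

End euclidean.

Section hausdorff.
Context (R : realType) (n s : nat).
Implicit Types A : set 'rV[R]_n.
Local Open Scope ereal_scope.

(* omega_s (diam A / 2) ^ s, where omega_s is the volume of the unit ball of
   R^s; the empty set has weight 0 for every s, including s = 0. *)
Definition hausdorff_weight A : \bar R :=
  if A == set0 then 0
  else lebesgue_rV (eball (0 : 'rV[R]_s) 1) * ((2^-1)%:E * ediam A) ^+ s.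

Definition hausdorff_pre (delta : R) A : \bar R :=
  ereal_inf [set \sum_(0 <= k <oo) hausdorff_weight (C k) |
    C in [set C : (set 'rV[R]_n)^nat |
      A `<=` \bigcup_k C k /\ forall k, ediam (C k) <= delta%:E]].

(* The supremum is the limit as delta tends to 0, by monotonicity. *)
Definition hausdorff A : \bar R :=
  ereal_sup [set hausdorff_pre delta A | delta in [set delta | (0 < delta)%R]].

End hausdorff.

Section perimeter.
Context (R : realType) (n : nat).
Implicit Types (T sigma : 'rV[R]_n -> 'rV[R]_n) (E K : set 'rV[R]_n).

Definition divergence T (x : 'rV[R]_n) : R :=
  \sum_i ('D_(delta_mx 0 i) T x) 0 i.

Definition field_support T : set 'rV[R]_n := closure [set x | T x != 0].

Definition C1_compact_support T : Prop :=
  [/\ forall x, differentiable T x,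
      forall v, continuous ('D_v T) &
      compact (field_support T)].

Definition locally_finite_perimeter E : Prop :=
  forall K, compact K ->
    (ereal_sup [set \int[@lebesgue_rV R n]_(x in E) (divergence T x)%:E |
       T in [set T | [/\ C1_compact_support T, field_support T `<=` K &
                         forall x, (enorm (T x) <= 1)%R]]] < +oo)%E.

(* sigma m is the Gauss-Green vector measure mu_E of E, presented by its polar
   decomposition: m = |mu_E| is a Radon measure and |sigma| = 1 m-a.e. *)
Definition gauss_green E (m : {measure set 'rV[R]_n -> \bar R}) sigma : Prop :=
  [/\ forall K, compact K -> (m K < +oo)%E,
      measurable_fun setT sigma,
      {ae m, forall x, enorm (sigma x) = 1} &
      forall T, C1_compact_support T ->
        (\int[@lebesgue_rV R n]_(x in E) (divergence T x)%:E =
         \int[m]_x (edot (T x) (sigma x))%:E)%E].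

(* By the Riesz representation theorem the pair (m, sigma) exists when E has
   locally finite perimeter; m is unique and sigma is unique m-a.e. *)
Definition reduced_boundary E : set 'rV[R]_n :=
  [set x | exists (m : {measure set 'rV[R]_n -> \bar R}) sigma,
    [/\ gauss_green E m sigma,
        forall r : R, 0 < r -> (0 < m (eball x r))%E &
        exists2 nu : 'rV[R]_n, enorm nu = 1 &
          forall i, (fun r : R => (\int[m]_(y in eball x r) (sigma y 0 i))
                                   / fine (m (eball x r))) @ 0^'+ --> nu 0 i]].

End perimeter.

Section cube.
Context (R : realType) (n : nat).
Implicit Types (E F : set 'rV[R]_n) (v r : R) (k : nat).

Definition cube : set 'rV[R]_n := [set x | forall i, 0 <= x 0 i <= 1].

Definition open_cube : set 'rV[R]_n := [set x | forall i, 0 < x 0 i < 1].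

Definition volume E : \bar R := lebesgue_rV E.

Definition area E : \bar R :=
  if `[< locally_finite_perimeter E >]
  then hausdorff n.-1 (reduced_boundary E `&` open_cube) else +oo%E.

Definition isoperimetric_minimizer v E : Prop :=
  [/\ measurable E, E `<=` cube, volume E = v%:E &
      forall F, measurable F -> F `<=` cube -> volume F = v%:E ->
        (area E <= area F)%E].

(* S is the set of free coordinates; the other ones are fixed to 0 or 1. *)
Definition is_face k F : Prop :=
  exists (S : {set 'I_n}) (e : 'I_n -> bool),
    #|S| = k /\ F = [set x | cube x /\ forall i, i \notin S -> x 0 i = (e i)%:R].

Definition tube F r : set 'rV[R]_n := [set x | cube x /\ edist x F <= r].

End cube.

Arguments cube {R n}.
Arguments open_cube {R n}.

(* Main.v *)
Require Import Defs.
From HB Require Import structures.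
From mathcomp Require Import all_boot all_order all_algebra.
From mathcomp Require Import all_classical all_reals all_analysis.
From mathcomp Require Import measurable_realfun ring lra.

(* A tube of codimension d and radius r <= 1 about a face has volume B_d r^d,
   where B_d is the volume of the part of the unit ball of R^d in the positive
   orthant; in the open cube its boundary is a spherical cylinder, of area
   r^(d-1) h_d when r < 1. Let v be slightly larger than B_10. No tube of
   codimension at least 10 has volume v. A tube of volume v and codimension
   d <= 9 is beaten by the points of the cube within a distance slightly larger
   than 1 of a face of codimension 10, since h_10 <= (10/d) (B_10/B_d) h_d and
   (10/d)^d B_10/B_d < 0.999. The complement of a tube has volume v only if
   d = 1, and it is then, up to a null set, a tube about the opposite facet.

   The value of h_d is never computed: the comparison of h_(d+1) with h_d comes
   from covering a sphere by thin bands, each 1-Lipschitz in longitude and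
   latitude. The reduced boundary is confined to the sphere by testing the
   Gauss-Green formula against bump functions, and it contains the sphere
   because the Gauss-Green measure of a tube with r < 1 can be written down. *)

Set Implicit Arguments.
Unset Strict Implicit.
Unset Printing Implicit Defensive.

Import Order.TTheory GRing.Theory Num.Theory.
Import numFieldNormedType.Exports.

Local Open Scope classical_set_scope.
Local Open Scope ring_scope.

(** * Integration over the cube *)

Section coordinates.
Context (R : realType).

(** The choice of 10: differentiating the volume in the radius suggests h_k = k B_k, and with this
    value, at volume B_10, codimension 10 has less area than codimension d exactly when (10/d)^d
    B_10/B_d < 1. The tightest case is d = 9, where the left side is about 0.998; with 9 in place of
    10, the comparison with d = 8 gives about 1.04. This narrow margin dictates the bound 0.999, the
    radius 1 + 10^-5 of the competitor and the precision to which pi is estimated. At radius above 1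
    the competitor sticks out through the opposite facets, so its area is only bounded above, by the
    sphere continued outside the cube, and its volume is only enclosed between B_10 and the volume
    of the full orthant ball. Hausdorff measures are handled through covers: subadditivity,
    additivity at positive distance and Lipschitz maps. Since h_d cancels in the final comparison,
    it must also be shown finite and positive. The reduced boundary quantifies over an unknown
    Gauss-Green measure. An upper bound on the area must treat every such measure, a lower bound
    must exhibit one. *)

Definition upd n (i : 'I_n) (x : 'rV[R]_n) (t : R) : 'rV[R]_n :=
  \row_j (if j == i then t else x 0 j).

(** Reflecting the coordinates where [e] holds moves any face to one through the origin with the
    same free coordinates, so the computations are done in the positive orthant. *)
Definition flip n (e : 'I_n -> bool) (x : 'rV[R]_n) : 'rV[R]_n :=
  \row_j (if e j then 1 - x 0 j else x 0 j).

Lemma measurable_forall d (T : measurableType d) n (A : 'I_n -> set T) :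
  (forall i, measurable (A i)) -> measurable [set x | forall i, A i x].
Proof.
move=> mA; rewrite [X in measurable X](_ : _ = \bigcap_(i in setT) A i).
  by apply: fin_bigcap_measurable; [exact: finite_finset|move=> i _].
by apply/seteqP; split => x /= h i; [move=> _|]; exact: h.
Qed.

Lemma measurable_rV d (T : measurableType d) n (f : T -> 'rV[R]_n) :
  (forall i, measurable_fun setT (fun x => f x 0 i : measurableTypeR R)) ->
  measurable_fun setT f.
Proof.
move=> mf; apply: (@measurability _ _ _ _ _ _ (@open 'rV[R]_n)) => //.
move=> _ [U oU <-]; rewrite setTI (open_rV_box oU) preimage_bigcup.
rewrite bigcup_mkcond; apply: countable_bigcupT_measurable => // q.
case: ifP => // _.
apply: measurable_forall => i.
pose J : set (measurableTypeR R) := [set` `](ratr (q i).1 : R), ratr (q i).2[].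
have := mf i measurableT J (measurable_itv _); rewrite setTI.
by congr measurable; apply/seteqP; split => x; rewrite /J /= in_itv.
Qed.

Lemma continuous_measurable_rV n (f : 'rV[R]_n -> R) :
  continuous f -> measurable_fun setT (f : _ -> measurableTypeR R).
Proof.
move=> cf; apply: (measurability _ (RGenOInfty.measurableE R)).
move=> _ [_ [a ->] <-]; rewrite setTI; apply: sub_sigma_algebra.
by apply: open_comp; [move=> v _; exact: cf|exact: interval_open].
Qed.

Lemma open_measurable_rV n (U : set 'rV[R]_n) : open U -> measurable U.
Proof. exact: sub_sigma_algebra. Qed.

Lemma measurable_upd n (i : 'I_n) :
  measurable_fun setT (fun p : 'rV[R]_n * measurableTypeR R => upd i p.1 p.2).
Proof.
apply: measurable_rV => j; rewrite /upd.
have [->|ji] := eqVneq j i.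
  by under eq_fun do rewrite mxE eqxx; exact: measurable_snd.
under eq_fun do rewrite mxE (negbTE ji).
exact: (measurableT_comp (measurable_rV_coord j)).
Qed.

Lemma measurable_upd1 n (i : 'I_n) x :
  measurable_fun setT (fun t : measurableTypeR R => upd i x t).
Proof.
apply: measurable_rV => j; rewrite /upd.
have [->|ji] := eqVneq j i.
  by under eq_fun do rewrite mxE eqxx; exact: measurable_id.
by under eq_fun do rewrite mxE (negbTE ji); exact: measurable_cst.
Qed.

Lemma measurable_flip n (e : 'I_n -> bool) : measurable_fun setT (@flip n e).
Proof.
apply: measurable_rV => j; rewrite /flip; under eq_fun do rewrite mxE.
case: (e j); last exact: measurable_rV_coord.
by apply: measurable_funB => //; exact: measurable_rV_coord.
Qed.

Lemma flipK n (e : 'I_n -> bool) : involutive (@flip n e).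
Proof.
by move=> x; apply/rowP => j; rewrite !mxE; case: (e j); rewrite // subKr.
Qed.

Lemma cube_cons n t (y : 'rV[R]_n) :
  cube (rV_cons (t, y)) <-> 0 <= t <= 1 /\ cube y.
Proof.
split=> [h|[t01 h] i].
  split; first by have := h 0; rewrite /rV_cons mxE unlift_none.
  by move=> i; have := h (lift 0 i); rewrite /rV_cons mxE liftK.
by rewrite /rV_cons mxE; case: unliftP.
Qed.

Lemma upd_cons0 n s (y : 'rV[R]_n) t : upd 0 (rV_cons (s, y)) t = rV_cons (t, y).
Proof.
by apply/rowP => j; rewrite !mxE; case: unliftP => [k ->|->].
Qed.

Lemma upd_consS n (i : 'I_n) s (y : 'rV[R]_n) t :
  upd (lift 0 i) (rV_cons (s, y)) t = rV_cons (s, upd i y t).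
Proof.
apply/rowP => j; rewrite !mxE; case: unliftP => [k ->|->] //.
by rewrite (inj_eq (@lift_inj _ _)) mxE.
Qed.

Lemma flip_cons n (e : 'I_n.+1 -> bool) s (y : 'rV[R]_n) :
  flip e (rV_cons (s, y)) =
  rV_cons (if e 0 then 1 - s else s, flip (fun i => e (lift 0 i)) y).
Proof.
by apply/rowP => j; rewrite !mxE; case: unliftP => [k ->|->] //=; rewrite mxE.
Qed.

Lemma measurable_cube n : measurable (@cube R n).
Proof.
apply: measurable_forall => i.
have := @measurable_rV_coord R n i measurableT [set` `[0%R : R, 1%R]] (measurable_itv _).
by rewrite setTI; congr measurable; apply/seteqP; split => x; rewrite /= in_itv.
Qed.

Lemma measurable_rV_cons1 n (t : R) :
  measurable_fun setT (fun y : 'rV[R]_n => rV_cons (t, y)).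
Proof.
apply: measurable_rV => j; rewrite /rV_cons; under eq_fun do rewrite mxE /=.
by case: unlift => [k|]; [exact: measurable_rV_coord|exact: measurable_cst].
Qed.

End coordinates.
#[global] Hint Extern 0 (measurable cube) => apply: measurable_cube : core.

Section cube_integral.
Context (R : realType).
Local Open Scope ereal_scope.
Local Notation L n := (@lebesgue_rV R n).
Local Notation I01 := [set` `[0%R : R, 1%R]].
Local Notation lam := (@lebesgue_measure R).

Lemma cube_integral_rec n (f : 'rV[R]_n.+1 -> \bar R) :
  measurable_fun setT f -> (forall x, 0 <= f x) ->
  \int[L n.+1]_(x in cube) f x =
  \int[lam]_(t in I01) \int[L n]_(y in cube) f (rV_cons (t, y)).
Proof.
move=> mf f0.
rewrite integral_mkcond.
transitivity (\int[lam \x L n]_p ((f \_ cube) \o (@rV_cons R n)) p).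
  have h0 x : 0 <= (f \_ cube) x by rewrite patchE; case: ifP.
  have mh : measurable_fun setT (f \_ cube).
    by apply/(measurable_restrictT _ _).1 => //; exact: measurable_funTS.
  have := @ge0_integral_pushforward _ _ _ _ R _ (@measurable_rV_cons R n)
    (lam \x L n) setT (f \_ cube) measurableT mh (fun x _ => h0 x).
  by rewrite preimage_setT.
rewrite fubini_tonelli1 /fubini_F; last 2 first.
- apply: measurableT_comp; last exact: measurable_rV_cons.
  by apply/(measurable_restrictT _ _).1 => //; exact: measurable_funTS.
- by move=> x /=; rewrite patchE; case: ifP.
rewrite [RHS]integral_mkcond; apply: eq_integral => t _.
rewrite patchE; case: ifPn => ht.
  rewrite [RHS]integral_mkcond; apply: eq_integral => y _ /=.
  rewrite !patchE; congr (if _ then _ else _).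
  apply/idP/idP; rewrite !inE => hc; first by have [] := (cube_cons t y).1 hc.
  by apply/cube_cons; split => //; move: ht; rewrite inE /= in_itv.
rewrite integral0_eq// => y _ /=.
rewrite patchE ifF//; apply/negbTE; apply: contra ht; rewrite !inE.
by move=> /cube_cons[]; rewrite /= in_itv.
Qed.

Lemma lam01 : lam I01 = 1.
Proof. by rewrite lebesgue_measure_itv /= lte01 oppr0 adde0. Qed.

Lemma cube_cst n : L n cube = 1.
Proof.
elim: n => [|n ih].
  by rewrite /= diracE mem_set // => -[].
have := @cube_integral_rec n (cst 1) (measurable_cst _) (fun=> lee01).
rewrite integral_cst// mul1e => ->.
transitivity (\int[lam]_(t in I01) (cst 1 t)).
  apply: eq_integral => t _; rewrite integral_cst//= mul1e.
  exact: ih.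
by rewrite integral_cst//= mul1e lam01.
Qed.

Lemma measurable_fun_upd_integral n (i : 'I_n) (f : 'rV[R]_n -> \bar R) :
  measurable_fun setT f -> (forall x, 0 <= f x) ->
  measurable_fun setT (fun x => \int[lam]_(t in I01) f (upd i x t)).
Proof.
move=> mf f0.
pose h (p : 'rV[R]_n * measurableTypeR R) := if p.2 \in I01 then f (upd i p.1 p.2) else 0.
have mh : measurable_fun setT h.
  rewrite (_ : h = (fun p => f (upd i p.1 p.2)) \_ (snd @^-1` I01)).
    apply/(measurable_restrictT _ _).1.
      by rewrite -[X in measurable X]setTI; exact: measurable_snd.
    apply: measurable_funTS; exact: (measurableT_comp mf (measurable_upd i)).
  by apply/funext => p; rewrite patchE /h; congr (if _ then _ else _); rewrite !inE.
rewrite (_ : (fun x => _) = fubini_F lam h).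
  apply: measurable_fun_fubini_tonelli_F => // p.
  by rewrite /h; case: ifP.
apply/funext => x; rewrite /fubini_F [LHS]integral_mkcond.
by apply: eq_integral => t _; rewrite patchE.
Qed.

(** Since the sides have length 1, averaging along one coordinate preserves the integral over the
    cube. In this form Fubini applies to any coordinate without splitting it off from the vector. *)
Lemma cube_integral_upd n (i : 'I_n) (f : 'rV[R]_n -> \bar R) :
  measurable_fun setT f -> (forall x, 0 <= f x) ->
  \int[L n]_(x in cube) f x =
  \int[L n]_(x in cube) \int[lam]_(t in I01) f (upd i x t).
Proof.
elim: n i f => [[]//|n ih] i f mf f0.
have mu := measurable_fun_upd_integral i mf f0.
rewrite [RHS]cube_integral_rec//; last first.
  by move=> x; apply: integral_ge0.
rewrite [LHS]cube_integral_rec//.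
have [k ->|->] := unliftP ord0 i.
  apply: eq_integral => s _; rewrite (ih k).
  - by apply: eq_integral => y _; apply: eq_integral => t _; rewrite upd_consS.
  - exact: (measurableT_comp mf (measurable_rV_cons1 s)).
  - by move=> y.
under [RHS]eq_integral do under eq_integral do under eq_integral do rewrite upd_cons0.
rewrite integral_cst//= lam01 mule1.
(* For the first coordinate the two sides differ in the order of integration. The domain is put into
   the integrand to apply Tonelli on the full product. *)
pose Q : set (measurableTypeR R * 'rV[R]_n) := (I01 : set (measurableTypeR R)) `*` cube.
have mQ : measurable Q.
  by apply: measurableX; [exact: measurable_itv|exact: measurable_cube].
pose h (p : measurableTypeR R * 'rV[R]_n) :=
  (f \o (@rV_cons R n)) p * (\1_Q p)%:E.
have mh : measurable_fun setT h.
  apply: emeasurable_funM; first exact: (measurableT_comp mf (@measurable_rV_cons R n)).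
  apply/measurable_EFinP/measurable_indic; exact: mQ.
have h0 x : 0 <= h x by apply: mule_ge0; [exact: f0|rewrite lee_fin].
have := @fubini_tonelli _ _ _ _ R lam (L n) h mh h0.
have E t y : h (t, y) = if t \in I01 then if y \in cube then f (rV_cons (t, y)) else 0 else 0.
  rewrite /h indicE in_setX /=; case: (t \in _) => /=; last by rewrite mule0.
  by case: (y \in _); rewrite ?mule1 ?mule0.
under eq_integral do under eq_integral do rewrite E.
under [RHS]eq_integral do under eq_integral do rewrite E.
move=> hE; rewrite [LHS]integral_mkcond [RHS]integral_mkcond.
transitivity (\int[lam]_x \int[L n]_y
     (if x \in I01 then if y \in cube then f (rV_cons (x, y)) else 0 else 0)).
  apply: eq_integral => t _; rewrite patchE; case: ifP => _.
    by rewrite integral_mkcond; apply: eq_integral => y _; rewrite patchE.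
  by rewrite integral0.
rewrite hE; apply: eq_integral => y _; rewrite patchE; case: ifP => _.
  by rewrite [RHS]integral_mkcond; apply: eq_integral => t _; rewrite patchE.
by under eq_integral do rewrite if_same; rewrite integral0.
Qed.

Lemma integral_onem (f : R -> \bar R) :
  measurable_fun setT (f : measurableTypeR R -> _) -> (forall x, 0 <= f x) ->
  \int[lam]_(t in I01) f (1 - t)%R = \int[lam]_(t in I01) f t.
Proof.
move=> mf f0.
pose phi (t : measurableTypeR R) : measurableTypeR R := (1 - t)%R.
have mphi : measurable_fun setT phi by apply: measurable_funB.
have := @ge0_integral_pushforward _ _ _ _ R phi mphi lam I01 f
  (measurable_itv _) (measurable_funTS mf) (fun x _ => f0 x).
have -> : phi @^-1` I01 = I01.
  apply/seteqP; split => t /=; rewrite /phi !in_itv /= => /andP[a b].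
    by rewrite -(subKr 1%R t) subr_ge0 b /= gerBl.
  by rewrite subr_ge0 b /= gerBl.
move=> <-; apply: eq_measure_integral => /= A mA _.
apply/esym/lebesgue_measure_unique => //= _ [[a b]] _ <-; rewrite /pushforward.
rewrite (_ : phi @^-1` _ = [set` `[(1 - b)%R, (1 - a)%R[]); last first.
  apply/seteqP; split => t; rewrite /phi /= !in_itv /= => /andP[h1 h2].
    by rewrite lerBlDr addrC -lerBlDr h2 /= ltrBrDr addrC -ltrBrDr.
  by rewrite ltrBrDr addrC -ltrBrDr h2 /= lerBlDr addrC -lerBlDr.
rewrite !lebesgue_measure_itv /= !lte_fin ltrD2l ltrN2.
by case: ifP => // _; congr EFin; ring.
Qed.

Lemma cube_integral_flip n (e : 'I_n -> bool) (f : 'rV[R]_n -> \bar R) :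
  measurable_fun setT f -> (forall x, 0 <= f x) ->
  \int[L n]_(x in cube) f (flip e x) = \int[L n]_(x in cube) f x.
Proof.
elim: n e f => [|n ih] e f mf f0.
  by apply: eq_integral => x _; congr f; apply/rowP => -[].
rewrite [RHS]cube_integral_rec// cube_integral_rec//; last first.
  exact: (measurableT_comp mf (@measurable_flip R _ e)).
transitivity (\int[lam]_(t in I01) \int[L n]_(y in cube)
   f (rV_cons (if e ord0 then 1 - t else t, y))%R).
  apply: eq_integral => t _.
  rewrite -(ih (fun i => e (lift ord0 i))
    (fun y => f (rV_cons (if e ord0 then 1 - t else t, y))%R)); last 2 first.
  - exact: (measurableT_comp mf (measurable_rV_cons1 _)).
  - by move=> y.
  by apply: eq_integral => y _; rewrite flip_cons.
case: (e ord0) => //.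
rewrite (@integral_onem (fun t => \int[L n]_(y in cube) f (rV_cons (t, y))))//.
  pose h (p : measurableTypeR R * 'rV[R]_n) := if p.2 \in cube then f (rV_cons p) else 0.
  have mh : measurable_fun setT h.
    rewrite (_ : h = (fun p => f (rV_cons p)) \_ (snd @^-1` cube)).
      apply/(measurable_restrictT _ _).1.
        rewrite -[X in measurable X]setTI.
        by apply: measurable_snd => //; exact: measurable_cube.
      apply: measurable_funTS; exact: (measurableT_comp mf (@measurable_rV_cons R n)).
    by apply/funext => p; rewrite patchE /h; congr (if _ then _ else _); rewrite !inE.
  rewrite (_ : (fun x => _) = fubini_F (L n) h).
    apply: measurable_fun_fubini_tonelli_F => // p.
    by rewrite /h; case: ifP.
  apply/funext => x; rewrite /fubini_F [LHS]integral_mkcond.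
  by apply: eq_integral => t _; rewrite patchE.
by move=> x; apply: integral_ge0.
Qed.

Lemma lebesgue_rV_itv n (J : 'I_n -> interval R) :
  L n [set x | forall i, x 0%R i \in J i] = \prod_(i < n) lam [set` J i].
Proof.
elim: n J => [|n ih] J.
  by rewrite big_ord0 /= diracE mem_set// => -[].
rewrite big_ord_recl /= -(ih (fun i => J (lift ord0 i))) /pushforward.
rewrite -product_measure1E; last 2 first.
- exact: measurable_itv.
- apply: measurable_forall => i.
  have := @measurable_rV_coord R n i measurableT [set` J (lift ord0 i)] (measurable_itv _).
  by rewrite setTI.
congr (_ _); apply/seteqP; split => -[t y] /=.
  move=> h; split; first by have := h ord0; rewrite mxE unlift_none.
  by move=> i; have := h (lift ord0 i); rewrite mxE liftK.
by move=> [h1 h2] i; rewrite mxE; case: unliftP => [j ->|->].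
Qed.

Lemma lebesgue_rV_open_gt0 n (U : set 'rV[R]_n) : open U -> U !=set0 -> 0 < L n U.
Proof.
move=> oU [x Ux].
have : nbhs x U by exact: open_nbhs_nbhs.
move=> /nbhs_ballP[e /= e0 eU].
pose J (i : 'I_n) : interval R := `](x 0 i - e)%R, (x 0 i + e)%R[.
have sub : [set y : 'rV[R]_n | forall i, y 0%R i \in J i] `<=` U.
  move=> y hy; apply: eU; split => //= i j; rewrite (ord1 i).
  by have := hy j; rewrite /J in_itv /= /ball /= distrC ltr_distl.
apply: (@lt_le_trans _ _ (L n [set y : 'rV[R]_n | forall i, y 0%R i \in J i])).
  rewrite lebesgue_rV_itv (eq_bigr (fun=> (e + e)%:E)); last first.
    move=> i _; rewrite lebesgue_measure_itv /= lte_fin ltrD2l gtrN//.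
    by rewrite -EFinB; congr EFin; ring.
  rewrite -(big_morph EFin EFinM (erefl _)) lte_fin.
  by apply: prodr_gt0 => i _; rewrite addr_gt0.
apply: le_measure => //; rewrite inE; last exact: open_measurable_rV.
apply: measurable_forall => i.
have := @measurable_rV_coord R n i measurableT [set` J i] (measurable_itv _).
by rewrite setTI.
Qed.

Lemma integrable_cube n (f : 'rV[R]_n -> R) (M : R) :
  measurable_fun setT (f : _ -> measurableTypeR R) ->
  (forall x, cube x -> `|f x| <= M)%R ->
  (L n).-integrable cube (EFin \o f).
Proof.
move=> mf fM; apply: measurable_bounded_integrable => //.
- by rewrite [X in X < _]cube_cst ltry.
- exact: measurable_funTS.
- exists M; split; first exact: num_real.
  by move=> x Mx y cy /=; apply: (le_trans (fM y cy)); exact: ltW.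
Qed.

Lemma integrable_I01 (f : R -> R) (M : R) :
  measurable_fun setT (f : measurableTypeR R -> measurableTypeR R) ->
  (forall t, I01 t -> `|f t| <= M)%R -> lam.-integrable I01 (EFin \o f).
Proof.
move=> mf fM; apply: measurable_bounded_integrable => //.
- exact: (eq_ind_r (fun y : \bar R => y < +oo) (ltry 1) lam01).
- exact: measurable_funTS.
- exists M; split; first exact: num_real.
  by move=> y My t It /=; apply: (le_trans _ (ltW My)); exact: fM.
Qed.

Lemma integral_I01_bound (f : R -> R) (M : R) :
  measurable_fun setT (f : measurableTypeR R -> measurableTypeR R) ->
  (forall t, I01 t -> `|f t| <= M)%R ->
  (\int[lam]_(t in I01) (f t)%:E) \is a fin_num /\
  (`|fine (\int[lam]_(t in I01) (f t)%:E)| <= M)%R.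
Proof.
move=> mf fM; have If := integrable_I01 mf fM.
have Ifin : (\int[lam]_(t in I01) (f t)%:E) \is a fin_num.
  by apply: integrable_fin_num => //; exact: measurable_itv.
split => //.
rewrite -lee_fin -abse_EFin fineK//.
apply: (le_trans (le_abse_integral _ _ _)) => //.
  exact: (measurable_int _ If).
apply: (@le_trans _ _ (\int[lam]_(t in I01) (cst M%:E t))).
  apply: ge0_le_integral => //.
  - by apply/measurable_EFinP; apply: measurable_funTS; exact: measurableT_comp.
by rewrite integral_cst//= lam01 mule1.
Qed.

Lemma cube_upd n (i : 'I_n) (x : 'rV[R]_n) t : cube x -> (0 <= t <= 1)%R -> cube (upd i x t).
Proof. by move=> cx t01 j; rewrite mxE; case: ifP. Qed.

Lemma cube_flip n (e : 'I_n -> bool) (x : 'rV[R]_n) : cube x -> cube (flip e x).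
Proof.
move=> cx j; rewrite mxE; have /andP[a b] := cx j.
by case: ifP => _; rewrite ?a// subr_ge0 b /= gerBl.
Qed.

Lemma cube_integral_upd_bounded n (i : 'I_n) (f : 'rV[R]_n -> R) (M : R) :
  measurable_fun setT (f : _ -> measurableTypeR R) ->
  (forall x, cube x -> `|f x| <= M)%R ->
  \int[L n]_(x in cube) (f x)%:E =
  \int[L n]_(x in cube) \int[lam]_(t in I01) (f (upd i x t))%:E.
Proof.
move=> mf fM.
(* On the cube [h] is [f + M], which is nonnegative there; the maximum makes it nonnegative
   everywhere. *)
pose h x := (Num.max 0 (f x + M))%:E.
have mh : measurable_fun setT h.
  by apply/measurable_EFinP; apply: measurable_maxr => //; exact: measurable_funD.
have h0 x : 0 <= h x by rewrite lee_fin le_max lexx.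
have hE x : cube x -> h x = (f x)%:E + M%:E.
  move=> cx; rewrite /h -EFinD; congr EFin; apply/max_idPr.
  by rewrite -lerBlDr sub0r; have := fM x cx; rewrite ler_norml => /andP[].
have mfu x : measurable_fun setT (fun t : measurableTypeR R => f (upd i x t)).
  exact: (measurableT_comp mf (measurable_upd1 i x)).
have fMu x t : cube x -> I01 t -> (`|f (upd i x t)| <= M)%R.
  by rewrite /= in_itv /= => cx t01; apply: fM; exact: cube_upd.
have iu x : cube x -> lam.-integrable I01 (fun t => (f (upd i x t))%:E).
  by move=> cx; exact: (integrable_I01 (mfu x) (fun t => fMu x t cx)).
have ic : (L n).-integrable cube (EFin \o cst M).
  exact: (@integrable_cube n (cst M) `|M|%R (measurable_cst _) (fun _ _ => lexx _)).
have uE x : cube x -> \int[lam]_(t in I01) h (upd i x t) =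
    \int[lam]_(t in I01) (f (upd i x t))%:E + M%:E.
  move=> cx; under eq_integral => t.
    rewrite inE /= in_itv /= => t01; rewrite hE; last exact: cube_upd.
    over.
  rewrite integralD//=; last 2 first.
  - exact: iu.
  - exact: (@integrable_I01 (cst M) `|M|%R (measurable_cst _) (fun _ _ => lexx _)).
  by rewrite integral_cst//= lam01 mule1.
have := cube_integral_upd i mh h0.
have -> : \int[L n]_(x in cube) h x = \int[L n]_(x in cube) (f x)%:E + M%:E.
  transitivity (\int[L n]_(x in cube) ((f x)%:E + (cst M x)%:E)).
    by apply: eq_integral => x; rewrite inE => cx; rewrite hE.
  rewrite integralD//=.
  - by rewrite integral_cst//= [X in _ * X]cube_cst mule1.
  - exact: integrable_cube fM.
pose F x := \int[lam]_(t in I01) (f (upd i x t))%:E.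
have FE x : cube x -> F x = (fine (F x))%:E /\ (`|fine (F x)| <= M)%R.
  move=> cx; have [fF le] := integral_I01_bound (mfu x) (fun t => fMu x t cx).
  by rewrite fineK.
have mF : (L n).-integrable cube F.
  have mu := measurable_fun_upd_integral i mh h0.
  apply: (eq_integrable _ (EFin \o (fun x => fine (\int[lam]_(t in I01) h (upd i x t)) - M)%R)) => //.
    by move=> x; rewrite inE => cx /=; rewrite uE// -/(F x) (FE x cx).1 /= addrK.
  apply: (@integrable_cube _ _ M).
    apply: measurable_funB; last exact: measurable_cst.
    by apply: (measurableT_comp _ mu).
  by move=> x cx; rewrite uE// -/(F x) (FE x cx).1 /= addrK (FE x cx).2.
have -> : \int[L n]_(x in cube) (\int[lam]_(t in I01) h (upd i x t)) =
   \int[L n]_(x in cube) F x + M%:E.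
  transitivity (\int[L n]_(x in cube) (F x + (cst M x)%:E)).
    by apply: eq_integral => x; rewrite inE => cx; rewrite uE.
  rewrite integralD//=.
  - by rewrite integral_cst//= [X in _ * X]cube_cst mule1.
by move=> hh; rewrite -[LHS](@addeK _ M%:E)// hh addeK.
Qed.

Lemma cube_integral_flip_signed n (e : 'I_n -> bool) (f : 'rV[R]_n -> \bar R) :
  measurable_fun setT f ->
  \int[L n]_(x in cube) f (flip e x) = \int[L n]_(x in cube) f x.
Proof.
move=> mf; rewrite [LHS]integralE [RHS]integralE; congr (_ - _).
  rewrite -(cube_integral_flip e (measurable_funepos mf)) => [|x].
    by apply: eq_integral => x _; rewrite !funeposE.
  exact: funepos_ge0.
rewrite -(cube_integral_flip e (measurable_funeneg mf)) => [|x].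
  by apply: eq_integral => x _; rewrite !funenegE.
exact: funeneg_ge0.
Qed.

Lemma measurable_itv_box n (J : 'I_n -> interval R) :
  measurable [set x : 'rV[R]_n | forall i, x 0%R i \in J i].
Proof.
apply: measurable_forall => i.
have := @measurable_rV_coord R n i measurableT [set` J i] (measurable_itv _).
by rewrite setTI.
Qed.

Lemma open_cubeE n :
  @open_cube R n = [set x | forall i, x 0%R i \in `]0%R, 1%R[].
Proof. by apply/seteqP; split => x h i; have := h i; rewrite in_itv. Qed.

Lemma measurable_open_cube n : measurable (@open_cube R n).
Proof. by rewrite open_cubeE; exact: measurable_itv_box. Qed.

Lemma open_open_cube n : open (@open_cube R n).
Proof.
have <- : rV_box [ffun=> (0%Q, 1%Q)] = @open_cube R n.
  by apply/seteqP; split => x h i; have := h i; rewrite ffunE /= rmorph0 rmorph1.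
exact: open_rV_boxP.
Qed.

Lemma sub_open_cube n : @open_cube R n `<=` cube.
Proof. by move=> x h i; have /andP[a b] := h i; rewrite !ltW. Qed.

Lemma cube_boundary_null n : L n (cube `\` open_cube) = 0.
Proof.
have o1 : L n open_cube = 1.
  rewrite open_cubeE lebesgue_rV_itv big1// => i _.
  by rewrite lebesgue_measure_itv /= lte01 oppr0 adde0.
rewrite measureD.
- by rewrite (setIidr (@sub_open_cube n)) [X in X - _]cube_cst [X in _ - X]o1 subee.
- exact: measurable_cube.
- exact: measurable_open_cube.
- by rewrite [X in X < _]cube_cst ltry.
Qed.

End cube_integral.

(** * Volumes of tubes *)

Section trig_integrals.
Context (R : realType).
Local Notation lam := (@lebesgue_measure R).

(* [cosint m] is the antiderivative of [cos ^+ m] vanishing at [0]. *)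
Fixpoint cosint2 m : (R -> R) * (R -> R) :=
  if m is m'.+1 then
    ((cosint2 m').2, fun x => (cos x ^+ m'.+1 * sin x + m'.+1%:R * (cosint2 m').1 x) / m'.+2%:R)
  else (id, sin).

Definition cosint m := (cosint2 m).1.

Lemma cosint0 x : cosint 0 x = x. Proof. by []. Qed.
Lemma cosint1 x : cosint 1 x = sin x. Proof. by []. Qed.
Lemma cosintSS m x : cosint m.+2 x =
  (cos x ^+ m.+1 * sin x + m.+1%:R * cosint m x) / m.+2%:R.
Proof. by []. Qed.

Lemma is_derive_cosint (m : nat) (x : R) : is_derive x 1 (cosint m) (cos x ^+ m).
Proof.
suff [] : is_derive x 1 (cosint m) (cos x ^+ m) /\
  is_derive x 1 (cosint m.+1) (cos x ^+ m.+1) by [].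
elim: m => [|m [ih1 ih2]].
  by split; [exact: is_derive_id|rewrite expr1; exact: is_derive_sin].
split => //.
rewrite (_ : cosint m.+2 = (m.+2%:R^-1 *: (cos ^+ m.+1 * sin + m.+1%:R *: cosint m))); last first.
  by apply/funext => y; rewrite cosintSS mulrC !fctE.
apply: is_derive_eq.
rewrite /= -[_%:R *: (cos x ^+ m)]/(_%:R * _).
have n0 : (m.+2%:R : R) != 0 by rewrite pnatr_eq0.
have := cos2Dsin2 x; set c := cos x; set s := sin x => cs.
have ss : s * s = 1 - c * c by rewrite -cs; ring.
have -> : (cos ^+ m.+1) x = c ^+ m.+1 by rewrite fctE.
rewrite -![_ *: _]/(_ * _) !exprS.
transitivity (m.+2%:R^-1 * (c ^+ m * (c * c) +
   m.+1%:R * (c ^+ m - c ^+ m * (s * s)))); first by ring.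
by rewrite ss; field.
Qed.

Lemma cosint_at0 m : cosint m 0 = 0.
Proof.
suff [] : cosint m 0 = 0 /\ cosint m.+1 0 = 0 by [].
elim: m => [|m [ih1 ih2]]; first by rewrite cosint0 cosint1 sin0.
by split => //; rewrite cosintSS sin0 ih1 !mulr0 addr0 mul0r.
Qed.

Definition wallis m := cosint m (pi / 2).

Lemma wallis0 : wallis 0 = pi / 2. Proof. by []. Qed.

Lemma wallis1 : wallis 1 = 1. Proof. exact: sin_pihalf. Qed.

Lemma wallisSS m : wallis m.+2 = m.+1%:R / m.+2%:R * wallis m.
Proof. by rewrite /wallis cosintSS cos_pihalf exprS mul0r mul0r add0r mulrAC. Qed.

Lemma wallis_gt0 m : 0 < wallis m.
Proof.
suff [] : 0 < wallis m /\ 0 < wallis m.+1 by [].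
elim: m => [|m [ih1 ih2]].
  by rewrite wallis0 wallis1 ltr01 divr_gt0 ?pi_gt0.
by split => //; rewrite wallisSS mulr_gt0 // divr_gt0.
Qed.

Lemma wallis_le1 m : wallis m.+1 <= 1.
Proof.
suff [] : wallis m.+1 <= 1 /\ wallis m.+2 <= 1 by [].
elim: m => [|m [ih1 ih2]].
  rewrite wallis1 wallisSS wallis0 lexx; split => //.
  by have /andP[_] := (pihalf_02_cos_pihalf R).1; lra.
split => //; rewrite wallisSS mulr_ile1 ?divr_ge0//; first exact/ltW/wallis_gt0.
by rewrite ler_pdivrMr ?ltr0n// mul1r ler_nat.
Qed.

Lemma pihalf_gt0 : 0 < pi / 2 :> R.
Proof. by rewrite divr_gt0 ?pi_gt0. Qed.

Lemma continuous_comp_itv (f : R -> R) (a b : R) : continuous f -> {within `[a, b], continuous f}.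
Proof. by move=> cf; apply: continuous_subspaceT. Qed.

Lemma derivable_oo_of_is_derive (f g : R -> R) (a b : R) :
  (forall x : R, is_derive x 1 f (g x)) -> derivable_oo_LRcontinuous f a b.
Proof.
move=> df.
have cf : continuous f.
  move=> x; apply: differentiable_continuous; apply/derivable1_diffP.
  by have := df x => -[].
split => [x _||]; first by have := df x => -[].
- exact: cvg_at_right_filter (cf a).
- exact: cvg_at_left_filter (cf b).
Qed.

Lemma derive1_of_is_derive (f g : R -> R) :
  (forall x : R, is_derive x 1 f (g x)) -> derive1 f = g.
Proof. by move=> df; apply/funext => x; rewrite derive1E; exact: derive_val. Qed.

Lemma integral_cosX m :
  (\int[lam]_(x in `[0%R, (pi / 2)%R]) (cos x ^+ m)%:E = (wallis m)%:E)%E.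
Proof.
rewrite (@continuous_FTC2 _ _ (cosint m)).
- by rewrite cosint_at0 sube0.
- exact: pihalf_gt0.
- apply: continuous_comp_itv => x; apply: (@continuous_comp _ _ _ cos (fun y : R => y ^+ m)); [exact: continuous_cos|exact: exprn_continuous].
- exact: derivable_oo_of_is_derive (is_derive_cosint m).
- by move=> x _; rewrite (derive1_of_is_derive (is_derive_cosint m)).
Qed.

Lemma integral_subst_sin (r : R) (G : R -> R) : 0 < r ->
  {within `[0, r], continuous G} ->
  (\int[lam]_(x in `[0%R, r]) (G x)%:E =
   \int[lam]_(x in `[0%R, (pi / 2)%R]) (G (r * sin x) * (r * cos x))%R%:E)%E.
Proof.
move=> r0 cG.
pose F x : R := r * sin x.
have dF (x : R) : is_derive x 1 F (r * cos x).
  by rewrite /F; apply: is_derive_eq; rewrite -![_ *: _]/(_ * _); ring.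
have F'E := derive1_of_is_derive dF.
have cF' : continuous (fun x : R => r * cos x).
  by move=> x; apply: continuousM; [exact: cvg_cst|exact: continuous_cos].
have F0 : F 0 = 0 by rewrite /F sin0 mulr0.
have Fpi : F (pi / 2) = r by rewrite /F sin_pihalf mulr1.
have := @integration_by_substitution_increasing R F G 0 (pi / 2) (ltW pihalf_gt0).
rewrite F0 Fpi F'E => -> //.
- move=> x y; rewrite !in_itv /= => /andP[x0 xp] /andP[y0 yp] xy.
  rewrite /F ltr_pM2l// ltr_sin// in_itv /= ?xp ?yp ?andbT;
   by apply: (le_trans _ (_ : 0 <= _)) => //; rewrite oppr_le0 ltW// pihalf_gt0.
- by apply/cvg_ex; exists (r * cos 0); exact: cvg_at_right_filter (cF' 0).
- by apply/cvg_ex; exists (r * cos (pi / 2)); exact: cvg_at_left_filter (cF' _).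
- exact: derivable_oo_of_is_derive dF.
Qed.

Lemma integral_subst_cos (r : R) (G : R -> R) : 0 < r ->
  {within `[0, r], continuous G} ->
  (\int[lam]_(x in `[0%R, r]) (G x)%:E =
   \int[lam]_(x in `[0%R, (pi / 2)%R]) (G (r * cos x) * (r * sin x))%R%:E)%E.
Proof.
move=> r0 cG.
pose F x : R := r * cos x.
have dF (x : R) : is_derive x 1 F (- r * sin x).
  by rewrite /F; apply: is_derive_eq; rewrite -![_ *: _]/(_ * _); ring.
have F'E := derive1_of_is_derive dF.
have cF' : continuous (fun x : R => - r * sin x).
  by move=> x; apply: (@continuousM R R (cst (- r)) sin); [exact: cvg_cst|exact: continuous_sin].
have F0 : F 0 = r by rewrite /F cos0 mulr1.
have Fpi : F (pi / 2) = 0 by rewrite /F cos_pihalf mulr0.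
have := @integration_by_substitution_decreasing R F G 0 (pi / 2) (ltW pihalf_gt0).
rewrite F0 Fpi F'E => -> //.
- by apply: eq_integral => x _; rewrite !fctE mulNr opprK.
- move=> x y; rewrite !in_itv /= => /andP[x0 xp] /andP[y0 yp] xy.
  have pp : pi / 2 <= pi :> R by have := pi_ge0 R; lra.
  by rewrite /F ltr_pM2l// ltr_cos// in_itv /= ?x0 ?y0 (le_trans _ pp).
- by apply/cvg_ex; eexists; exact: cvg_at_right_filter (cF' 0).
- by apply/cvg_ex; eexists; exact: cvg_at_left_filter (cF' _).
- exact: derivable_oo_of_is_derive dF.
Qed.

Lemma continuous_chord (s : R) : continuous (fun t : R => Num.sqrt (s - t ^+ 2)).
Proof.
move=> t.
apply: (@continuous_comp _ _ _ (fun t : R => s - t ^+ 2)%R (@Num.sqrt R));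
  last exact: sqrt_continuous.
by apply: (@continuousB _ _ _ (cst s) (fun t : R => t ^+ 2)%R);
  [exact: cvg_cst|exact: exprn_continuous].
Qed.

Lemma integral_halfdisc d (r : R) : 0 < r ->
  (\int[lam]_(t in `[0%R, r]) (Num.sqrt (r ^+ 2 - t ^+ 2) ^+ d)%R%:E =
   (r ^+ d.+1 * wallis d.+1)%:E)%E.
Proof.
move=> r0.
rewrite (@integral_subst_sin r (fun t => Num.sqrt (r ^+ 2 - t ^+ 2) ^+ d))//; last first.
  apply: continuous_comp_itv => t.
  apply: (@continuous_comp _ _ _ (fun t : R => Num.sqrt (r ^+ 2 - t ^+ 2)) (fun y : R => y ^+ d));
    [exact: continuous_chord|exact: exprn_continuous].
transitivity (\int[lam]_(x in `[0%R, (pi / 2)%R]) ((r ^+ d.+1)%:E * (cos x ^+ d.+1)%:E))%E.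
  apply: eq_integral => x; rewrite inE /= in_itv /= => /andP[x0 xp].
  rewrite -EFinM; congr EFin.
  have -> : r ^+ 2 - (r * sin x) ^+ 2 = (r * cos x) ^+ 2.
    by rewrite !exprMn -{1}(mulr1 (r ^+ 2)) -(cos2Dsin2 x); ring.
  rewrite sqrtr_sqr ger0_norm; first by rewrite -exprSr exprMn.
  apply: mulr_ge0; first exact: ltW.
  apply: cos_ge0_pihalf; rewrite xp andbT.
  by rewrite (le_trans _ x0)// oppr_le0 ltW// pihalf_gt0.
rewrite ge0_integralZl//; first by rewrite integral_cosX.
- apply/measurable_EFinP; apply: measurable_funTS.
  apply: (measurableT_comp (exprn_measurable _)).
  by apply: continuous_measurable_fun; exact: continuous_cos.
- move=> x; rewrite /= in_itv /= => /andP[x0 xp]; rewrite lee_fin exprn_ge0//.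
  by rewrite cos_ge0_pihalf// xp andbT (le_trans _ x0)// oppr_le0 ltW// pihalf_gt0.
- by rewrite lee_fin exprn_ge0// ltW.
Qed.

(** This is B_d: slicing the unit ball of the orthant along one axis gives B_(d-1) times the
    integral of (1 - t^2)^((d-1)/2), which is [wallis d]. *)
Fixpoint ball_orthant d : R := if d is d'.+1 then ball_orthant d' * wallis d else 1.

Lemma ball_orthant_gt0 d : 0 < ball_orthant d.
Proof. by elim: d => //= d ih; rewrite mulr_gt0 // wallis_gt0. Qed.

Lemma ball_orthant_nonincreasing d d' : (d <= d')%N -> ball_orthant d' <= ball_orthant d.
Proof.
elim: d' => [|d' ih]; first by rewrite leqn0 => /eqP ->.
rewrite leq_eqVlt => /predU1P[->//|]; rewrite ltnS => /ih; apply: le_trans => /=.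
by rewrite ler_piMr ?wallis_le1// ltW// ball_orthant_gt0.
Qed.

Local Notation I01 := [set` `[0%R : R, 1%R]].
Local Open Scope ereal_scope.

(* [orthant_ball_volume d rho] is the volume of the part of the ball of squared
   radius [rho] about a vertex of the [d]-cube that lies in the cube. *)
Fixpoint orthant_ball_volume d : R -> \bar R := fun rho =>
  if d is d'.+1 then \int[lam]_(t in I01) orthant_ball_volume d' (rho - t ^+ 2)%R
  else ((0 <= rho)%R%:R)%:E.

Lemma orthant_ball_volume_ge0 d rho : 0 <= orthant_ball_volume d rho.
Proof.
elim: d rho => [|d ih] rho /=; first by rewrite lee_fin.
by apply: integral_ge0.
Qed.

Lemma measurable_orthant_ball_volume d :
  measurable_fun setT (orthant_ball_volume d : measurableTypeR R -> \bar R).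
Proof.
elim: d => [|d ih] /=.
  apply/measurable_EFinP.
  rewrite (_ : (fun _ => _) = \1_[set` `[0%R, +oo[]).
    apply: measurable_indic; exact: measurable_itv.
  by apply/funext => x; rewrite indicE; congr (nat_of_bool _)%:R;
    apply/idP/idP; rewrite inE /= in_itv /= andbT.
pose h (p : measurableTypeR R * measurableTypeR R) :=
  orthant_ball_volume d (p.1 - p.2 ^+ 2)%R * (\1_I01 p.2)%:E.
have mh : measurable_fun setT h.
  apply: emeasurable_funM.
    apply: (measurableT_comp ih); apply: measurable_funB => //.
    exact: (measurableT_comp (exprn_measurable _)).
  apply/measurable_EFinP; apply: (measurableT_comp _ measurable_snd).
  apply: measurable_indic; exact: measurable_itv.
rewrite (_ : (fun x => _) = fubini_F lam h).
  apply: measurable_fun_fubini_tonelli_F => // p.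
  by apply: mule_ge0; [exact: orthant_ball_volume_ge0|rewrite lee_fin].
apply/funext => x; rewrite /fubini_F [LHS]integral_mkcond.
apply: eq_integral => t _; rewrite patchE /h /= indicE.
by case: (t \in _); rewrite ?mule1 ?mule0.
Qed.

Lemma orthant_ball_volume_lt0 d rho : (rho < 0)%R -> orthant_ball_volume d rho = 0.
Proof.
elim: d rho => [|d ih] rho rho0 /=; first by rewrite leNgt rho0.
by apply: integral0_eq => t _; apply: ih; rewrite subr_lt0 (lt_le_trans rho0)// sqr_ge0.
Qed.

Lemma integral_scaled_halfdisc d (r : R) : (0 <= r)%R ->
  \int[lam]_(t in `[0%R, r]) (ball_orthant d * Num.sqrt (r ^+ 2 - t ^+ 2) ^+ d)%R%:E =
  (ball_orthant d.+1 * r ^+ d.+1)%R%:E.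
Proof.
rewrite le_eqVlt => /predU1P[<-|r0].
  by rewrite set_itv1 integral_set1 exprS mul0r mulr0.
under eq_integral do rewrite EFinM.
rewrite ge0_integralZl//; first by rewrite integral_halfdisc// -EFinM; congr EFin => /=; ring.
- apply/measurable_EFinP; apply: measurable_funTS.
  apply: (measurableT_comp (exprn_measurable _)).
  by apply: continuous_measurable_fun; exact: continuous_chord.
- by rewrite lee_fin; exact/ltW/ball_orthant_gt0.
Qed.

(** Only an upper bound: once [rho] exceeds 1, part of the ball lies outside the cube. *)
Lemma orthant_ball_volume_le d rho : (0 <= rho)%R ->
  orthant_ball_volume d rho <= (ball_orthant d * Num.sqrt rho ^+ d)%R%:E.
Proof.
elim: d rho => [|d ih] rho rho0; first by rewrite /= rho0 expr0 mulr1.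
rewrite -integral_scaled_halfdisc ?sqrtr_ge0// sqr_sqrtr//.
rewrite /= integral_mkcond [leRHS]integral_mkcond; apply: ge0_le_integral => //.
- by move=> t _; rewrite patchE; case: ifP => // _; exact: orthant_ball_volume_ge0.
- apply/(measurable_restrictT _ _).1; first exact: measurable_itv.
  apply: measurable_funTS; apply: (measurableT_comp (measurable_orthant_ball_volume d)).
  by apply: measurable_funB => //; exact: (measurableT_comp (exprn_measurable _)).
- apply/(measurable_restrictT _ _).1; first exact: measurable_itv.
  apply/measurable_EFinP; apply: measurable_funTS; apply: measurable_funM => //.
  apply: (measurableT_comp (exprn_measurable _)).
  by apply: continuous_measurable_fun; exact: continuous_chord.
- move=> t _; rewrite !patchE; case: ifPn => [|_]; last first.
    case: ifP => // _; rewrite lee_fin mulr_ge0 ?exprn_ge0 ?sqrtr_ge0//.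
    exact/ltW/ball_orthant_gt0.
  rewrite inE /= in_itv /= => /andP[t0 _]; case: ifPn => [|].
    rewrite inE /= in_itv /= t0 /= => tr; apply: ih; rewrite subr_ge0.
    by rewrite -(sqr_sqrtr rho0) ler_pXn2r// nnegrE ?sqrtr_ge0.
  rewrite notin_setE /= in_itv /= t0 /= => /negP; rewrite -ltNge => tr.
  rewrite orthant_ball_volume_lt0// subr_lt0 -(sqr_sqrtr rho0) ltr_pXn2r//.
  by rewrite nnegrE sqrtr_ge0.
Qed.

Lemma orthant_ball_volumeE d rho : (0 <= rho <= 1)%R ->
  orthant_ball_volume d rho = (ball_orthant d * Num.sqrt rho ^+ d)%R%:E.
Proof.
elim: d rho => [|d ih] rho /andP[rho0 rho1]; first by rewrite /= rho0 expr0 mulr1.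
rewrite -integral_scaled_halfdisc ?sqrtr_ge0// sqr_sqrtr//.
rewrite /= integral_mkcond [RHS]integral_mkcond; apply: eq_integral => t _.
have s1 : (Num.sqrt rho <= 1)%R by rewrite -sqrtr1 ler_sqrt.
rewrite !patchE; case: ifPn => [|]; rewrite ?notin_setE ?inE /= in_itv /=.
  move=> /andP[t0 _]; case: ifPn; rewrite ?notin_setE ?inE /= in_itv /= t0 /=.
    move=> tr; apply: ih; rewrite subr_ge0 -(sqr_sqrtr rho0) ler_pXn2r ?nnegrE ?sqrtr_ge0//.
    by rewrite tr sqr_sqrtr// lerBlDr (le_trans rho1)// lerDl sqr_ge0.
  move=> /negP; rewrite -ltNge => tr; rewrite orthant_ball_volume_lt0// subr_lt0.
  by rewrite -(sqr_sqrtr rho0) ltr_pXn2r// nnegrE sqrtr_ge0.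
move=> h; rewrite ifF//; apply/negbTE; rewrite notin_setE /= in_itv /=.
by move=> /andP[t0 tr]; apply: h; rewrite t0 (le_trans tr).
Qed.

Definition partial_sqnorm n (P : {set 'I_n}) (z : 'rV[R]_n) : R :=
  (\sum_(i in P) z 0%R i ^+ 2)%R.

Lemma continuous_partial_sqnorm n (P : {set 'I_n}) : continuous (partial_sqnorm P).
Proof.
have h i : continuous (fun z : 'rV[R]_n => z 0%R i ^+ 2)%R.
  move=> z.
  apply: (@continuous_comp _ _ _ (fun z : 'rV[R]_n => z 0%R i) (fun y : R => y ^+ 2)%R).
    exact: coord_continuous.
  exact: exprn_continuous.
have := @continuous_big R 'I_n +%R 0%R (fun i => i \in P) (@add_continuous R) 'rV[R]_n
  (index_enum 'I_n) (fun i (z : 'rV[R]_n) => z 0%R i ^+ 2)%R.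
by apply.
Qed.

Lemma partial_sqnorm_upd n (P : {set 'I_n}) k (z : 'rV[R]_n) t : k \notin P ->
  partial_sqnorm P (upd k z t) = partial_sqnorm P z.
Proof.
move=> kP; apply: eq_bigr => i iP; rewrite mxE ifF//.
by apply/negbTE; apply: contraNneq kP => <-.
Qed.

Lemma measurable_partial_sqnorm n (P : {set 'I_n}) :
  measurable_fun setT (partial_sqnorm P : _ -> measurableTypeR R).
Proof. apply: continuous_measurable_rV; exact: continuous_partial_sqnorm. Qed.

(** The points of the cube within [sqrt rho] of the face on which the coordinates in [P] vanish.
    With squared radii, fixing a coordinate in [P] at [t] gives a tube with parameter
    [rho - t ^+ 2]. *)
Definition orthant_tube n (P : {set 'I_n}) (rho : R) : set 'rV[R]_n :=
  [set z | cube z /\ (partial_sqnorm P z <= rho)%R].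

Lemma measurable_sqnorm_le n (P : {set 'I_n}) (rho : R) :
  measurable [set z | (partial_sqnorm P z <= rho)%R].
Proof.
have := @measurable_partial_sqnorm n P measurableT [set` `]-oo, rho]] (measurable_itv _).
by rewrite setTI; congr measurable; apply/seteqP; split => x; rewrite /= in_itv.
Qed.

Lemma measurable_orthant_tube n (P : {set 'I_n}) (rho : R) : measurable (orthant_tube P rho).
Proof.
apply: measurableI; [exact: measurable_cube|exact: measurable_sqnorm_le].
Qed.

(** Peeling off the first coordinate either performs one step of the recursion for the ball or, for
    a coordinate outside [P], integrates a constant over an interval of length 1. *)
Lemma lebesgue_orthant_tube n (P : {set 'I_n}) (rho : R) :
  lebesgue_rV (orthant_tube P rho) = orthant_ball_volume #|P| rho.
Proof.
elim: n P rho => [|n ih] P rho.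
  have s0 z : partial_sqnorm P z = 0%R by rewrite /partial_sqnorm big_ord0.
  rewrite /= diracE -sum1_card big_ord0 /=; congr (nat_of_bool _)%:R%:E.
  case: (boolP (0 <= rho)%R) => h.
    by rewrite mem_set//; split; [case|rewrite s0].
  by rewrite memNset// => -[_]; rewrite s0; apply/negP.
pose A k (Q : {set 'I_k}) (r : R) := [set z : 'rV[R]_k | (partial_sqnorm Q z <= r)%R].
have LA k (Q : {set 'I_k}) r :
    \int[@lebesgue_rV R k]_(z in cube) (\1_(A k Q r) z)%:E = lebesgue_rV (orthant_tube Q r).
  rewrite integral_indic//; last exact: measurable_sqnorm_le.
  by rewrite setIC.
pose P' : {set 'I_n} := [set i | lift ord0 i \in P]%SET.
have cP : #|P| = ((ord0 \in P) + #|P'|)%N.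
  rewrite -!sum1_card big_mkcond big_ord_recl /= [in RHS]big_mkcond /=; congr addn.
  by apply: eq_bigr => i _; rewrite inE.
have sP t y : partial_sqnorm P (rV_cons (t, y)) =
    ((if ord0 \in P then t ^+ 2 else 0) + partial_sqnorm P' y)%R.
  rewrite /partial_sqnorm big_mkcond big_ord_recl /= [in RHS]big_mkcond /= mxE unlift_none.
  by congr (_ + _)%R; apply: eq_bigr => i _; rewrite mxE liftK inE.
rewrite -LA cube_integral_rec; last 2 first.
- apply/measurable_EFinP/measurable_indic; exact: measurable_sqnorm_le.
- by move=> x; rewrite lee_fin.
have E t : \int[@lebesgue_rV R n]_(y in cube) (\1_(A _ P rho) (rV_cons (t, y)))%:E =
    orthant_ball_volume #|P'| (rho - (if ord0 \in P then t ^+ 2 else 0))%R.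
  rewrite -ih -LA; apply: eq_integral => y _; rewrite !indicE; congr (nat_of_bool _)%:R%:E.
  by apply/idP/idP; rewrite !inE /A /= sP lerBrDl.
under eq_integral do rewrite E.
rewrite cP; case: (ord0 \in P) => //.
by rewrite integral_cst//= lam01 mule1 subr0.
Qed.

End trig_integrals.

(** * Hausdorff measure *)

Section euclidean_norm.
Context (R : realType) (n : nat).
Implicit Types x y : 'rV[R]_n.

Lemma edotxx x : edot x x = \sum_i x 0 i ^+ 2.
Proof. by apply: eq_bigr => i _; rewrite expr2. Qed.

Lemma edotxx_ge0 x : 0 <= edot x x.
Proof. by rewrite edotxx; apply: sumr_ge0 => i _; exact: sqr_ge0. Qed.

Lemma enorm_ge0 x : 0 <= enorm x. Proof. exact: sqrtr_ge0. Qed.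

Lemma sqr_enorm x : enorm x ^+ 2 = \sum_i x 0 i ^+ 2.
Proof. by rewrite /enorm sqr_sqrtr ?edotxx_ge0// edotxx. Qed.

Lemma enorm0 : enorm (0 : 'rV[R]_n) = 0.
Proof.
by apply/eqP; rewrite -sqrf_eq0 sqr_enorm big1// => i _; rewrite mxE expr0n.
Qed.

Lemma enormN x : enorm (- x) = enorm x.
Proof.
by rewrite /enorm !edotxx; congr Num.sqrt; apply: eq_bigr => i _; rewrite mxE sqrrN.
Qed.

Lemma enormB x y : enorm (x - y) = enorm (y - x).
Proof. by rewrite -enormN opprB. Qed.

Lemma coord_le_enorm x i : `|x 0 i| <= enorm x.
Proof.
rewrite -ler_sqr ?nnegrE ?enorm_ge0// sqr_enorm real_normK ?num_real//.
by rewrite (bigD1 i)//= lerDl; apply: sumr_ge0 => j _; exact: sqr_ge0.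
Qed.

Lemma enorm_le x (r : R) : 0 <= r ->
  (enorm x <= r) = (\sum_i x 0 i ^+ 2 <= r ^+ 2).
Proof. by move=> r0; rewrite -ler_sqr ?nnegrE ?enorm_ge0// sqr_enorm. Qed.

Lemma eballP x y (r : R) : 0 < r -> eball x r y <-> \sum_i (y 0 i - x 0 i) ^+ 2 < r ^+ 2.
Proof.
move=> r0; rewrite /eball /= -ltr_sqr ?nnegrE ?enorm_ge0 ?(ltW r0)// sqr_enorm.
rewrite (eq_bigr (fun i => (y 0 i - x 0 i) ^+ 2)); first by split.
by move=> i _; rewrite !mxE.
Qed.

Lemma continuous_sqdist x : continuous (fun y : 'rV[R]_n => \sum_i (y 0 i - x 0 i) ^+ 2).
Proof.
have h i : continuous (fun y : 'rV[R]_n => (y 0 i - x 0 i) ^+ 2).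
  move=> z.
  apply: (@continuous_comp _ _ _ (fun y : 'rV[R]_n => y 0 i - x 0 i) (fun y : R => y ^+ 2)).
    apply: (@continuousB _ _ _ (fun y : 'rV[R]_n => y 0 i) (cst (x 0 i))); last exact: cst_continuous.
    exact: coord_continuous.
  exact: exprn_continuous.
have := @continuous_big R 'I_n +%R 0 xpredT (@add_continuous R) 'rV[R]_n
  (index_enum 'I_n) (fun i (y : 'rV[R]_n) => (y 0 i - x 0 i) ^+ 2).
by apply.
Qed.

Lemma eball_le0 x (r : R) : r <= 0 -> eball x r = set0.
Proof.
by move=> r0; apply/seteqP; split => y //=; rewrite /eball /= ltNge (le_trans r0 (enorm_ge0 _)).
Qed.

Lemma open_eball x (r : R) : open (eball x r).
Proof.
have [r0|r0] := ltP 0 r; last by rewrite eball_le0//; exact: open0.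
rewrite (_ : eball x r = (fun y : 'rV[R]_n => \sum_i (y 0 i - x 0 i) ^+ 2) @^-1` [set t | t < r ^+ 2]).
  by apply: open_comp; [move=> y _; exact: continuous_sqdist|exact: open_lt].
by apply/seteqP; split => y /=; rewrite eballP.
Qed.

Lemma eball_center x (r : R) : 0 < r -> eball x r x.
Proof. by move=> r0; rewrite /eball /= subrr enorm0. Qed.

End euclidean_norm.

Section hausdorff_theory.
Context (R : realType) (n s : nat).
Implicit Types A B : set 'rV[R]_n.
Local Open Scope ereal_scope.

Local Notation omega := (lebesgue_rV (eball (0%R : 'rV[R]_s) 1%R)).

Lemma unit_ball_gt0 : 0 < omega.
Proof.
apply: lebesgue_rV_open_gt0; first exact: open_eball.
by exists 0%R; exact: eball_center.
Qed.

Lemma unit_ball_fin_num : omega \is a fin_num.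
Proof.
rewrite ge0_fin_numE; last exact: measure_ge0.
apply: (@le_lt_trans _ _ (lebesgue_rV [set x : 'rV[R]_s | forall i, x 0%R i \in `[-1, 1]%R])).
  apply: le_measure; rewrite ?inE.
  - by apply: open_measurable_rV; exact: open_eball.
  - exact: measurable_itv_box.
  move=> x; rewrite /eball /= subr0 => x1 i; rewrite in_itv /= -ler_norml.
  exact: (le_trans (coord_le_enorm x i) (ltW x1)).
rewrite lebesgue_rV_itv (eq_bigr (fun=> 2%:E)); last first.
  move=> i _; rewrite lebesgue_measure_itv /= lte_fin.
  by rewrite (_ : (-1 < 1)%R) ?opprK//; lra.
by rewrite -(big_morph EFin EFinM (erefl _)) ltry.
Qed.

Lemma ediam_ge0 A : A !=set0 -> 0 <= ediam A.
Proof.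
move=> [x Ax]; apply: le_ereal_sup_tmp; exists (enorm (x - x))%:E.
  by exists x => //; exists x.
by rewrite lee_fin enorm_ge0.
Qed.

Lemma ediam_sub A B : A `<=` B -> ediam A <= ediam B.
Proof.
move=> AB; apply: ereal_sup_le => _ [x Ax [y Ay <-]].
by exists x; [exact: AB|exists y => //; exact: AB].
Qed.

Lemma enorm_le_ediam A x y : A x -> A y -> (enorm (x - y))%:E <= ediam A.
Proof. by move=> Ax Ay; apply: ereal_sup_ubound; exists x => //; exists y. Qed.

Lemma weight_set0 : hausdorff_weight s (set0 : set 'rV[R]_n) = 0.
Proof. by rewrite /hausdorff_weight eqxx. Qed.

Lemma weight_ge0 A : 0 <= hausdorff_weight s A.
Proof.
rewrite /hausdorff_weight; case: ifPn => // /set0P A0.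
apply: mule_ge0; first exact/ltW/unit_ball_gt0.
by apply/expe_ge0/mule_ge0; [rewrite lee_fin invr_ge0|exact: ediam_ge0].
Qed.

Lemma lee_expe (x y : \bar R) k : 0 <= x -> x <= y -> x ^+ k <= y ^+ k.
Proof.
move=> x0 xy; elim: k => // k ih; rewrite !expeS lee_pmul ?expe_ge0//.
Qed.

Lemma weight_sub A B : A `<=` B -> hausdorff_weight s A <= hausdorff_weight s B.
Proof.
move=> AB; have [->|/set0P A0] := eqVneq A set0; first by rewrite weight_set0 weight_ge0.
rewrite /hausdorff_weight.
have /set0P/negbTE -> := A0.
have /set0P/negbTE -> : B !=set0 by case: A0 => x /AB; exists x.
have d0 := ediam_ge0 A0.
have h0 : 0 <= (2^-1)%:E * ediam A by apply: mule_ge0 => //; rewrite lee_fin invr_ge0.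
apply: lee_pmul; [exact/ltW/unit_ball_gt0|exact: expe_ge0|exact: lexx|].
by apply: lee_expe => //; apply: lee_pmul; [rewrite lee_fin invr_ge0|exact: d0|exact: lexx|exact: ediam_sub].
Qed.

Lemma hausdorff_pre_ge0 d A : 0 <= hausdorff_pre s d A.
Proof.
apply: le_ereal_inf_tmp => _ [C _ <-]; apply: nneseries_ge0 => k _ _; exact: weight_ge0.
Qed.

Lemma hausdorff_pre_le d A (C : (set 'rV[R]_n)^nat) :
  A `<=` \bigcup_k C k -> (forall k, ediam (C k) <= d%:E) ->
  hausdorff_pre s d A <= \sum_(0 <= k <oo) hausdorff_weight s (C k).
Proof. by move=> AC Cd; apply: ereal_inf_lbound; exists C. Qed.

Lemma hausdorff_pre_sub d A B : A `<=` B -> hausdorff_pre s d A <= hausdorff_pre s d B.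
Proof.
move=> AB; apply: le_ereal_inf_tmp => _ [C [BC Cd] <-].
by apply: hausdorff_pre_le => //; exact: subset_trans BC.
Qed.

Lemma hausdorff_pre_nonincreasing d d' A : (d <= d')%R ->
  hausdorff_pre s d' A <= hausdorff_pre s d A.
Proof.
move=> dd'; apply: le_ereal_inf_tmp => _ [C [BC Cd] <-].
by apply: hausdorff_pre_le => // k; rewrite (le_trans (Cd k))// lee_fin.
Qed.

Lemma hausdorff_pre_le_hausdorff d A : (0 < d)%R -> hausdorff_pre s d A <= hausdorff s A.
Proof. by move=> d0; apply: ereal_sup_ubound; exists d. Qed.

Lemma hausdorff_le A (M : \bar R) :
  (forall d, (0 < d)%R -> hausdorff_pre s d A <= M) -> hausdorff s A <= M.
Proof. by move=> h; apply: ge_ereal_sup => _ [d /= d0 <-]; exact: h. Qed.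

Lemma hausdorff_ge0 A : 0 <= hausdorff s A.
Proof. exact: le_trans (hausdorff_pre_ge0 1 A) (hausdorff_pre_le_hausdorff A ltr01). Qed.

Lemma hausdorff_sub A B : A `<=` B -> hausdorff s A <= hausdorff s B.
Proof.
move=> AB; apply: hausdorff_le => d d0.
exact: le_trans (hausdorff_pre_sub d AB) (hausdorff_pre_le_hausdorff B d0).
Qed.

Lemma ediam0 : ediam (set0 : set 'rV[R]_n) = -oo.
Proof.
by apply/ereal_sup_ninfty => ? [? []].
Qed.

Lemma hausdorff_pre_set0 d : hausdorff_pre s d (set0 : set 'rV[R]_n) = 0.
Proof.
apply/eqP; rewrite eq_le hausdorff_pre_ge0 andbT.
have := @hausdorff_pre_le d set0 (fun=> set0) (@sub0set _ _).
rewrite eseries0; first by apply => k; rewrite ediam0 leNye.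
by move=> i _ _; exact: weight_set0.
Qed.

End hausdorff_theory.
Section hausdorff_operations.
Context (R : realType).
Local Open Scope ereal_scope.

Lemma expeZ (K : R) (x : \bar R) k : (K%:E * x) ^+ k = (K ^+ k)%:E * x ^+ k.
Proof.
elim: k => [|k ih]; first by rewrite !expe0 expr0 mul1e.
by rewrite !expeS exprS EFinM ih muleACA.
Qed.

Lemma le_add_ereal_inf (S1 S2 : set (\bar R)) (M : \bar R) :
  (forall a, S1 a -> 0 <= a) -> (forall b, S2 b -> 0 <= b) ->
  (forall a b, S1 a -> S2 b -> M <= a + b) -> M <= ereal_inf S1 + ereal_inf S2.
Proof.
move=> S10 S20 MS.
have i1 : 0 <= ereal_inf S1 by exact: le_ereal_inf_tmp.
have i2 : 0 <= ereal_inf S2 by exact: le_ereal_inf_tmp.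
have [->|f1] := eqVneq (ereal_inf S1) +oo.
  by rewrite addye ?leey// -ltNye (lt_le_trans _ i2)// ltNy0.
have [->|f2] := eqVneq (ereal_inf S2) +oo.
  by rewrite addey ?leey// -ltNye (lt_le_trans _ i1)// ltNy0.
have {}f1 : ereal_inf S1 \is a fin_num by rewrite ge0_fin_numE// ltey.
have {}f2 : ereal_inf S2 \is a fin_num by rewrite ge0_fin_numE// ltey.
apply/lee_addgt0Pr => e e0.
have e2 : (0 < e / 2)%R by rewrite divr_gt0.
have [a Sa ha] := lb_ereal_inf_adherent e2 f1.
have [b Sb hb] := lb_ereal_inf_adherent e2 f2.
apply: (le_trans (MS _ _ Sa Sb)).
rewrite [e in e%:E]splitr EFinD addeACA.
by apply: leeD; exact: ltW.
Qed.

Lemma add_ereal_sup_le (S1 S2 : set (\bar R)) (M : \bar R) :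
  S1 !=set0 -> S2 !=set0 ->
  (forall a, S1 a -> 0 <= a) -> (forall b, S2 b -> 0 <= b) ->
  (forall a b, S1 a -> S2 b -> a + b <= M) -> ereal_sup S1 + ereal_sup S2 <= M.
Proof.
move=> [a0 Sa0] [b0 Sb0] S10 S20 MS.
have [->|fM] := eqVneq M +oo; first exact: leey.
have i1 : 0 <= ereal_sup S1 by apply: le_ereal_sup_tmp; exists a0 => //; exact: S10.
have i2 : 0 <= ereal_sup S2 by apply: le_ereal_sup_tmp; exists b0 => //; exact: S20.
have f1 : ereal_sup S1 \is a fin_num.
  rewrite ge0_fin_numE//; apply: (@le_lt_trans _ _ M); last by rewrite ltey.
  apply: ge_ereal_sup => a Sa; apply: le_trans (MS _ _ Sa Sb0).
  by rewrite leeDl// S20.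
have f2 : ereal_sup S2 \is a fin_num.
  rewrite ge0_fin_numE//; apply: (@le_lt_trans _ _ M); last by rewrite ltey.
  apply: ge_ereal_sup => b Sb; apply: le_trans (MS _ _ Sa0 Sb).
  by rewrite leeDr// S10.
apply/lee_addgt0Pr => e e0.
have e2 : (0 < e / 2)%R by rewrite divr_gt0.
have [a Sa ha] := ub_ereal_sup_adherent e2 f1.
have [b Sb hb] := ub_ereal_sup_adherent e2 f2.
apply: (@le_trans _ _ ((a + (e / 2)%:E) + (b + (e / 2)%:E))).
  by apply: leeD; rewrite -leeBlDr// ltW.
by rewrite addeACA -EFinD -splitr leeD2r// MS.
Qed.

(** Serves to merge two countable covers into one sequence by alternating their members. *)
Lemma nneseries_interleave (u v : (\bar R)^nat) :
  (forall k, 0 <= u k) -> (forall k, 0 <= v k) ->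
  \sum_(0 <= k <oo) (if odd k then v k./2 else u k./2) <=
  \sum_(0 <= k <oo) u k + \sum_(0 <= k <oo) v k.
Proof.
move=> u0 v0; apply: lime_le.
  by apply: is_cvg_nneseries => k _ _; case: ifP.
apply: nearW => N.
have -> : \sum_(0 <= k < N) (if odd k then v k./2 else u k./2) =
    \sum_(0 <= k < uphalf N) u k + \sum_(0 <= k < N./2) v k.
  elim: N => [|N ih]; first by rewrite !big_geq// adde0.
  rewrite big_nat_recr//= ih uphalf_half; case: (odd N) => /=.
    by rewrite !add1n [X in _ = _ + X]big_nat_recr//= addeA.
  by rewrite !add0n [X in _ = X + _]big_nat_recr//= addeAC.
by apply: leeD; apply: nneseries_lim_ge => k _ _.
Qed.

Section lipschitz.
Context (n m s : nat) (f : 'rV[R]_n -> 'rV[R]_m) (A : set 'rV[R]_n) (K : R).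
Hypothesis K0 : (0 < K)%R.
Hypothesis fK : forall x y, A x -> A y -> (enorm (f x - f y) <= K * enorm (x - y))%R.

Lemma ediam_lipschitz B : B `<=` A -> B !=set0 -> ediam (f @` B) <= K%:E * ediam B.
Proof.
move=> BA B0; apply: ge_ereal_sup => _ [_ [x Bx <-] [_ [y By <-] <-]].
apply: (@le_trans _ _ (K * enorm (x - y))%:E); first by rewrite lee_fin fK//; exact: BA.
by rewrite EFinM lee_pmul2l// ?lte_fin//; exact: enorm_le_ediam.
Qed.

Lemma weight_lipschitz B : B `<=` A ->
  hausdorff_weight s (f @` B) <= (K ^+ s)%:E * hausdorff_weight s B.
Proof.
move=> BA; have [->|/set0P B0] := eqVneq B set0.
  by rewrite image_set0 !weight_set0 mule0.
rewrite /hausdorff_weight.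
have /set0P/negbTE -> := B0.
have /set0P/negbTE -> : f @` B !=set0 by case: B0 => x Bx; exists (f x), x.
rewrite muleCA -expeZ; apply: lee_pmul.
- exact/ltW/unit_ball_gt0.
- apply/expe_ge0/mule_ge0; first by rewrite lee_fin invr_ge0.
  by apply: ediam_ge0; case: B0 => x Bx; exists (f x), x.
- exact: lexx.
apply: lee_expe.
  apply/mule_ge0; first by rewrite lee_fin invr_ge0.
  by apply: ediam_ge0; case: B0 => x Bx; exists (f x), x.
by rewrite muleCA lee_pmul2l// ?lte_fin// ?invr_gt0//; exact: ediam_lipschitz.
Qed.

Lemma hausdorff_pre_lipschitz d :
  hausdorff_pre s (K * d) (f @` A) <= (K ^+ s)%:E * hausdorff_pre s d A.
Proof.
have Ks : (0 < K ^+ s)%R by rewrite exprn_gt0.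
rewrite -lee_pdivrMl//; apply: le_ereal_inf_tmp => _ [C [AC Cd] <-].
rewrite lee_pdivrMl// -nneseriesZl; last by move=> k _; exact: weight_ge0.
(* The members of the cover are cut down to [A] before being mapped, because [f] is Lipschitz only
   there. *)
apply: (@le_trans _ _ (\sum_(0 <= k <oo) hausdorff_weight s (f @` (C k `&` A)))).
  apply: hausdorff_pre_le.
    by move=> _ [x Ax <-]; have [k _ Ck] := AC x Ax; exists k => //; exists x.
  move=> k; have [->|/set0P B0] := eqVneq (C k `&` A) set0.
    by rewrite image_set0 ediam0 leNye.
  apply: (le_trans (ediam_lipschitz (@subIsetr _ _ _) B0)).
  rewrite EFinM lee_pmul2l// ?lte_fin//; apply: le_trans (Cd k).
  by apply: ediam_sub; exact: subIsetl.
apply: lee_nneseries => [k _ _|k _]; first exact: weight_ge0.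
apply: (le_trans (weight_lipschitz (@subIsetr _ _ _))).
by rewrite lee_pmul2l// ?lte_fin//; apply: weight_sub; exact: subIsetl.
Qed.

Lemma hausdorff_lipschitz : hausdorff s (f @` A) <= (K ^+ s)%:E * hausdorff s A.
Proof.
have Ks : (0 < K ^+ s)%R by rewrite exprn_gt0.
apply: hausdorff_le => d d0.
have := hausdorff_pre_lipschitz (K^-1 * d).
rewrite mulrA mulfV ?gt_eqF// mul1r => /le_trans; apply.
by rewrite lee_pmul2l// ?lte_fin//; apply: hausdorff_pre_le_hausdorff; rewrite mulr_gt0 ?invr_gt0.
Qed.
End lipschitz.
End hausdorff_operations.

(** * Slabs of a set invariant along one coordinate *)

Section slabs.
Context (R : realType) (n s : nat).
Implicit Types A B : set 'rV[R]_n.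
Local Open Scope ereal_scope.
Local Notation pre := (hausdorff_pre s).

Lemma hausdorff_preU d A B : pre d (A `|` B) <= pre d A + pre d B.
Proof.
apply: le_add_ereal_inf.
- by move=> _ [C _ <-]; apply: nneseries_ge0 => k _ _; exact: weight_ge0.
- by move=> _ [C _ <-]; apply: nneseries_ge0 => k _ _; exact: weight_ge0.
move=> _ _ [C [AC Cd] <-] [C' [BC' C'd] <-].
have h0 (D : (set 'rV[R]_n)^nat) k : 0 <= hausdorff_weight s (D k) by exact: weight_ge0.
apply: le_trans (nneseries_interleave (h0 C) (h0 C')).
pose D k := if odd k then C' k./2 else C k./2.
rewrite (_ : \big[_/_]_(0 <= k <oo) _ = \sum_(0 <= k <oo) hausdorff_weight s (D k)); last first.
  by apply: eq_eseriesr => k _; rewrite /D; case: ifP.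
apply: hausdorff_pre_le.
  move=> x [/AC[k _ Ck]|/BC'[k _ Ck]].
    by exists k.*2 => //; rewrite /D odd_double doubleK.
  by exists k.*2.+1 => //; rewrite /D /= odd_double /= uphalf_double.
by move=> k; rewrite /D; case: ifP.
Qed.

(** A set of diameter at most [d < e] meets at most one of [A] and [B], so any admissible cover of
    the union splits into covers of both. *)
Lemma hausdorff_pre_separated d A B (e : R) : (d < e)%R ->
  (forall x y, A x -> B y -> (e <= enorm (x - y))%R) ->
  pre d A + pre d B <= pre d (A `|` B).
Proof.
move=> de sep; apply: le_ereal_inf_tmp => _ [C [ABC Cd] <-].
apply: (@le_trans _ _ (\sum_(0 <= k <oo) hausdorff_weight s (C k `&` A) +
    \sum_(0 <= k <oo) hausdorff_weight s (C k `&` B))).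
  apply: leeD; apply: hausdorff_pre_le.
  - by move=> x Ax; have [k _ Ck] := ABC x (or_introl Ax); exists k.
  - by move=> k; apply: le_trans (Cd k); apply: ediam_sub; exact: subIsetl.
  - by move=> x Ax; have [k _ Ck] := ABC x (or_intror Ax); exists k.
  - by move=> k; apply: le_trans (Cd k); apply: ediam_sub; exact: subIsetl.
rewrite -nneseriesD; [|by move=> *; exact: weight_ge0|by move=> *; exact: weight_ge0].
apply: lee_nneseries => [k _ _|k _]; first by rewrite adde_ge0// weight_ge0.
have [->|/set0P[x [Cx Ax]]] := eqVneq (C k `&` A) set0.
  by rewrite weight_set0 add0e; apply: weight_sub; exact: subIsetl.
rewrite (_ : C k `&` B = set0); last first.
  apply/seteqP; split => y //= [Cy By].
  have := le_trans (enorm_le_ediam Cx Cy) (Cd k).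
  by rewrite lee_fin leNgt (lt_le_trans de)// sep.
by rewrite weight_set0 adde0; apply: weight_sub; exact: subIsetl.
Qed.

Lemma hausdorffU A B : hausdorff s (A `|` B) <= hausdorff s A + hausdorff s B.
Proof.
apply: hausdorff_le => d d0; apply: (le_trans (hausdorff_preU _ _ _)).
by apply: leeD; exact: hausdorff_pre_le_hausdorff.
Qed.

Lemma hausdorff_separated A B (e : R) : (0 < e)%R ->
  (forall x y, A x -> B y -> (e <= enorm (x - y))%R) ->
  hausdorff s A + hausdorff s B <= hausdorff s (A `|` B).
Proof.
move=> e0 sep; apply: add_ereal_sup_le.
- by exists (pre 1 A), 1%R => //=.
- by exists (pre 1 B), 1%R => //=.
- by move=> _ [d _ <-]; exact: hausdorff_pre_ge0.
- by move=> _ [d _ <-]; exact: hausdorff_pre_ge0.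
move=> _ _ [d /= d0 <-] [d' /= d'0 <-].
pose d2 : R := Num.min (Num.min d d') (e / 2)%R.
have d20 : (0 < d2)%R by rewrite !lt_min d0 d'0 divr_gt0.
apply: (le_trans _ (hausdorff_pre_le_hausdorff s (A `|` B) d20)).
apply: (le_trans _ (@hausdorff_pre_separated d2 A B e _ sep)).
  by apply: leeD; apply: hausdorff_pre_nonincreasing; rewrite !ge_min lexx ?orbT.
by rewrite !gt_min ltr_pdivrMr// ltr_pMr// ltr1n !orbT.
Qed.

Variable k : 'I_n.

Definition slab A (a b : R) : set 'rV[R]_n := [set x | A x /\ (a < x 0%R k < b)%R].

Definition translation_invariant A := forall x t, A x -> A (upd k x t).

Lemma slab_sub A a b a' b' : (a' <= a)%R -> (b <= b')%R -> slab A a b `<=` slab A a' b'.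
Proof. by move=> aa bb x [Ax /andP[xa xb]]; split => //; rewrite (le_lt_trans aa) ?(lt_le_trans xb). Qed.

Lemma slab_empty A a b : (b <= a)%R -> slab A a b = set0.
Proof.
by move=> ba; apply/seteqP; split => x //= [_ /andP[xa xb]];
  have := lt_trans xa xb; rewrite ltNge ba.
Qed.

Lemma hausdorff_pre_slab A a b a' b' d : translation_invariant A -> (b - a <= b' - a')%R ->
  pre d (slab A a b) <= pre d (slab A a' b').
Proof.
move=> tA ba.
pose f (x : 'rV[R]_n) := upd k x (x 0%R k + (a - a'))%R.
have fB x y : (f x - f y = x - y)%R.
  by apply/rowP => j; rewrite !mxE; case: eqP => // ->; ring.
have := @hausdorff_pre_lipschitz R n n s f (slab A a' b') 1%R ltr01 _ d.
rewrite mul1r expr1n mul1e => h; apply: le_trans (h _); last first.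
  by move=> x y _ _; rewrite fB mul1r.
apply: hausdorff_pre_sub => x [Ax /andP[xa xb]].
exists (upd k x (x 0%R k - (a - a')))%R.
  split; first exact: tA.
  by rewrite mxE eqxx; apply/andP; split; lra.
apply/rowP => j; rewrite !mxE eqxx; case: eqP => // ->; ring.
Qed.

Lemma hausdorff_slab A a b a' b' : translation_invariant A -> (b - a <= b' - a')%R ->
  hausdorff s (slab A a b) <= hausdorff s (slab A a' b').
Proof.
move=> tA ba; apply: hausdorff_le => d d0.
exact: (le_trans (hausdorff_pre_slab d tA ba) (hausdorff_pre_le_hausdorff _ _ d0)).
Qed.

(** Translates of the open slab of length [l] are placed at distance [q]; the strict inequality
    [q < l] makes neighbours overlap, so that nothing is missed between them. *)
Lemma hausdorff_pre_slab_subadd A (l q : R) m d : translation_invariant A -> (0 < q < l)%R ->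
  forall a, pre d (slab A a (a + m%:R * q)%R) <= m%:R%:E * pre d (slab A 0 l).
Proof.
move=> tA /andP[q0 ql]; elim: m => [|m ih] a.
  by rewrite mul0e slab_empty ?hausdorff_pre_set0// mul0r addr0.
apply: (@le_trans _ _ (pre d (slab A a (a + l)%R `|` slab A (a + q)%R (a + q + m%:R * q)%R))).
  apply: hausdorff_pre_sub => x [Ax /andP[xa xb]].
  have [xl|xl] := ltP (x 0%R k) (a + l)%R; [left|right]; split => //.
    by rewrite xa.
  by rewrite (lt_le_trans _ xl) ?ltrD2l//= (lt_le_trans xb)// -natr1 mulrDl mul1r addrAC addrA.
apply: (le_trans (hausdorff_preU _ _ _)).
rewrite -natr1 EFinD ge0_muleDl ?lee_fin ?ler0n// mul1e addeC; apply: leeD; first exact: ih.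
by apply: hausdorff_pre_slab => //; lra.
Qed.

Lemma hausdorff_slab_subadd A (l q : R) m : translation_invariant A -> (0 < q < l)%R ->
  forall a, hausdorff s (slab A a (a + m%:R * q)%R) <= m%:R%:E * hausdorff s (slab A 0 l).
Proof.
move=> tA ql a; apply: hausdorff_le => d d0.
apply: (le_trans (hausdorff_pre_slab_subadd m d tA ql a)).
by apply: lee_pmul => //; [exact: hausdorff_pre_ge0|exact: hausdorff_pre_le_hausdorff].
Qed.

(** Translates of the slab of length [l] are placed at distance [q]; the gaps of width [q - l]
    separate them, and measures of separated sets add up. *)
Lemma hausdorff_slab_superadd A (l q : R) m : translation_invariant A -> (0 < l < q)%R ->
  forall a, m%:R%:E * hausdorff s (slab A 0 l) <= hausdorff s (slab A a (a + m%:R * q)%R).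
Proof.
move=> tA /andP[l0 lq]; elim: m => [|m ih] a; first by rewrite mul0e hausdorff_ge0.
apply: (@le_trans _ _ (hausdorff s (slab A a (a + l)%R `|` slab A (a + q)%R (a + q + m%:R * q)%R))).
  apply: le_trans (hausdorff_separated (e := q - l) _ _).
  - rewrite -natr1 EFinD ge0_muleDl ?lee_fin ?ler0n// mul1e addeC; apply: leeD; last exact: ih.
    by apply: hausdorff_slab => //; lra.
  - by rewrite subr_gt0.
  move=> x y [_ /andP[_ xl]] [_ /andP[yq _]].
  rewrite enormB; apply: le_trans (coord_le_enorm _ k); rewrite !mxE.
  by apply: le_trans (ler_norm _); lra.
apply: hausdorff_sub => x [[Ax /andP[xa xb]]|[Ax /andP[xa xb]]]; split => //.
  rewrite xa /= (lt_le_trans xb)// lerD2l -natr1 mulrDl mul1r (le_trans (ltW lq))//.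
  by rewrite lerDr mulr_ge0 ?ler0n// ltW// (lt_trans l0).
rewrite (lt_trans _ xa) ?ltrDl ?(lt_trans l0)//= (lt_le_trans xb)//.
by rewrite -natr1 mulrDl mul1r addrAC addrA.
Qed.

End slabs.

Section limits.
Context (R : realType).
Local Open Scope ereal_scope.

(** Removes the error of order 1/N left by cutting into N pieces, also when [h] is infinite. *)
Lemma lee_mul_lim (x h : \bar R) (a b : R) : (0 < a)%R -> (0 <= b)%R -> 0 <= h ->
  (forall N, x <= (a + b / N.+1%:R)%:E * h) -> x <= a%:E * h.
Proof.
move=> a0 b0 h0 H; have [hoo|hfin] := eqVneq h +oo.
  by rewrite hoo gt0_muley ?leey// lte_fin.
have {hfin}hfin : h \is a fin_num by rewrite ge0_fin_numE// ltey.
apply/lee_addgt0Pr => e e0.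
pose N := Num.truncn (b * fine h / e).
apply: (le_trans (H N)).
rewrite -(fineK hfin) -!EFinM -EFinD lee_fin mulrDl lerD2l.
have : (b * fine h / e < N.+1%:R)%R by exact: truncnS_gt.
by rewrite ltr_pdivrMr// => /ltW; rewrite mulrAC ler_pdivrMr ?ltr0n// [X in (_ <= X)%R -> _]mulrC.
Qed.

End limits.

(** * Areas of spherical cylinders *)

Section sphere_boxes.
Context (R : realType) (n s : nat).
Implicit Types (P : {set 'I_n}) (l : 'I_n -> R).
Local Open Scope ereal_scope.

(** The measure of a slab is proportional to its length: thin slabs that are packed apart into
    length [l2] and overlap when covering length [l1] compare the two up to O(1/N). *)
Lemma hausdorff_slab_linear (k : 'I_n) (A : set 'rV[R]_n) (l1 l2 : R) :
  translation_invariant k A -> (0 < l1)%R -> (0 < l2)%R ->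
  hausdorff s (slab k A 0 l1) <= (l1 / l2)%:E * hausdorff s (slab k A 0 l2).
Proof.
move=> tA l10 l20; pose c := (l1 / l2)%R.
have c0 : (0 < c)%R by rewrite divr_gt0.
apply: (@lee_mul_lim _ _ _ _ (2 * c + 1)%R) => //; [lra|exact: hausdorff_ge0|move=> N].
pose N1 : R := N.+1%:R; have N10 : (0 < N1)%R by rewrite ltr0n.
(* The thin slabs have length [l']. The step [q2 > l'] packs [N.+1] of them into length [l2], the
   step [q1 < l'] covers length [l1] with [M] of them, and [M / N1] is at most
   [c + (2 * c + 1) / N1]. *)
pose q2 := (l2 / N1)%R; pose l' := (l2 / (N1 + 1))%R; pose q1 := (l2 / (N1 + 2))%R.
pose M := (Num.truncn (c * (N1 + 2))).+1.
have c2 : (0 <= c * (N1 + 2))%R by rewrite mulr_ge0// ?ltW//; lra.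
have /andP[M1 M2] := truncn_itv c2.
have q10 : (0 < q1)%R by rewrite divr_gt0//; lra.
have l'0 : (0 < l')%R by rewrite divr_gt0//; lra.
have h1 : (0 < q1 < l')%R.
  by rewrite q10 /= /q1 /l' ltr_pM2l// ltf_pV2 ?posrE; lra.
have h2 : (0 < l' < q2)%R.
  by rewrite l'0 /= /q2 /l' ltr_pM2l// ltf_pV2 ?posrE; lra.
have E1 := hausdorff_slab_subadd s M tA h1 0.
have E2 := hausdorff_slab_superadd s N.+1 tA h2 0.
apply: (@le_trans _ _ (hausdorff s (slab k A 0 (0 + M%:R * q1)%R))).
  apply/hausdorff_sub/slab_sub => //; rewrite add0r.
  have -> : l1 = (c * (N1 + 2) * q1)%R.
    rewrite /c /q1; field; apply/andP; split; lra.
  by rewrite ler_pM2r// ltW.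
apply: (le_trans E1).
apply: (@le_trans _ _ ((M%:R / N1)%:E * (N1%:E * hausdorff s (slab k A 0 l')))).
  rewrite muleA -EFinM divfK//; lra.
have E3 : hausdorff s (slab k A 0 (0 + N.+1%:R * q2)%R) = hausdorff s (slab k A 0 l2).
  by congr (hausdorff s (slab k A 0 _)); rewrite add0r /q2 /N1; field; lra.
rewrite E3 in E2.
apply: lee_pmul => //.
- by rewrite lee_fin divr_ge0// ltW.
- by apply: mule_ge0; [rewrite lee_fin ltW|exact: hausdorff_ge0].
rewrite lee_fin ler_pdivrMr//.
have -> : ((c + (2 * c + 1) / N1) * N1 = c * (N1 + 2) + 1)%R.
  by field; lra.
by rewrite /M -natr1 lerD2r.
Qed.

(** A spherical cylinder in the open orthant over a box of sides [l] in the free coordinates; here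
    [rho] is the radius, not its square. With unit sides and [rho < 1] it is the boundary of the
    tube inside the open cube; with unit sides and [rho = 1] its measure is h_d. The sides vary
    because dilations change them. *)
Definition sphere_box P (rho : R) l : set 'rV[R]_n :=
  [set z : 'rV[R]_n | [/\ forall i, i \in P -> (0 < z 0%R i)%R,
     partial_sqnorm P z = (rho ^+ 2)%R &
     forall i, i \notin P -> (0 < z 0%R i < l i)%R]].

Lemma sphere_box_sub P rho l l' : (forall i, i \notin P -> (l i <= l' i)%R) ->
  sphere_box P rho l `<=` sphere_box P rho l'.
Proof.
move=> ll' z [z1 z2 z3]; split => // i iP.
by have /andP[-> h] := z3 i iP; rewrite (lt_le_trans h)// ll'.
Qed.

(** The same [A] serves for every side in the direction [k], so boxes that differ only in that side
    are slabs of one set. *)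
Lemma sphere_box_slab P rho l k : k \notin P ->
  exists A, translation_invariant k A /\
    forall m, (forall i, i != k -> l i = m i) -> sphere_box P rho m = slab k A 0 (m k).
Proof.
move=> kP.
exists [set z : 'rV[R]_n | [/\ forall i, i \in P -> (0 < z 0%R i)%R,
     partial_sqnorm P z = (rho ^+ 2)%R &
     forall i, i \notin P -> i != k -> (0 < z 0%R i < l i)%R]].
split.
  move=> z t [z1 z2 z3]; split.
  - move=> i iP; rewrite mxE ifF ?z1//.
    by apply/negbTE; apply: contraNneq kP => <-.
  - by rewrite partial_sqnorm_upd.
  - by move=> i iP ik; rewrite mxE (negbTE ik) z3.
move=> m lm; apply/seteqP; split => z.
  move=> [z1 z2 z3]; split; last exact: z3.
  by split => // i iP ik; rewrite lm// z3.
move=> [[z1 z2 z3] z4]; split => // i iP.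
by have [->//|ik] := eqVneq i k; rewrite -lm// z3.
Qed.

Lemma sphere_box_coord P rho l l' k : k \notin P -> (0 < l k)%R -> (0 < l' k)%R ->
  (forall i, i != k -> l i = l' i) ->
  hausdorff s (sphere_box P rho l) <= (l k / l' k)%:E * hausdorff s (sphere_box P rho l').
Proof.
move=> kP lk l'k ll'; have [A [tA AE]] := sphere_box_slab rho l kP.
by rewrite (AE l)// (AE l')//; exact: hausdorff_slab_linear.
Qed.

Lemma sphere_box_rect P rho l l' : (forall i, (0 < l i)%R) -> (forall i, (0 < l' i)%R) ->
  hausdorff s (sphere_box P rho l) <=
  (\prod_(i | i \notin P) (l i / l' i))%R%:E * hausdorff s (sphere_box P rho l').
Proof.
move=> l0 l'0.
(* Induction on the list [S] of coordinates whose side is already [l i]; the others still have side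
   [l' i]. *)
suff H (S : seq 'I_n) : uniq S ->
    hausdorff s (sphere_box P rho (fun i => if i \in S then l i else l' i)) <=
    (\prod_(i <- S | i \notin P) (l i / l' i))%R%:E * hausdorff s (sphere_box P rho l').
  have := H (index_enum 'I_n) (index_enum_uniq _).
  by under eq_fun do rewrite mem_index_enum.
elim: S => [|k S ih] /=; first by rewrite big_nil mul1e.
move=> /andP[kS uS]; rewrite big_cons; case: ifPn => kP; last first.
  apply: le_trans (ih uS); apply/hausdorff_sub/sphere_box_sub => i iP.
  by rewrite inE; case: eqVneq => // ik; move: kP; rewrite -ik iP.
rewrite EFinM -muleA; apply: le_trans (lee_pmul _ _ (lexx _) (ih uS)); last 2 first.
- by rewrite lee_fin divr_ge0// ltW.
- exact: hausdorff_ge0.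
pose L1 i := if i \in k :: S then l i else l' i.
pose L2 i := if i \in S then l i else l' i.
have E1 : L1 k = l k by rewrite /L1 inE eqxx.
have E2 : L2 k = l' k by rewrite /L2 (negbTE kS).
have := @sphere_box_coord P rho L1 L2 k kP; rewrite E1 E2; apply => // i ik.
by rewrite /L1 /L2 inE (negbTE ik).
Qed.

Lemma enormZ (c : R) (x : 'rV[R]_n) : enorm (c *: x)%R = (`|c| * enorm x)%R.
Proof.
rewrite /enorm !edotxx -sqrtr_sqr -sqrtrM ?sqr_ge0//; congr Num.sqrt.
by rewrite mulr_sumr; apply: eq_bigr => i _; rewrite mxE exprMn.
Qed.

Lemma sphere_box_scale P (rho c : R) l : (0 < c)%R ->
  hausdorff s (sphere_box P (c * rho)%R (fun i => c * l i)%R) <=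
  (c ^+ s)%R%:E * hausdorff s (sphere_box P rho l).
Proof.
move=> c0.
have := @hausdorff_lipschitz R n n s (fun z => c *: z)%R (sphere_box P rho l) c c0 _.
move=> h; apply: le_trans (h _); last first.
  by move=> x y _ _; rewrite -scalerBr enormZ gtr0_norm.
apply: hausdorff_sub => z [z1 z2 z3].
exists (c^-1 *: z)%R; last by rewrite scalerA mulfV ?gt_eqF// scale1r.
split.
- by move=> i iP; rewrite mxE mulr_gt0 ?invr_gt0 ?z1.
- rewrite /partial_sqnorm (eq_bigr (fun i => (c^-1 ^+ 2 * z 0%R i ^+ 2)%R)); last first.
    by move=> i _; rewrite mxE exprMn.
  by rewrite -mulr_sumr -/(partial_sqnorm P z) z2; field; lra.
- move=> i iP; have /andP[a b] := z3 i iP; rewrite mxE mulr_gt0 ?invr_gt0//=.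
  by rewrite mulrC ltr_pdivrMr// mulrC.
Qed.

(** A dilation by [rho / rho'] matches the radii, and the free sides it stretches are then corrected
    by linearity in each of them. *)
Lemma sphere_box_compare P (rho rho' : R) l l' : (0 < rho)%R -> (0 < rho')%R ->
  (forall i, (0 < l i)%R) -> (forall i, (0 < l' i)%R) ->
  hausdorff s (sphere_box P rho l) <=
  ((rho / rho') ^+ s * \prod_(i | i \notin P) ((l i / rho) / (l' i / rho')))%R%:E *
  hausdorff s (sphere_box P rho' l').
Proof.
move=> r0 r'0 l0 l'0; pose c := (rho / rho')%R.
have c0 : (0 < c)%R by rewrite divr_gt0.
have := @sphere_box_scale P rho' c (fun i => l i / c)%R c0.
rewrite (_ : c * rho' = rho)%R; last by rewrite /c; field; lra.
rewrite (_ : (fun i => c * (l i / c))%R = l); last by apply/funext => i; field; lra.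
move=> /le_trans; apply; rewrite EFinM -muleA lee_pmul2l// ?lte_fin ?exprn_gt0//.
have := @sphere_box_rect P rho' (fun i => l i / c)%R l' (fun i => divr_gt0 (l0 i) c0) l'0.
move=> /le_trans; apply; rewrite le_eqVlt; apply/orP; left; apply/eqP.
congr (_%:E * _); apply: eq_bigr => i _; rewrite /c.
have := l'0 i => ?; field; repeat (apply/andP; split); lra.
Qed.

End sphere_boxes.

Section sphere_box_power.
Context (R : realType) (n : nat) (P : {set 'I_n}).
Local Open Scope ereal_scope.
Hypothesis P0 : (0 < #|P|)%N.

Local Notation h := (hausdorff n.-1 (sphere_box P 1%R (fun=> 1%R : R))).

Lemma prod_notin (c : R) : (\prod_(i | i \notin P) c = c ^+ (n - #|P|))%R.
Proof.
rewrite (eq_bigl (fun i => i \in ~: P)); last by move=> i; rewrite inE.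
by rewrite prodr_const cardsCs finset.setCK card_ord.
Qed.

Lemma card_le_n : (#|P| <= n)%N.
Proof. by have := max_card (mem P); rewrite card_ord. Qed.

Lemma exp_split (rho : R) : (rho ^+ n.-1 = rho ^+ #|P|.-1 * rho ^+ (n - #|P|))%R.
Proof.
by rewrite -exprD; congr (_ ^+ _)%R; have := card_le_n; case: #|P| P0 => // m _ mn; rewrite -{1}(subnK mn) addnS /= addnC.
Qed.

(** The dilation contributes [rho] to the power n - 1, of which n - d factors are undone by
    rescaling the n - d free sides; d - 1 factors remain. *)
Lemma sphere_box_power (rho : R) l : (0 < rho)%R -> (forall i, (0 < l i)%R) ->
  hausdorff n.-1 (sphere_box P rho l) <=
  (rho ^+ #|P|.-1 * \prod_(i | i \notin P) l i)%R%:E * h.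
Proof.
move=> r0 l0; have := @sphere_box_compare R n n.-1 P rho 1 l (fun=> 1%R) r0 ltr01 l0 (fun=> ltr01).
move=> /le_trans; apply; rewrite le_eqVlt; apply/orP; left; apply/eqP.
congr (_%:E * _); under eq_bigr do rewrite !divr1.
rewrite divr1 prodf_div prod_notin exp_split; field.
by rewrite expf_neq0// gt_eqF.
Qed.

Lemma sphere_box_power_ge (rho : R) : (0 < rho)%R ->
  (rho ^+ #|P|.-1)%R%:E * h <= hausdorff n.-1 (sphere_box P rho (fun=> 1%R)).
Proof.
move=> r0; rewrite -lee_pdivlMl ?exprn_gt0//.
have := @sphere_box_compare R n n.-1 P 1 rho (fun=> 1%R) (fun=> 1%R) ltr01 r0 (fun=> ltr01) (fun=> ltr01).
move=> /le_trans; apply; rewrite le_eqVlt; apply/orP; left; apply/eqP.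
congr (_%:E * _); rewrite (_ : 1 / 1 / (1 / rho) = rho)%R; last by field; lra.
rewrite prod_notin expr_div_n expr1n exp_split; field.
by rewrite !expf_neq0// gt_eqF.
Qed.

End sphere_box_power.

(** * Elementary trigonometric estimates *)

Section trig_bounds.
Context (R : realType).
Implicit Types x y a b : R.

Lemma mean_value (f df : R -> R) a b : a <= b ->
  (forall x : R, is_derive x 1 f (df x)) ->
  exists2 c, a <= c <= b & f b - f a = df c * (b - a).
Proof.
move=> ab Df.
have cf : continuous f.
  move=> x; apply: differentiable_continuous; apply/derivable1_diffP.
  by have := Df x => -[].
have [c cab E] := MVT_segment ab (fun x _ => Df x) (continuous_comp_itv cf).
by exists c => //; move: cab; rewrite in_itv.
Qed.

Lemma sin_le x : 0 <= x -> sin x <= x.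
Proof.
move=> x0; have [c _] := mean_value x0 (@is_derive_sin R).
by rewrite sin0 !subr0 => ->; rewrite -[leRHS]mul1r ler_wpM2r// cos_le1.
Qed.

Lemma cos_ge x : 1 - x ^+ 2 / 2 <= cos x.
Proof.
wlog x0 : x / 0 <= x => [H|].
  have [/H//|/ltW x0] := leP 0 x.
  by rewrite -cosN -sqrrN; apply: H; rewrite oppr_ge0.
pose f (y : R) := cos y + (2^-1 * y) * y.
have Df (y : R) : is_derive y 1 f (y - sin y).
  by rewrite /f; apply: is_derive_eq; rewrite -![_ *: _]/(_ * _); field.
have [c /andP[c0 _]] := mean_value x0 Df.
rewrite /f cos0 mulr0 addr0 !subr0 => E.
have : 0 <= (c - sin c) * x by rewrite mulr_ge0// subr_ge0 sin_le.
by rewrite -E expr2; lra.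
Qed.

Lemma sin_ge x : 0 <= x -> x - x ^+ 3 / 6 <= sin x.
Proof.
move=> x0; pose f (y : R) := sin y - y + (6^-1 * y) * (y * y).
have Df (y : R) : is_derive y 1 f (cos y - 1 + y ^+ 2 / 2).
  by rewrite /f; apply: is_derive_eq; rewrite -![_ *: _]/(_ * _); field.
have [c /andP[c0 _]] := mean_value x0 Df.
rewrite /f sin0 !mulr0 !subr0 addr0 subr0 => E.
have : 0 <= (cos c - 1 + c ^+ 2 / 2) * x by rewrite mulr_ge0//; have := cos_ge c; lra.
rewrite -E !exprS expr0; lra.
Qed.

(** From sin (pi/6) = 1/2 and the cubic lower bound on the sine: 629/1200 already has a sine above
    1/2. The precision is chosen to give [wallis 10 < 387 / 1000], on which the comparison of
    codimensions 9 and 10 rests. *)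
Lemma pi_lt : pi < 629 / 200 :> R.
Proof.
rewrite ltNge; apply/negP => hpi.
pose a : R := pi / 6.
have s6 : sin a = 1 / 2.
  have E : sin (a + (a + a)) = 1.
    by rewrite -sin_pihalf; congr sin; rewrite /a; field.
  (* With s = sin a, the equation sin (3 a) = 1 reads 4 s^3 - 3 s + 1 = 0, which factors in this
     way. *)
  have : (2 * sin a - 1) ^+ 2 * (sin a + 1) = 0.
    have c2 : cos a * cos a = 1 - sin a * sin a by have := cos2Dsin2 a; rewrite !expr2; lra.
    have : sin a * (cos a * cos a - sin a * sin a) + cos a * (sin a * cos a + cos a * sin a) = 1.
      by rewrite -E sinD cosD sinD.
    rewrite (_ : cos a * (sin a * cos a + cos a * sin a) = 2 * sin a * (cos a * cos a)); last by ring.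
    by rewrite c2 => h; rewrite !exprS expr0; lra.
  move/eqP; rewrite mulf_eq0 sqrf_eq0 => /orP[/eqP|/eqP]; first by lra.
  have : 0 <= sin a.
    by apply: sin_ge0_pi; rewrite /a; have := pi_ge0 R; lra.
  by lra.
have : sin (629 / 1200) <= sin a.
  have pp := pi_ge2 R.
  have p4 : pi <= 4 :> R by have /andP[_] := (pihalf_02_cos_pihalf R).1; lra.
  by rewrite leNgt ltr_sin ?in_itv /=; [|apply/andP; split; rewrite /a; lra ..];
    rewrite -leNgt /a; lra.
have := @sin_ge (629 / 1200) _; rewrite s6 => /(_ ltac:(lra)).
by rewrite !exprS expr0; lra.
Qed.

(** The integrand decreases on [0, pi/2], so shifting the left sum by one step gives a right sum,
    which lies below the integral. The shift costs at most the first term, which is [D]. *)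
Lemma cos_riemann_sum m N (D : R) : N.+1%:R * D = pi / 2 ->
  \sum_(i < N.+1) cos (i%:R * D) ^+ m * D <= wallis R m + D.
Proof.
move=> ND.
have p0 := pihalf_gt0 R.
have N0 : (0 : R) < N.+1%:R by rewrite ltr0n.
have D0 : 0 < D by rewrite -(pmulr_rgt0 _ N0) ND.
have cospos (x : R) : 0 <= x <= pi / 2 -> 0 <= cos x.
  by move=> /andP[x0 x1]; apply: cos_ge0_pihalf; rewrite x1 andbT; lra.
have step k : (k < N.+1)%N -> cos (k.+1%:R * D) ^+ m * D <=
    cosint m (k.+1%:R * D) - cosint m (k%:R * D).
  move=> kN.
  have kk : k%:R * D <= k.+1%:R * D by rewrite ler_pM2r// ler_nat.
  have k1 : k.+1%:R * D <= pi / 2 by rewrite -ND ler_pM2r// ler_nat.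
  have k0 : 0 <= k%:R * D by rewrite mulr_ge0// ltW.
  have [c /andP[c1 c2] ->] := mean_value kk (is_derive_cosint m).
  rewrite -mulrBl -natrB// subSnn mul1r ler_pM2r//; apply: lerXn2r; rewrite ?nnegrE.
  - by apply: cospos; lra.
  - by apply: cospos; lra.
  have pp := pi_ge0 R.
  by rewrite leNgt ltr_cos ?in_itv /=; [|apply/andP; split; lra ..]; rewrite -leNgt.
have H k : (k <= N.+1)%N -> \sum_(i < k) cos (i%:R * D) ^+ m * D <=
    D + cosint m (k%:R * D) - cos (k%:R * D) ^+ m * D.
  elim: k => [_|k ih kN].
    by rewrite big_ord0 mul0r cos0 expr1n mul1r cosint_at0; lra.
  by rewrite big_ord_recr /=; have := ih (ltnW kN); have := step k kN; lra.
have := H N.+1 (leqnn _); rewrite ND -/(wallis R m).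
have : 0 <= cos (pi / 2 : R) ^+ m * D by rewrite mulr_ge0// ?exprn_ge0 ?cos_pihalf// ltW.
by lra.
Qed.

End trig_bounds.

(** * Spheres covered by bands of latitude *)

Section bands.
Context (R : realType) (n : nat) (P : {set 'I_n}) (j : 'I_n).
Hypothesis jP : j \notin P.

Lemma hausdorff_bigsetU s N (B : nat -> set 'rV[R]_n) :
  (hausdorff s (\bigcup_(i < N) B i) <= \sum_(i < N) hausdorff s (B i))%E.
Proof.
elim: N => [|N ih].
  rewrite big_ord0 bigcup_mkord big_ord0; apply: hausdorff_le => d _.
  by rewrite hausdorff_pre_set0.
rewrite bigcup_mkord !big_ord_recr /= -bigcup_mkord.
by apply: (le_trans (hausdorffU _ _ _)); exact: leeD2r.
Qed.

Lemma sum_split (F : 'I_n -> R) :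
  \sum_i F i = \sum_(i in P) F i + (F j + \sum_(i | (i \notin P) && (i != j)) F i).
Proof. by rewrite (bigID (mem P)) /= [X in _ + X](bigD1 j). Qed.

(* The longitude-latitude parametrization of a sphere band over the latitudes
   above [t0], by the cylinder of radius [c]. *)
Definition band_map (t0 c : R) (z : 'rV[R]_n) : 'rV[R]_n :=
  \row_k (if k \in P then z 0 k * (cos (t0 + z 0 j) / c)
          else if k == j then sin (t0 + z 0 j) else z 0 k).

(** With u, v the latitudes, a = cos u, b = cos v and S the scalar product over [P], the squared
    distance in the coordinates of [P] and [j] becomes 2 (ab/c^2) (c^2 - S) + (a - b)^2 + (sin u -
    sin v)^2. Here ab <= c^2 by the choice of the cylinder, and the last two squares add up to 2 - 2
    cos (u - v) <= (u - v)^2. *)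
Lemma band_map_lipschitz (t0 c : R) (z z' : 'rV[R]_n) : 0 < c ->
  partial_sqnorm P z = c ^+ 2 -> partial_sqnorm P z' = c ^+ 2 ->
  0 <= cos (t0 + z 0 j) <= c -> 0 <= cos (t0 + z' 0 j) <= c ->
  enorm (band_map t0 c z - band_map t0 c z') <= enorm (z - z').
Proof.
move=> c0 Pz Pz' /andP[a0 ac] /andP[b0 bc].
rewrite enorm_le ?enorm_ge0// sqr_enorm !sum_split.
rewrite [X in _ + (_ + X)](eq_bigr (fun i => (z - z') 0 i ^+ 2)); last first.
  by move=> i /andP[iP ij]; rewrite !mxE (negbTE iP) (negbTE ij).
rewrite !addrA lerD2r.
rewrite ![_ 0 j]mxE (negbTE jP) eqxx.
set a := cos (t0 + z 0 j) in a0 ac *; set b := cos (t0 + z' 0 j) in b0 bc *.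
set u := t0 + z 0 j in a a0 ac *; set v := t0 + z' 0 j in b b0 bc *.
pose S := \sum_(i in P) z 0 i * z' 0 i.
have E1 : \sum_(i in P) (z - z') 0 i ^+ 2 = 2 * c ^+ 2 - 2 * S.
  transitivity (\sum_(i in P) (z 0 i ^+ 2 + z' 0 i ^+ 2 - 2 * (z 0 i * z' 0 i))).
    by apply: eq_bigr => i _; rewrite !mxE; ring.
  rewrite sumrB big_split /= -!/(partial_sqnorm P _) Pz Pz' -mulr_sumr -/S; ring.
have E2 : \sum_(i in P) (band_map t0 c z - band_map t0 c z') 0 i ^+ 2 =
    a ^+ 2 + b ^+ 2 - 2 * (a * b / c ^+ 2) * S.
  transitivity (\sum_(i in P) ((a / c) ^+ 2 * z 0 i ^+ 2 + (b / c) ^+ 2 * z' 0 i ^+ 2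
      - 2 * (a * b / c ^+ 2) * (z 0 i * z' 0 i))).
    by apply: eq_bigr => i iP; rewrite !mxE iP -/u -/v -/a -/b; field; lra.
  rewrite sumrB big_split /= -!mulr_sumr -!/(partial_sqnorm P _) Pz Pz' -/S; field; lra.
have S0 : 0 <= c ^+ 2 - S.
  have : 0 <= \sum_(i in P) (z - z') 0 i ^+ 2 by apply: sumr_ge0 => i _; exact: sqr_ge0.
  by rewrite E1; lra.
have ab : a * b / c ^+ 2 <= 1.
  by rewrite ler_pdivrMr ?exprn_gt0// mul1r expr2; apply: ler_pM.
have E3 : (a - b) ^+ 2 + (sin u - sin v) ^+ 2 <= (z 0 j - z' 0 j) ^+ 2.
  have -> : z 0 j - z' 0 j = u - v by rewrite /u /v; ring.
  have := cos_ge (u - v); rewrite cosB -/a -/b.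
  have := cos2Dsin2 u; have := cos2Dsin2 v; rewrite -/a -/b => h1 h2 h3.
  have -> : (a - b) ^+ 2 + (sin u - sin v) ^+ 2 =
    (a ^+ 2 + sin u ^+ 2) + (b ^+ 2 + sin v ^+ 2) - 2 * (a * b + sin u * sin v) by ring.
  by rewrite h1 h2; lra.
rewrite E1 E2 !mxE (negbTE jP) eqxx -/u -/v.
have := mulr_ge0 S0 (_ : 0 <= 1 - a * b / c ^+ 2); rewrite subr_ge0 => /(_ ab).
move: E3; set q := a * b / c ^+ 2.
have -> : (a - b) ^+ 2 = a ^+ 2 + b ^+ 2 - 2 * (q * c ^+ 2) by rewrite /q; field; lra.
by move=> h1 h2; nra.
Qed.

Hypothesis P0 : (0 < #|P|)%N.
Local Notation h := (hausdorff n.-1 (sphere_box P 1%R (fun=> 1%R : R))).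

(** The band is a 1-Lipschitz image of part of a cylinder whose sphere has one dimension less. The
    radius [c = cos t0] is that of the widest parallel, and the latitude becomes a free coordinate
    of range [D]. *)
Lemma sphere_band (t0 c D : R) : 0 < D -> 0 < c -> c = cos t0 -> 0 <= t0 ->
  (hausdorff n.-1 [set z : 'rV[R]_n | sphere_box (j |: P) 1%R (fun=> 1%R) z /\
     (t0 < asin (z 0%R j) < t0 + D)%R] <= (c ^+ #|P|.-1 * D)%R%:E * h)%E.
Proof.
move=> D0 c0 cE t00; pose l k := if k == j then D else 1 : R.
have l0 k : 0 < l k by rewrite /l; case: ifP.
have := @sphere_box_power R n P P0 c l c0 l0.
rewrite (bigD1 j)//= /l eqxx big1 ?mulr1; last by move=> i /andP[_ /negbTE ->].
apply: le_trans.
(* The last band may reach past the pole, where the cosine is negative; the cylinder is cut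
   there. *)
pose A := [set z | sphere_box P c l z /\ t0 + z 0%R j < pi / 2].
have hA : (hausdorff n.-1 A <= hausdorff n.-1 (sphere_box P c l))%E.
  by apply: hausdorff_sub => z [].
apply: le_trans hA.
have := @hausdorff_lipschitz R n n n.-1 (band_map t0 c) A 1 ltr01.
rewrite expr1n mul1e => H; apply: le_trans (H _); last first.
  move=> z z' [[z1 z2 z3] z4] [[z'1 z'2 z'3] z'4]; rewrite mul1r.
  have p4 := pi_ge0 R.
  have cs (w : 'rV[R]_n) : 0 < w 0 j -> t0 + w 0 j < pi / 2 -> 0 <= cos (t0 + w 0 j) <= c.
    move=> w0 wp; apply/andP; split; first by apply: cos_ge0_pihalf; lra.
    by rewrite cE leNgt ltr_cos ?in_itv /=; [rewrite -leNgt; lra|apply/andP; split; lra ..].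
  have /andP[zj _] := z3 j jP; have /andP[z'j _] := z'3 j jP.
  by apply: band_map_lipschitz => //; exact: cs.
apply: hausdorff_sub => z [[z1 z2 z3] /andP[t1 t2]].
have jjP : j \in j |: P by rewrite in_setU1 eqxx.
have zj0 := z1 j jjP.
have z2' : z 0 j ^+ 2 + partial_sqnorm P z = 1.
  by rewrite -[RHS](expr1n _ 2) -z2 /partial_sqnorm big_setU1.
have [k kP] : exists k, k \in P by apply/set0Pn; rewrite -card_gt0.
have zk0 : 0 < z 0 k by apply: z1; rewrite in_setU1 kP orbT.
have sP : 0 < partial_sqnorm P z.
  rewrite /partial_sqnorm (bigD1 k)//= ltr_wpDr ?exprn_gt0//.
  by apply: sumr_ge0 => i _; exact: sqr_ge0.
have zj1 : z 0 j < 1.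
  by rewrite -(ltr_pXn2r (n := 2))// ?nnegrE ?ler01 ?ltW// expr1n; lra.
have zr : -1 <= z 0 j <= 1 by lra.
have sinA : sin (asin (z 0 j)) = z 0 j by apply: asinK; rewrite in_itv /=.
have cosA2 : cos (asin (z 0 j)) ^+ 2 = partial_sqnorm P z.
  by have := cos2Dsin2 (asin (z 0 j)); rewrite sinA; lra.
have Alt : asin (z 0 j) < pi / 2 by apply: asin_ltpi2; lra.
have cosA0 : 0 < cos (asin (z 0 j)) by apply: cos_gt0_pihalf; have := pi_ge0 R; lra.
set t := asin (z 0 j) in t1 t2 sinA cosA2 Alt cosA0 *.
(* The preimage of [z]: its coordinates in [P], of norm [cos t], are stretched to norm [c], and the
   latitude is counted from [t0]. *)
exists (\row_k (if k \in P then z 0 k * (c / cos t) else if k == j then t - t0 else z 0 k)).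
  split; last by rewrite mxE (negbTE jP) eqxx; lra.
  split.
  - move=> i iP; rewrite mxE iP mulr_gt0 ?divr_gt0//.
    by apply: z1; rewrite in_setU1 iP orbT.
  - rewrite /partial_sqnorm (eq_bigr (fun i => (c / cos t) ^+ 2 * z 0 i ^+ 2)); last first.
      by move=> i iP; rewrite mxE iP; ring.
    by rewrite -mulr_sumr -/(partial_sqnorm P z) -cosA2; field; lra.
  - move=> i iP; rewrite mxE (negbTE iP) /l; case: eqP => [_|/eqP ij]; first by lra.
    by apply: z3; rewrite in_setU1 negb_or ij.
apply/rowP => i; rewrite !mxE (negbTE jP) eqxx (_ : t0 + (t - t0) = t); last by ring.
case: (boolP (i \in P)) => iP; first by field; lra.
by case: eqP => [->|].
Qed.

(** Summing over bands at the latitudes [i%:R * D] gives a Riemann sum of cos^(d-1), with d the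
    number of coordinates in [P]; in the limit it bounds h_(d+1) by [wallis] at d - 1 times h_d. *)
Lemma sphere_box_band :
  (hausdorff n.-1 (sphere_box (j |: P) 1%R (fun=> 1%R : R)) <= (wallis R #|P|.-1)%:E * h)%E.
Proof.
have p0 := pihalf_gt0 R.
(* With N pieces, W the Wallis integral and D = pi/(2N), the error (1 + 1/N) (W + D) - W is at most
   (W + pi)/N. *)
apply: (@lee_mul_lim _ _ _ _ (wallis R #|P|.-1 + pi)).
- exact: wallis_gt0.
- by rewrite addr_ge0 ?pi_ge0// ltW// wallis_gt0.
- exact: hausdorff_ge0.
move=> N; pose N1 : R := N.+1%:R.
have N10 : 0 < N1 by rewrite ltr0n.
have N11 : 1 <= N1 by rewrite ler1n.
pose D : R := pi / 2 / N1.
have D0 : 0 < D by rewrite divr_gt0.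
have ND : N1 * D = pi / 2 by rewrite /D; field; lra.
(* The bands are open at both ends; widening them slightly beyond the step [D] makes them
   overlap. *)
pose D' := D * (1 + N1^-1).
have NV0 : 0 < N1^-1 by rewrite invr_gt0.
have D'D : D < D' by rewrite /D' ltr_pMr// ltrDl.
pose B i := [set z : 'rV[R]_n | sphere_box (j |: P) 1%R (fun=> 1%R) z /\
     (i%:R * D < asin (z 0%R j) < i%:R * D + D')%R].
apply: (@le_trans _ _ (hausdorff n.-1 (\bigcup_(i < N.+1) B i))).
  apply: hausdorff_sub => z hz.
  have [hP hz2 hz3] := hz.
  have jjP : j \in j |: P by rewrite in_setU1 eqxx.
  have zj0 := hP j jjP.
  have zj1 : z 0 j <= 1.
    have : z 0 j ^+ 2 <= 1 ^+ 2.
      rewrite -[leRHS]hz2 /partial_sqnorm big_setU1//= lerDl.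
      by apply: sumr_ge0 => i _; exact: sqr_ge0.
    by rewrite ler_pXn2r// nnegrE ltW.
  have zr : -1 <= z 0 j <= 1 by lra.
  set t := asin (z 0 j).
  have tp : t <= pi / 2 by exact: asin_lepi2.
  have t0 : 0 < t.
    rewrite ltNge; apply/negP => tle.
    have : sin t <= 0.
      rewrite -oppr_ge0 -sinN; apply: sin_ge0_pi.
      have := asin_geNpi2 zr; rewrite -/t; have := pi_ge0 R; lra.
    by rewrite asinK ?in_itv//= leNgt zj0.
  have ex : exists m, t <= m%:R * D by exists N.+1; rewrite -/N1 ND.
  (* The least multiple of [D] that is at least [t] is positive, and its predecessor [m] indexes a
     band containing [z]. *)
  case: (ex_minnP ex) => -[|m] hm mmin; first by move: hm; rewrite mul0r leNgt t0.
  have mN : (m < N.+1)%N by apply: mmin; rewrite -/N1 ND.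
  exists m => //; split => //; rewrite -/t; apply/andP; split.
    by rewrite ltNge; apply/negP => /mmin; rewrite ltnn.
  by apply: (le_lt_trans hm); rewrite -natr1 mulrDl mul1r ltrD2l.
apply: (le_trans (hausdorff_bigsetU _ _ _)).
apply: (@le_trans _ _ (\sum_(i < N.+1) (cos (i%:R * D) ^+ #|P|.-1 * D')%R%:E * h)%E).
  apply: lee_sum => i _; apply: sphere_band => //.
  - exact: lt_trans D'D.
  - apply: cos_gt0_pihalf; apply/andP; split.
      by apply: (@lt_le_trans _ _ 0); [rewrite oppr_lt0|rewrite mulr_ge0// ltW].
    by rewrite -ND ltr_pM2r// ltr_nat.
  - by rewrite mulr_ge0// ltW.
have cg (i : 'I_N.+1) : 0 <= cos (i%:R * D) ^+ #|P|.-1 * D'.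
  rewrite mulr_ge0//; last by rewrite ltW// (lt_trans D0).
  rewrite exprn_ge0//; apply: cos_ge0_pihalf; apply/andP; split.
    by apply: (@le_trans _ _ 0); [rewrite oppr_le0 ltW|rewrite mulr_ge0// ltW].
  by rewrite -ND ler_pM2r// ler_nat ltnW.
rewrite -ge0_sume_distrl; last by move=> i _; rewrite lee_fin cg.
apply: lee_pmul => //.
- by apply: sume_ge0 => i _; rewrite lee_fin cg.
- exact: hausdorff_ge0.
rewrite sumEFin lee_fin.
have := @cos_riemann_sum R #|P|.-1 N D ND.
have -> : \sum_(i < N.+1) cos (i%:R * D) ^+ #|P|.-1 * D' =
    (1 + N1^-1) * \sum_(i < N.+1) cos (i%:R * D) ^+ #|P|.-1 * D.
  by rewrite mulr_sumr; apply: eq_bigr => i _; rewrite /D'; ring.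
set S := \sum_(i < N.+1) _; set W := wallis R _ => SW.
apply: (@le_trans _ _ ((1 + N1^-1) * (W + D))).
  by rewrite ler_pM2l// addr_gt0.
have V1 : N1^-1 <= 1 by rewrite invf_le1.
have DE : D = pi / 2 * N1^-1 by [].
rewrite DE -/N1; set y := N1^-1 in NV0 V1 *.
have : pi / 2 * (y * y) <= pi / 2 * y.
  by rewrite ler_pM2l// ler_piMr// ltW.
lra.
Qed.

End bands.

(** * Finiteness and positivity of the spherical areas *)

Section sphere_box_bounds.
Context (R : realType) (n : nat).
Local Open Scope ereal_scope.

Lemma sphere_box_pre_coord s (P : {set 'I_n}) (rho d : R) l l' k N : k \notin P ->
  l k = 1%R -> l' k = (2 / N.+1%:R)%R -> (forall i, i != k -> l i = l' i) ->
  hausdorff_pre s d (sphere_box P rho l) <=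
  N.+1%:R%:E * hausdorff_pre s d (sphere_box P rho l').
Proof.
move=> kP lk l'k ll'; have [A [tA AE]] := sphere_box_slab rho l kP.
rewrite (AE l)// (AE l')// lk l'k.
have N0 : (0 < N.+1%:R :> R)%R by rewrite ltr0n.
have := @hausdorff_pre_slab_subadd R n s k A (2 / N.+1%:R)%R N.+1%:R^-1%R N.+1 d tA _ 0.
rewrite add0r mulfV ?gt_eqF//; apply.
by rewrite invr_gt0 N0/= ltr_pMl ?invr_gt0// ltr1n.
Qed.

(** Cuts each free side into [N.+1] parts. The pieces have side 2/(N+1), twice the mesh, so that the
    open boxes overlap. *)
Lemma sphere_box_pre s (P : {set 'I_n}) (rho d : R) N :
  hausdorff_pre s d (sphere_box P rho (fun=> 1%R)) <=
  (N.+1%:R ^+ (n - #|P|))%R%:E *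
  hausdorff_pre s d (sphere_box P rho (fun=> 2 / N.+1%:R)%R).
Proof.
rewrite -prod_notin.
suff H (S : seq 'I_n) : uniq S ->
    hausdorff_pre s d (sphere_box P rho (fun=> 1%R)) <=
    (\prod_(i <- S | i \notin P) N.+1%:R)%R%:E *
    hausdorff_pre s d (sphere_box P rho (fun i => if i \in S then (2 / N.+1%:R)%R else 1%R)).
  have := H (index_enum 'I_n) (index_enum_uniq _).
  rewrite (_ : (fun i => if _ then _ else _) = (fun=> 2 / N.+1%:R)%R)//.
  by apply/funext => i; rewrite mem_index_enum.
elim: S => [|k S ih] /=; first by rewrite big_nil mul1e.
move=> /andP[kS uS]; apply: (le_trans (ih uS)); rewrite big_cons.
have N0 : (0 < N.+1%:R :> R)%R by rewrite ltr0n.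
have p0 : (0 < \prod_(j <- S | j \notin P) N.+1%:R :> R)%R by apply: prodr_gt0.
case: ifPn => kP; last first.
  rewrite lee_pmul2l ?lte_fin//; apply/hausdorff_pre_sub/sphere_box_sub => i iP.
  by rewrite inE; case: eqVneq => // ik; move: kP; rewrite -ik iP.
rewrite [(N.+1%:R * \prod_(_ <- _ | _) _)%R]mulrC EFinM -muleA lee_pmul2l ?lte_fin//.
pose L1 i := if i \in S then (2 / N.+1%:R)%R else 1%R : R.
pose L2 i := if i \in k :: S then (2 / N.+1%:R)%R else 1%R : R.
have E1 : L1 k = 1%R by rewrite /L1 (negbTE kS).
have E2 : L2 k = (2 / N.+1%:R)%R by rewrite /L2 inE eqxx.
apply: (@sphere_box_pre_coord s P rho d L1 L2 k N kP E1 E2) => i ik.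
by rewrite /L1 /L2 inE (negbTE ik).
Qed.

Lemma ediam_le (A : set 'rV[R]_n) (r : R) : (0 <= r)%R ->
  (forall x y i, A x -> A y -> `|x 0%R i - y 0%R i| <= r)%R ->
  ediam A <= (n%:R * r)%:E.
Proof.
move=> r0 Ar; apply: ge_ereal_sup => _ [x Ax [y Ay <-]].
rewrite lee_fin enorm_le ?mulr_ge0//.
apply: (@le_trans _ _ (\sum_(i < n) r ^+ 2)%R).
  apply: ler_sum => i _; rewrite -real_normK ?num_real//.
  by rewrite ler_pXn2r ?nnegrE// !mxE; exact: Ar.
rewrite sumr_const card_ord -[leLHS]mulr_natl exprMn ler_wpM2r ?sqr_ge0//.
by rewrite -natrX ler_nat; case: (n) => // k; rewrite expnS leq_pmulr// expn_gt0.
Qed.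

(** For a single coordinate the sphere is one point and the box is a flat (n-1)-cube. Its
    (N+1)^(n-1) pieces have diameter at most 2n/(N+1), so their total weight is bounded
    independently of N. *)
Lemma sphere_box_hausdorff_fin (i : 'I_n) :
  hausdorff n.-1 (sphere_box [set i]%SET 1%R (fun=> 1%R : R)) < +oo.
Proof.
pose om := lebesgue_rV (eball (0%R : 'rV[R]_n.-1) 1%R).
apply: (@le_lt_trans _ _ (om * (n%:R ^+ n.-1)%:E)); last first.
  by rewrite /om -(fineK (unit_ball_fin_num R n.-1)) -EFinM ltry.
apply: hausdorff_le => d d0.
pose N := Num.truncn (n%:R * 2 / d)%R.
have N0 : (0 < N.+1%:R :> R)%R by rewrite ltr0n.
have hN : (n%:R * (2 / N.+1%:R) <= d)%R.
  have : (n%:R * 2 / d < N.+1%:R)%R by exact: truncnS_gt.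
  rewrite ltr_pdivrMr// => /ltW.
  by rewrite [(n%:R * (2 / _))%R]mulrA ler_pdivrMr// [(d * _)%R]mulrC.
apply: (le_trans (sphere_box_pre n.-1 [set i]%SET 1 d N)).
rewrite cards1 subn1.
pose A := sphere_box [set i]%SET 1%R (fun=> (2 / N.+1%:R)%R : R).
have two0 : (0 <= 2 / N.+1%:R :> R)%R by rewrite divr_ge0// ltW.
have dA : ediam A <= (n%:R * (2 / N.+1%:R))%:E.
  apply: ediam_le => // x y k [x1 x2 x3] [y1 y2 y3].
  have [->|ki] := eqVneq k i.
    move: x2 y2; rewrite /partial_sqnorm !big_set1 => x2 y2.
    have ii : i \in [set i]%SET by rewrite inE.
    have := x1 i ii; have := y1 i ii => yi xi.
    have := eqrXn2 (n := 2) isT (ltW xi) (ltW yi); rewrite x2 y2 eqxx => /esym/eqP ->.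
    by rewrite subrr normr0.
  have kP : k \notin [set i]%SET by rewrite inE.
  have /= /andP[a b] := x3 k kP; have /= /andP[a' b'] := y3 k kP.
  by rewrite ler_norml; set q := (2 / _)%R in b b' *; apply/andP; split; lra.
apply: (@le_trans _ _ ((N.+1%:R ^+ n.-1)%:E * hausdorff_weight n.-1 A)).
  rewrite lee_pmul2l ?lte_fin ?exprn_gt0//.
  have := @hausdorff_pre_le R n n.-1 d A (fun k => if k is 0%N then A else set0).
  rewrite nneseries_recl//; last by case=> [|k] _ /=; [exact: weight_ge0|rewrite weight_set0].
  rewrite eseries0 ?adde0; last by case=> // k _ _; rewrite weight_set0.
  apply; first by move=> x Ax; exists 0%N.
  case=> [|k]; last by rewrite ediam0 leNye.
  by apply: (le_trans dA); rewrite lee_fin.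
have [A0|/set0P A0] := eqVneq A set0.
  by rewrite A0 weight_set0 mule0 mule_ge0// ?(ltW (unit_ball_gt0 _ _))// lee_fin exprn_ge0.
rewrite /hausdorff_weight.
have /set0P/negbTE -> := A0.
rewrite muleCA; apply: lee_pmul.
- exact/ltW/unit_ball_gt0.
- apply: mule_ge0; first by rewrite lee_fin exprn_ge0// ltW.
  by apply/expe_ge0/mule_ge0; [rewrite lee_fin invr_ge0|exact: ediam_ge0].
- exact: lexx.
apply: (@le_trans _ _ ((N.+1%:R ^+ n.-1)%:E * ((2^-1)%:E * (n%:R * (2 / N.+1%:R))%:E) ^+ n.-1)).
  rewrite lee_pmul2l ?lte_fin ?exprn_gt0//; apply: lee_expe.
    by apply: mule_ge0; [rewrite lee_fin invr_ge0|exact: ediam_ge0].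
  by rewrite lee_pmul2l ?lte_fin ?invr_gt0.
rewrite -EFinM -EFin_expe -EFinM lee_fin -exprMn le_eqVlt; apply/orP; left; apply/eqP.
by congr (_ ^+ _)%R; field; lra.
Qed.

(** Over each point of a small box in the coordinates other than [i] lies a point of the sphere. A
    cover of the sphere therefore gives, by projection along [i], a cover of that box by boxes of
    sides twice the diameters, and volumes give a lower bound on its weight. *)
Lemma sphere_box_hausdorff_gt0 (P : {set 'I_n}) (i : 'I_n) : i \in P ->
  0 < hausdorff n.-1 (sphere_box P 1%R (fun=> 1%R : R)).
Proof.
move=> iP; pose s := n.-1.
apply: lt_le_trans (hausdorff_pre_le_hausdorff _ _ ltr01).
(* Chosen so that 2a(n+1) = 1: fewer than n+1 squares of numbers below 2a sum to less than 1, which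
   leaves a positive coordinate [i] on the unit sphere. *)
pose a : R := (1 / (2 * n.+1%:R))%R.
have n0 : (0 < n.+1%:R :> R)%R by rewrite ltr0n.
have a0 : (0 < a)%R by rewrite divr_gt0// mulr_gt0.
(* Sides of length 1 in the direction [i], here and in [Bx], turn (n-1)-dimensional volumes of
   projections into n-dimensional ones. *)
pose G := [set x : 'rV[R]_n | forall k, x 0%R k \in if k == i then `]0%R, 1%R[ else `]a, (2 * a)%R[].
have mG : measurable G by exact: measurable_itv_box.
have LG : 0 < lebesgue_rV G.
  rewrite /G lebesgue_rV_itv (eq_bigr (fun k => (if k == i then 1 else a)%:E)); last first.
    move=> k _; case: ifP => _; rewrite lebesgue_measure_itv /= lte_fin.
      by rewrite ltr01 oppr0 adde0.
    by rewrite (_ : (a < 2 * a)%R); [rewrite -EFinB; congr EFin; ring|lra].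
  rewrite -(big_morph EFin EFinM (erefl _)) lte_fin.
  by apply: prodr_gt0 => k _; case: ifP.
pose om := lebesgue_rV (eball (0%R : 'rV[R]_s) 1%R).
have omE := fineK (unit_ball_fin_num R s); have om0 := unit_ball_gt0 R s.
pose c : R := (4 ^+ s / fine om)%R.
have fom0 : (0 < fine om)%R by rewrite -lte_fin omE.
have c0 : (0 < c)%R by rewrite divr_gt0 ?exprn_gt0.
apply: (@lt_le_trans _ _ (c^-1%:E * lebesgue_rV G)).
  by rewrite mule_gt0// lte_fin invr_gt0.
apply: le_ereal_inf_tmp => _ [C [AC Cd] <-].
rewrite lee_pdivrMl//.
pose D k : R := fine (ediam (C k)).
pose p k : 'rV[R]_n := xget 0%R (C k).
pose J k j := if j == i then `[0%R, 1%R] else `[(p k 0%R j - D k)%R, (p k 0%R j + D k)%R].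
pose Bx k : set 'rV[R]_n := if C k == set0 then set0 else
  [set x : 'rV[R]_n | forall j, x 0%R j \in J k j].
have hC k : C k !=set0 -> [/\ C k (p k), ediam (C k) = (D k)%:E & (0 <= D k)%R].
  move=> C0; have d0 := ediam_ge0 C0; split.
  - by apply: xgetPex.
  - rewrite fineK// ge0_fin_numE//; by apply: (le_lt_trans (Cd k)); rewrite ltry.
  - by rewrite fine_ge0.
have mB k : measurable (Bx k).
  by rewrite /Bx; case: ifP => // _; exact: measurable_itv_box.
apply: (@le_trans _ _ (\sum_(0 <= k <oo) lebesgue_rV (Bx k))).
  apply: measure_sigma_subadditive => // x Gx.
  pose r2 := (1 - \sum_(k in P :\ i) x 0 k ^+ 2)%R.
  have Gk k : k != i -> (a < x 0%R k < 2 * a)%R.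
    by move=> ki; have := Gx k; rewrite (negbTE ki) in_itv.
  have na : (2 * a * n.+1%:R = 1)%R by rewrite /a; field; lra.
  have r20 : (0 < r2)%R.
    rewrite subr_gt0; apply: (@le_lt_trans _ _ (\sum_(k < n) (2 * a) ^+ 2)%R).
      rewrite big_mkcond; apply: ler_sum => k _; case: ifP; last by rewrite sqr_ge0.
      rewrite in_setD1 => /andP[/Gk/andP[k1 k2] _].
      by rewrite ler_pXn2r// ?nnegrE; lra.
    rewrite sumr_const card_ord -mulr_natl expr2.
    move: na; rewrite -natr1 => na.
    have : (0 <= n%:R :> R)%R by [].
    nra.
  pose z := upd i x (Num.sqrt r2).
  have a1 : (2 * a <= 1)%R.
    by rewrite -[leRHS]na; apply: ler_peMr; [rewrite mulr_ge0// ltW|rewrite ler1n].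
  have Yz : sphere_box P 1%R (fun=> 1%R) z.
    split.
    - move=> k kP; rewrite mxE; case: eqP => [_|/eqP/Gk/andP[k1 _]]; first by rewrite sqrtr_gt0.
      exact: lt_trans k1.
    - rewrite /partial_sqnorm (big_setD1 i)//= mxE eqxx sqr_sqrtr ?ltW//.
      rewrite expr1n /r2 [X in (_ + X)%R](eq_bigr (fun k => x 0 k ^+ 2)%R) ?subrK// => k.
      by rewrite in_setD1 => /andP[/negbTE ki _]; rewrite mxE ki.
    - move=> k kP; have ki : k != i by apply: contraNneq kP => ->.
      by rewrite mxE (negbTE ki); have /andP[k1 k2] := Gk k ki; apply/andP; split; lra.
  have [k _ Ck] := AC z Yz; exists k => //.
  have C0 : C k !=set0 by exists z.
  have [Cp dE D0] := hC k C0.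
  rewrite /Bx ifF; last exact/negbTE/set0P.
  move=> j; rewrite /J; have [->|ji] := eqVneq j i.
    by have := Gx i; rewrite eqxx !in_itv /= => /andP[? ?]; rewrite !ltW.
  have := enorm_le_ediam Ck Cp; rewrite dE lee_fin => /(le_trans (coord_le_enorm _ j)).
  rewrite !mxE (negbTE ji) in_itv /= ler_norml => /andP[h1 h2].
  by apply/andP; split; lra.
rewrite -nneseriesZl; last by move=> k _; exact: weight_ge0.
apply: lee_nneseries => [k _ _|k _]; first exact: measure_ge0.
have [C0|/set0P C0] := eqVneq (C k) set0.
  by rewrite /Bx C0 eqxx measure0 weight_set0 mule0.
have [Cp dE D0] := hC k C0.
rewrite /Bx /hausdorff_weight.
have /set0P/negbTE -> := C0.
rewrite lebesgue_rV_itv (eq_bigr (fun j => (if j == i then 1 else 2 * D k)%R%:E)); last first.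
  move=> j _; rewrite /J; case: ifP => _; rewrite lebesgue_measure_itv /= lte_fin.
    by rewrite ltr01 oppr0 adde0.
  case: ltP => h; first by rewrite -EFinB; congr EFin; ring.
  by congr EFin; lra.
rewrite -(big_morph EFin EFinM (erefl _)) -omE dE -EFinM -EFin_expe -!EFinM lee_fin.
rewrite (bigD1 i)//= eqxx mul1r (eq_bigr (fun=> (2 * D k)%R)); last by move=> j /negbTE ->.
rewrite (eq_bigl (fun j => j \notin [set i]%SET)); last by move=> j; rewrite inE.
rewrite prod_notin cards1 subn1 -/s.
rewrite (_ : (2 * D k = 4 * (2^-1 * D k))%R); last by field.
rewrite exprMn /c -/om mulrA divfK ?gt_eqF//.
Qed.

End sphere_box_bounds.

(** * The divergence theorem on tubes *)

Section cube_calculus.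
Context (R : realType) (n : nat).
Local Notation L := (@lebesgue_rV R n).
Local Notation lam := (@lebesgue_measure R).
Local Notation I01 := [set` `[0%R : R, 1%R]].

Lemma compact_cube : compact (@cube R n).
Proof.
have := @rV_compact R n (fun=> [set` `[0%R : R, 1%R]]) (fun=> @segment_compact R 0 1).
by congr compact; apply/seteqP; split => x h i; have := h i; rewrite /= in_itv.
Qed.

Lemma continuous_bounded_cube (f : 'rV[R]_n -> R) : continuous f ->
  exists M, forall x, cube x -> `|f x| <= M.
Proof.
move=> cf.
have : bounded_set (f @` cube).
  by apply/compact_bounded/continuous_compact; [exact: continuous_subspaceT|exact: compact_cube].
move=> [M [_ HM]]; exists (M + 1) => x cx.
by apply: (HM (M + 1)); [rewrite ltrDl|exists x].
Qed.

Lemma updE i (x : 'rV[R]_n) t : upd i x t = x + (t - x 0 i) *: delta_mx 0 i.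
Proof.
apply/rowP => j; rewrite !mxE /=; have [->|ji] := eqVneq j i.
  by rewrite mulr1 subrKC.
by rewrite mulr0 addr0.
Qed.

Lemma upd_id i (x : 'rV[R]_n) : upd i x (x 0 i) = x.
Proof. by rewrite updE subrr scale0r addr0. Qed.

Lemma updD i (x : 'rV[R]_n) t h : upd i x (h + t) = h *: delta_mx 0 i + upd i x t.
Proof. by rewrite !updE addrCA -scalerDl addrA. Qed.

Lemma upd_swap i j (x : 'rV[R]_n) t u : i != j ->
  upd i (upd j x t) u = upd j (upd i x u) t.
Proof.
move=> ij; apply/rowP => k; rewrite !mxE.
by case: (eqVneq k i) => [->|ki]; rewrite ?(negbTE ij) ?mxE ?eqxx ?(negbTE ki).
Qed.

Lemma continuous_upd i (x : 'rV[R]_n) : continuous (upd i x).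
Proof.
rewrite (_ : upd i x = (fun t => x + (t - x 0 i) *: delta_mx 0 i)); last first.
  by apply/funext => t; exact: updE.
move=> t; apply: (@continuousD _ _ _ (cst x) (fun t : R => (t - x 0 i) *: delta_mx 0 i)).
  exact: cst_continuous.
apply: (@continuous_comp _ _ _ (fun t : R => t - x 0 i) (fun c : R => c *: (delta_mx 0 i : 'rV[R]_n))).
  by apply: (@continuousB _ _ _ id (cst (x 0 i))); [exact: cvg_id|exact: cst_continuous].
exact: scalel_continuous.
Qed.

Lemma is_derive_upd (T : 'rV[R]_n -> 'rV[R]_n) i (x : 'rV[R]_n) (t : R) :
  differentiable T (upd i x t) ->
  is_derive t 1 (fun t => T (upd i x t) 0 i)
    (('D_(delta_mx 0 i) T (upd i x t)) 0 i).
Proof.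
move=> dT; have dv : derivable T (upd i x t) (delta_mx 0 i).
  exact: diff_derivable.
rewrite (derive_mx dv) mxE.
have dc : derivable (fun y => T y 0 i) (upd i x t) (delta_mx 0 i).
  by move/derivable_mxP : dv.
have E : (fun h : R => h^-1 *: (((fun t => T (upd i x t) 0 i) \o shift t) (h *: 1) - T (upd i x t) 0 i)) =
  (fun h : R => h^-1 *: (((fun y => T y 0 i) \o shift (upd i x t)) (h *: delta_mx 0 i) - T (upd i x t) 0 i)).
  by apply/funext => h /=; rewrite -[h *: 1]/(h * 1) mulr1 updD.
by split; rewrite /derivable /derive E.
Qed.

(* On the coordinate line through [z] in the direction [k], [orthant_tube P rho]
   is the segment from [0] to [slice_top P rho k z], provided
   [slice_room P rho k z] is nonnegative; otherwise the line misses it. *)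
Definition slice_room (P : {set 'I_n}) (rho : R) k (z : 'rV[R]_n) : R :=
  rho - partial_sqnorm (P :\ k) z.

Definition slice_top (P : {set 'I_n}) (rho : R) k (z : 'rV[R]_n) : R :=
  if k \in P then Num.min 1 (Num.sqrt (slice_room P rho k z)) else 1.

Lemma partial_sqnorm_setD1_upd (P : {set 'I_n}) k (z : 'rV[R]_n) t :
  partial_sqnorm (P :\ k) (upd k z t) = partial_sqnorm (P :\ k) z.
Proof.
apply: eq_bigr => i; rewrite in_setD1 => /andP[/negbTE ik _].
by rewrite mxE ik.
Qed.

Lemma partial_sqnorm_updE (P : {set 'I_n}) k (z : 'rV[R]_n) t :
  partial_sqnorm P (upd k z t) = (if k \in P then t ^+ 2 else 0) + partial_sqnorm (P :\ k) z.
Proof.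
case: ifP => kP.
  by rewrite -(partial_sqnorm_setD1_upd P k z t) {1}/partial_sqnorm (big_setD1 k)//= mxE eqxx.
rewrite add0r partial_sqnorm_upd ?kP//; apply: eq_bigl => i; rewrite in_setD1.
by have [->|] := eqVneq i k; rewrite ?kP.
Qed.

Lemma slice_top_ge0 P rho k z : 0 <= slice_top P rho k z.
Proof. by rewrite /slice_top; case: ifP => // _; rewrite le_min ler01 sqrtr_ge0. Qed.

Lemma slice_top_le1 P rho k z : slice_top P rho k z <= 1.
Proof. by rewrite /slice_top; case: ifP => // _; rewrite ge_min lexx. Qed.

Lemma slice_tubeP P rho k z t : 0 <= t <= 1 ->
  (partial_sqnorm P (upd k z t) <= rho) =
  (0 <= slice_room P rho k z) && (t <= slice_top P rho k z).
Proof.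
move=> /andP[t0 t1]; rewrite partial_sqnorm_updE -lerBrDr -/(slice_room P rho k z).
rewrite /slice_top; set w := slice_room P rho k z; case: ifP => _; last by rewrite t1 andbT.
rewrite le_min t1 /=; have [w0|w0] /= := leP 0 w.
  by rewrite -{1}(sqr_sqrtr w0) ler_pXn2r ?nnegrE ?sqrtr_ge0.
by apply/negbTE; rewrite -ltNge (lt_le_trans w0)// sqr_ge0.
Qed.

Lemma measurable_slice_room P rho k :
  measurable_fun setT (slice_room P rho k : _ -> measurableTypeR R).
Proof. apply: measurable_funB => //; exact: measurable_partial_sqnorm. Qed.

Lemma measurable_slice_top P rho k :
  measurable_fun setT (slice_top P rho k : _ -> measurableTypeR R).
Proof.
rewrite /slice_top; case: (k \in P); last exact: measurable_cst.
apply: measurable_minr; first exact: measurable_cst.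
apply: (@measurableT_comp _ _ _ _ _ _ (@Num.sqrt R)); last exact: measurable_slice_room.
by apply: continuous_measurable_fun; exact: sqrt_continuous.
Qed.

(** Averaging along the coordinate [k] reduces the integral of the derivative to the fundamental
    theorem of calculus on one segment of the tube. *)
Lemma slice_integral P rho k (f g : 'rV[R]_n -> R) :
  (forall z, cube z -> forall t : R, is_derive t 1 (fun t => f (upd k z t)) (g (upd k z t))) ->
  continuous g ->
  (\int[L]_(z in orthant_tube P rho) (g z)%:E =
   \int[L]_(z in cube) ((0 <= slice_room P rho k z)%R%:R *
      (f (upd k z (slice_top P rho k z)) - f (upd k z 0)))%:E)%E.
Proof.
move=> dfg cg; have [M gM] := continuous_bounded_cube cg.
pose A := [set z : 'rV[R]_n | partial_sqnorm P z <= rho].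
have mA : measurable A by exact: measurable_sqnorm_le.
have mg : measurable_fun setT (g : _ -> measurableTypeR R).
  exact: continuous_measurable_rV.
transitivity (\int[L]_(z in cube) (\1_A z * g z)%:E)%E.
  rewrite [LHS]integral_mkcond [RHS]integral_mkcond; apply: eq_integral => z _.
  rewrite !patchE /orthant_tube indicE.
  have -> : (z \in [set z | cube z /\ partial_sqnorm P z <= rho]) = (z \in cube) && (z \in A).
    by apply/idP/andP; rewrite !inE.
  by case: (z \in cube) => //=; case: (z \in A); rewrite ?mul1r ?mul0r.
rewrite (@cube_integral_upd_bounded _ _ k _ M); last 2 first.
- by apply: measurable_funM => //; exact: measurable_indic.
- move=> z cz; rewrite normrM indicE; apply: le_trans (gM z cz).
  by case: (z \in A); rewrite ?normr1 ?mul1r// normr0 mul0r.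
apply: eq_integral => z; rewrite inE => cz.
have inA t : 0 <= t <= 1 -> (upd k z t \in A) =
    (0 <= slice_room P rho k z) && (t <= slice_top P rho k z).
  by move=> t01; rewrite -slice_tubeP//; apply/idP/idP; rewrite inE.
have [w0|w0] := leP 0 (slice_room P rho k z); last first.
  rewrite mul0r; apply: integral0_eq => t; rewrite /= in_itv /= => t01.
  by rewrite indicE inA// leNgt w0 mul0r.
rewrite mul1r; set s := slice_top P rho k z.
have s0 : 0 <= s by exact: slice_top_ge0.
have s1 : s <= 1 by exact: slice_top_le1.
transitivity (\int[lam]_(t in `[0%R, s]) (g (upd k z t))%:E)%E.
  rewrite [LHS]integral_mkcond [RHS]integral_mkcond; apply: eq_integral => t _.
  rewrite !patchE; case: ifPn; rewrite ?notin_setE ?inE /= in_itv /=.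
    move=> t01; rewrite indicE inA// w0 /=; have /andP[t0 t1] := t01.
    case: ifPn; rewrite ?notin_setE ?inE /= in_itv /= t0 /=; first by move=> ->; rewrite mul1r.
    by move=> /negP/negbTE ->; rewrite mul0r.
  move=> t01; rewrite ifF//; apply/negbTE; rewrite notin_setE /= in_itv /=.
  by move=> /andP[t0 ts]; apply: t01; rewrite t0 (le_trans ts).
move: s0; rewrite le_eqVlt => /predU1P[<-|s0].
  by rewrite set_itv1 integral_set1 subrr.
rewrite (@continuous_FTC2 _ _ (fun t => f (upd k z t)))//.
- apply: continuous_comp_itv => t.
  by apply: (@continuous_comp _ _ _ (upd k z) g); [exact: continuous_upd|exact: cg].
- exact: derivable_oo_of_is_derive (dfg z cz).
- by move=> t _; rewrite (derive1_of_is_derive (dfg z cz)).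
Qed.

End cube_calculus.

(** * Tubes about arbitrary faces *)

Section vertex_tubes.
Context (R : realType) (n : nat).
Local Notation L := (@lebesgue_rV R n).
Implicit Types (e : 'I_n -> bool) (P : {set 'I_n}).

Lemma continuous_rV (X : topologicalType) (f : X -> 'rV[R]_n) :
  (forall i, continuous (fun x => f x 0 i)) -> continuous f.
Proof.
move=> cf x A /nbhs_ballP[e /= e0 eA].
have h : \forall y \near x, forall i, `|f x 0 i - f y 0 i| < e.
  apply: filter_forall => i; have := cf i x => /cvgrPdist_lt/(_ e e0).
  exact.
apply: filterS h => y hy; apply: eA; split => // i j.
by rewrite (ord1 i) /ball /=; exact: hy.
Qed.

Lemma continuous_flip e : continuous (@flip R n e).
Proof.
apply: continuous_rV => i; rewrite /flip.
have cc : continuous (fun x : 'rV[R]_n => x 0 i) by exact: coord_continuous.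
case E : (e i).
  under eq_fun do rewrite mxE E.
  by move=> x; apply: (@continuousB R R 'rV[R]_n (cst 1) (fun x : 'rV[R]_n => x 0 i));
    [exact: cst_continuous|exact: cc].
by under eq_fun do rewrite mxE E.
Qed.

(** The tube of squared radius [rho] about the face on which [x_i] is [e i] for [i] in [P]; thus [P]
    is the set of fixed coordinates and its cardinality is the codimension. *)
Definition vertex_tube e P (rho : R) : set 'rV[R]_n :=
  [set x | orthant_tube P rho (flip e x)].

Lemma measurable_vertex_tube e P rho : measurable (vertex_tube e P rho).
Proof.
have := @measurable_flip R n e measurableT (orthant_tube P rho) (measurable_orthant_tube _ _).
by rewrite setTI.
Qed.

Lemma vertex_tube_cube e P rho : vertex_tube e P rho `<=` cube.
Proof. by move=> x [cx _]; rewrite -(flipK e x); exact: cube_flip. Qed.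

Lemma integral_vertex_tube e P rho (g : 'rV[R]_n -> \bar R) : measurable_fun setT g ->
  (\int[L]_(x in vertex_tube e P rho) g x = \int[L]_(z in orthant_tube P rho) g (flip e z))%E.
Proof.
move=> mg; pose h := g \_ (vertex_tube e P rho).
have mh : measurable_fun setT h.
  apply/(measurable_restrictT _ _).1; first exact: measurable_vertex_tube.
  exact: measurable_funTS.
transitivity (\int[L]_(x in cube) h x)%E.
  rewrite [LHS]integral_mkcond [RHS]integral_mkcond; apply: eq_integral => x _.
  rewrite /h !patchE; case: (boolP (x \in vertex_tube e P rho)) => hx; last by rewrite if_same.
  by rewrite mem_set//; apply: vertex_tube_cube; move: hx; rewrite inE; exact.
rewrite -(cube_integral_flip_signed e mh).
rewrite [LHS]integral_mkcond [RHS]integral_mkcond; apply: eq_integral => x _.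
rewrite /h !patchE.
have -> : (flip e x \in vertex_tube e P rho) = (x \in orthant_tube P rho).
  by apply/idP/idP; rewrite !inE /vertex_tube /= flipK.
case: (boolP (x \in orthant_tube P rho)) => hx; last by rewrite if_same.
by rewrite ifT//; move: hx; rewrite !inE => -[].
Qed.

Lemma lebesgue_vertex_tube e P rho :
  L (vertex_tube e P rho) = orthant_ball_volume #|P| rho.
Proof.
rewrite -lebesgue_orthant_tube.
have mt := measurable_vertex_tube e P rho; have mo := measurable_orthant_tube P rho.
have := @integral_vertex_tube e P rho (cst 1%E) (measurable_cst _).
by rewrite !integral_cst// !mul1e.
Qed.

Lemma flip_upd e k (z : 'rV[R]_n) t :
  flip e (upd k z t) = upd k (flip e z) (if e k then 1 - t else t).
Proof.
by apply/rowP => j; rewrite !mxE; case: (eqVneq j k) => [->|_]; rewrite ?mxE.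
Qed.

Definition flip_sign e (k : 'I_n) : R := if e k then -1 else 1.

Section divergence_theorem.
Variables (e : 'I_n -> bool) (T : 'rV[R]_n -> 'rV[R]_n).
Hypothesis dT : forall x, differentiable T x.
Hypothesis cT : forall v, continuous ('D_v T).

Lemma continuous_field k : continuous (fun x => T x 0 k).
Proof.
move=> x; apply: (@continuous_comp _ _ _ T (fun y : 'rV[R]_n => y 0 k)).
  exact: differentiable_continuous.
exact: coord_continuous.
Qed.

Lemma continuous_derive_coord k : continuous (fun x => ('D_(delta_mx 0 k) T x) 0 k).
Proof.
move=> x; apply: (@continuous_comp _ _ _ ('D_(delta_mx 0 k) T) (fun y : 'rV[R]_n => y 0 k)).
  exact: cT.
exact: coord_continuous.
Qed.

Let f k (z : 'rV[R]_n) := flip_sign e k * T (flip e z) 0 k.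
Let g k (z : 'rV[R]_n) := ('D_(delta_mx 0 k) T (flip e z)) 0 k.

Lemma is_derive_flip_field k (z : 'rV[R]_n) (t : R) :
  is_derive t 1 (fun t => f k (upd k z t)) (g k (upd k z t)).
Proof.
rewrite /f /g flip_upd.
have D u := @is_derive_upd R n T k (flip e z) u (dT _).
rewrite /flip_sign.
rewrite (_ : (fun t => _) = (fun t => (if e k then -1 else 1) *
   T (upd k (flip e z) (if e k then 1 - t else t)) 0 k)); last first.
  by apply/funext => u; rewrite flip_upd.
case: (e k); last first.
  by under eq_fun do rewrite mul1r.
have D1 : is_derive t 1 (fun t : R => 1 - t) (-1).
  by apply: is_derive_eq; ring.
have := @is_derive1_comp R (fun u => T (upd k (flip e z) u) 0 k) (fun t : R => 1 - t) t _ _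
  (D (1 - t)) D1.
rewrite mulrN1 => D2.
have := @is_deriveN _ _ _ _ _ _ _ D2; rewrite opprK.
by congr (is_derive _ _ _ _); apply/funext => u /=; rewrite mulN1r.
Qed.

Lemma continuous_flip_derive k : continuous (g k).
Proof.
move=> z; apply: (@continuous_comp _ _ _ (@flip R n e) (fun x => ('D_(delta_mx 0 k) T x) 0 k)).
  exact: continuous_flip.
exact: continuous_derive_coord.
Qed.

Lemma measurable_divergence : measurable_fun setT (divergence T : _ -> measurableTypeR R).
Proof.
apply: measurable_sum => k; apply: continuous_measurable_rV.
exact: continuous_derive_coord.
Qed.

(** Each term of the divergence is integrated along its own direction, where the reflected tube is a
    segment starting on a facet. *)
Lemma integral_divergence P rho :
  (\int[L]_(x in vertex_tube e P rho) (divergence T x)%:E =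
   \sum_(k < n) \int[L]_(z in cube) ((0 <= slice_room P rho k z)%R%:R *
      (f k (upd k z (slice_top P rho k z)) - f k (upd k z 0)))%:E)%E.
Proof.
rewrite integral_vertex_tube; last first.
  by apply/measurable_EFinP; exact: measurable_divergence.
under eq_integral do rewrite -sumEFin.
rewrite integral_sum//; last 2 first.
- exact: measurable_orthant_tube.
- move=> k; have [M gM] := continuous_bounded_cube (@continuous_flip_derive k).
  apply: (@integrableS _ _ _ L cube).
  + exact: measurable_cube.
  + exact: measurable_orthant_tube.
  + by move=> z [].
  apply: (@integrable_cube _ _ _ M) => //.
  by apply: continuous_measurable_rV; exact: continuous_flip_derive.
apply: eq_bigr => k _; apply: slice_integral; last exact: continuous_flip_derive.
by move=> z _ t; exact: is_derive_flip_field.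
Qed.

End divergence_theorem.

Lemma measurable_upd_fun k (u : 'rV[R]_n -> R) :
  measurable_fun setT (u : _ -> measurableTypeR R) ->
  measurable_fun setT (fun z => upd k z (u z)).
Proof.
move=> mu.
have mp : measurable_fun setT (fun z : 'rV[R]_n => (z, u z) : 'rV[R]_n * measurableTypeR R).
  by apply/measurable_fun_pairP; split; [exact: measurable_id|exact: mu].
exact: (measurableT_comp (@measurable_upd R n k) mp).
Qed.

Lemma measurable_room_indic P rho k :
  measurable_fun setT (fun z : 'rV[R]_n => (0 <= slice_room P rho k z)%R%:R : measurableTypeR R).
Proof.
rewrite (_ : (fun z => _) = \1_(slice_room P rho k @^-1` [set` `[0, +oo[])); last first.
  apply/funext => z; rewrite indicE; congr (nat_of_bool _)%:R.
  by apply/idP/idP; rewrite inE /= in_itv /= andbT.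
apply: measurable_indic; rewrite -[X in measurable X]setTI.
by apply: measurable_slice_room => //; exact: measurable_itv.
Qed.

Lemma measurable_slice_diff P rho k (f : 'rV[R]_n -> R) :
  measurable_fun setT (f : _ -> measurableTypeR R) ->
  measurable_fun setT (fun z => (0 <= slice_room P rho k z)%R%:R *
    (f (upd k z (slice_top P rho k z)) - f (upd k z 0)) : measurableTypeR R).
Proof.
move=> mf; apply: measurable_funM; first exact: measurable_room_indic.
apply: measurable_funB; apply: (measurableT_comp mf); apply: measurable_upd_fun.
  exact: measurable_slice_top.
exact: measurable_cst.
Qed.

Lemma slice_diff_le P rho k (f : 'rV[R]_n -> R) M z : 0 <= M ->
  (forall x, cube x -> `|f x| <= M) -> cube z ->
  `|(0 <= slice_room P rho k z)%R%:R *
    (f (upd k z (slice_top P rho k z)) - f (upd k z 0))| <= 2 * M.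
Proof.
move=> M0 fM cz; rewrite normrM.
case: (0 <= _); rewrite ?normr0 ?mul0r ?mulr_ge0// normr1 mul1r.
rewrite mulrDl mul1r (le_trans (ler_normB _ _))//.
by apply: lerD; apply: fM; apply: cube_upd => //;
  rewrite ?lexx ?ler01// slice_top_ge0 slice_top_le1.
Qed.

(** Each direction contributes the integral of a difference of two values of a field of norm at most
    1, hence at most 2, whatever the compact set. *)
Lemma vertex_tube_finite_perimeter e P rho :
  locally_finite_perimeter (vertex_tube e P rho).
Proof.
move=> K _; apply: (@le_lt_trans _ _ (\sum_(k < n) 2%:E)%E); last first.
  by rewrite sumEFin ltry.
apply: ge_ereal_sup => _ [T [[dT cT _] _ T1] <-].
rewrite (integral_divergence e dT cT); apply: lee_sum => k _.
set f := fun z : 'rV[R]_n => flip_sign e k * T (flip e z) 0 k.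
have cf : continuous f.
  move=> z; apply: (@continuousM _ _ (cst (flip_sign e k)) (fun z => T (flip e z) 0 k)).
    exact: cst_continuous.
  apply: (@continuous_comp _ _ _ (@flip R n e) (fun x => T x 0 k)).
    exact: continuous_flip.
  exact: continuous_field.
have mf : measurable_fun setT (f : _ -> measurableTypeR R) by exact: continuous_measurable_rV.
have f1 x : cube x -> `|f x| <= 1.
  move=> _; rewrite /f normrM /flip_sign; have -> : `|if e k then -1 else 1 : R| = 1.
    by case: (e k); rewrite ?normrN normr1.
  by rewrite mul1r (le_trans (coord_le_enorm _ _)).
have ms := measurable_slice_diff P rho k mf.
have bs z := @slice_diff_le P rho k f 1 z ler01 f1.
apply: (@le_trans _ _ (\int[L]_(z in cube) (cst 2%:E z))%E).
  apply: le_integral.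
  - exact: measurable_cube.
  - exact: integrable_cube ms bs.
  - exact: (@integrable_cube R n (cst (2 : R)) `|2| (measurable_cst _) (fun _ _ => lexx _)).
  - move=> z; rewrite inE => cz; rewrite lee_fin.
    by apply: (le_trans (ler_norm _)); apply: (le_trans (bs z cz)); rewrite mulr1.
by rewrite integral_cst//= [X in (_ * X)%E]cube_cst mule1.
Qed.

End vertex_tubes.

(** * The reduced boundary of a tube lies on a sphere *)

Section bump.
Context (R : realType).

Lemma is_derive_quadratic (f : R -> R) (u d : R) :
  (forall v, `|f v - f u - d * (v - u)| <= (v - u) ^+ 2) -> is_derive u 1 f d.
Proof.
move=> H.
have C : (h^-1 *: ((f \o shift u) (h *: (1 : R)) - f u) @[h --> 0^']) --> d.
  apply/cvgrPdist_le => eps eps0; near=> h.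
  have h0 : h != 0 by near: h; exact: nbhs_dnbhs_neq.
  have he : `|h| <= eps by near: h; exact: dnbhs0_le.
  rewrite /= -[h *: 1]/(h * 1) mulr1 -[_ *: _]/(_ * _).
  have := H (h + u); rewrite addrK => Hh.
  rewrite (_ : d - h^-1 * (f (h + u) - f u) = - (h^-1 * (f (h + u) - f u - d * h))); last by field.
  rewrite normrN normrM normfV ler_pdivrMl ?normr_gt0//.
  by apply: (le_trans Hh); rewrite -real_normK ?num_real// expr2 ler_wpM2l.
by split; [apply/cvg_ex; exists d|exact/cvg_lim].
Unshelve. all: by end_near. Qed.

Definition pos_sq (u : R) : R := Num.max 0 u ^+ 2.

Lemma is_derive_pos_sq (u : R) : is_derive u 1 pos_sq (2 * Num.max 0 u).
Proof.
apply: is_derive_quadratic => v; rewrite /pos_sq.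
have := sqr_ge0 (v - u); have := sqr_ge0 u; have := sqr_ge0 v; rewrite !expr2.
case: (leP 0 u) => hu; case: (leP 0 v) => hv h1 h2 h3; rewrite ler_norml.
- by apply/andP; split; lra.
- have h4 : 0 <= u * - v by rewrite mulr_ge0// oppr_ge0 ltW.
  by apply/andP; split; lra.
- have h4 : 0 <= v * - u by rewrite mulr_ge0// oppr_ge0 ltW.
  by apply/andP; split; lra.
- by apply/andP; split; lra.
Qed.

(** A rational function of the squared positive part: it is continuously differentiable, takes
    values in [0, 1], vanishes for [u <= 0] and tends to 1 with N for [u > 0]. *)
Definition cutoff (N : nat) (u : R) : R := N%:R * pos_sq u / (1 + N%:R * pos_sq u).

Definition cutoff' (N : nat) (u : R) : R :=
  N%:R * (2 * Num.max 0 u) / (1 + N%:R * pos_sq u) ^+ 2.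

Lemma pos_sq_ge0 u : 0 <= pos_sq u. Proof. exact: sqr_ge0. Qed.

Lemma cutoff_den_gt0 N u : 0 < 1 + N%:R * pos_sq u.
Proof. by rewrite ltr_pwDl// mulr_ge0// pos_sq_ge0. Qed.

Lemma is_derive_cutoff N (u : R) : is_derive u 1 (cutoff N) (cutoff' N u).
Proof.
have n0 := lt0r_neq0 (cutoff_den_gt0 N u).
have D1 := is_derive_pos_sq u.
have -> : cutoff N = fun u => 1 - (1 + N%:R * pos_sq u)^-1.
  by apply/funext => v; rewrite /cutoff; field; rewrite lt0r_neq0// cutoff_den_gt0.
apply: is_derive_eq; rewrite -![_ *: _]/(_ * _) /cutoff'.
by field.
Qed.

Lemma continuous_cutoff' N : continuous (cutoff' N).
Proof.
have cm : continuous (fun u : R => Num.max 0 u).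
  by move=> u; apply: (@continuous_max _ _ (cst 0) id); [exact: cst_continuous|exact: cvg_id].
have cp : continuous pos_sq.
  move=> u; apply: (@continuous_comp _ _ _ (fun u : R => Num.max 0 u) (fun y : R => y ^+ 2)).
    exact: cm.
  exact: exprn_continuous.
move=> u; apply: (@continuousM R R (fun u : R => N%:R * (2 * Num.max 0 u))
  (fun u : R => ((1 + N%:R * pos_sq u) ^+ 2)^-1)).
  apply: (@continuousM R R (cst N%:R) (fun u : R => 2 * Num.max 0 u)); first exact: cst_continuous.
  by apply: (@continuousM R R (cst 2) (fun u : R => Num.max 0 u)); [exact: cst_continuous|exact: cm].
apply: (@continuousV R R (fun u : R => (1 + N%:R * pos_sq u) ^+ 2)).
  by rewrite expf_neq0// lt0r_neq0// cutoff_den_gt0.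
apply: (@continuous_comp _ _ _ (fun u : R => 1 + N%:R * pos_sq u) (fun y : R => y ^+ 2));
  last exact: exprn_continuous.
apply: (@continuousD R R R (cst 1) (fun u : R => N%:R * pos_sq u)); first exact: cst_continuous.
by apply: (@continuousM R R (cst N%:R) pos_sq); [exact: cst_continuous|exact: cp].
Qed.

Lemma cutoff_le0 N u : u <= 0 -> cutoff N u = 0.
Proof. by move=> u0; rewrite /cutoff /pos_sq (max_idPl u0) expr0n /= mulr0 mul0r. Qed.

Lemma cutoff'_le0 N u : u <= 0 -> cutoff' N u = 0.
Proof. by move=> u0; rewrite /cutoff' (max_idPl u0) !mulr0 mul0r. Qed.

Lemma cutoff_ge0 N u : 0 <= cutoff N u.
Proof.
apply: divr_ge0; last exact/ltW/cutoff_den_gt0.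
by apply: mulr_ge0; last exact: pos_sq_ge0.
Qed.

Lemma cutoff_le1 N u : cutoff N u <= 1.
Proof. by rewrite ler_pdivrMr ?cutoff_den_gt0// mul1r lerDr. Qed.

Lemma cvg_cutoff u : 0 < u -> cutoff N u @[N --> \oo] --> (1 : R).
Proof.
move=> u0; pose c := pos_sq u.
have c0 : 0 < c by rewrite /c /pos_sq exprn_gt0// lt_max u0 orbT.
apply/cvgrPdist_le => eps eps0; near=> N.
rewrite (_ : 1 - cutoff N u = (1 + N%:R * c)^-1); last first.
  by rewrite /cutoff -/c; field; rewrite lt0r_neq0// cutoff_den_gt0.
have d0 : 0 < 1 + N%:R * c by exact: cutoff_den_gt0.
rewrite gtr0_norm ?invr_gt0// invf_ple ?posrE//.
apply: (@le_trans _ _ (N%:R * c)); last by rewrite lerDr.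
rewrite -ler_pdivrMr//; near: N; exact: nbhs_infty_ger.
Unshelve. all: by end_near. Qed.

End bump.

Section bump_field.
Context (R : realType) (n : nat) (p : 'rV[R]_n) (r : R) (i : 'I_n).
Implicit Types x y v : 'rV[R]_n.

(** A polynomial that is positive exactly on the Euclidean ball, so that the bumps built on it
    converge pointwise to the indicator of that ball. *)
Definition gap y : R := r ^+ 2 - \sum_k (y 0 k - p 0 k) ^+ 2.

Definition bump N y : R := cutoff N (gap y).

Definition bump_field N y : 'rV[R]_n := bump N y *: delta_mx 0 i.

Let dgap y v : R := - (2 * \sum_k (y 0 k - p 0 k) * v 0 k).

Lemma is_derive_gap y v : is_derive y v gap (dgap y v).
Proof.
pose S := \sum_k v 0 k ^+ 2.
have E h : gap (h *: v + y) - gap y = h * dgap y v - h ^+ 2 * S.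
  have -> : h * dgap y v - h ^+ 2 * S =
      \sum_k (- (h * 2 * ((y 0 k - p 0 k) * v 0 k)) - h ^+ 2 * v 0 k ^+ 2).
    by rewrite /dgap mulrN mulrA !mulr_sumr sumrB sumrN.
  rewrite /gap opprB addrC addrA subrK -sumrB; apply: eq_bigr => k _.
  by rewrite !mxE; ring.
have C : (h^-1 *: ((gap \o shift y) (h *: v) - gap y) @[h --> 0^']) --> dgap y v.
  apply/cvgrPdist_le => eps eps0; near=> h.
  have h0 : h != 0 by near: h; exact: nbhs_dnbhs_neq.
  have he : `|h| <= eps / (1 + S) by near: h; apply: dnbhs0_le; rewrite divr_gt0// ltr_pwDl// sumr_ge0// => k _; exact: sqr_ge0.
  have S0 : 0 <= S by apply: sumr_ge0 => k _; exact: sqr_ge0.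
  rewrite /= E -[_ *: _]/(_ * _).
  rewrite (_ : dgap y v - h^-1 * (h * dgap y v - h ^+ 2 * S) = h * S); last by field.
  rewrite normrM (ger0_norm S0).
  move: he; rewrite ler_pdivlMr ?ltr_pwDl// mulrDr mulr1.
  by apply: le_trans; rewrite lerDr.
by split; [apply/cvg_ex; exists (dgap y v)|exact/cvg_lim].
Unshelve. all: by end_near. Qed.

Lemma differentiable_gap y : differentiable gap y.
Proof.
have -> : gap = cst (r ^+ 2) - \sum_k (fun y => (y 0 k - p 0 k) ^+ 2).
  by apply/funext => z; rewrite /gap !fctE fct_sumE.
apply: differentiableB; first exact: differentiable_cst.
apply: differentiable_sum => k.
have -> : (fun y : 'rV[R]_n => (y 0 k - p 0 k) ^+ 2) = (fun y => y 0 k - p 0 k) ^+ 2.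
  by apply/funext => z; rewrite !fctE.
apply: differentiableX.
apply: (@differentiableB _ _ _ (fun y : 'rV[R]_n => y 0 k) (cst (p 0 k))).
  exact: differentiable_coord.
exact: differentiable_cst.
Qed.

Lemma differentiable_bump N y : differentiable (bump N) y.
Proof.
apply: (@differentiable_comp _ _ _ _ gap (cutoff N)); first exact: differentiable_gap.
by apply/derivable1_diffP; have := is_derive_cutoff N (gap y) => -[].
Qed.

Lemma derive_bump N y v : 'D_v (bump N) y = cutoff' N (gap y) * dgap y v.
Proof.
have dc : differentiable (cutoff N) (gap y).
  by apply/derivable1_diffP; have := is_derive_cutoff N (gap y) => -[].
rewrite deriveE; last exact: differentiable_bump.
rewrite (diff_comp (differentiable_gap y) dc) /= diff1E// derive1E.
rewrite -deriveE; last exact: differentiable_gap.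
have [_ ->] := is_derive_gap y v; have [_ ->] := is_derive_cutoff N (gap y).
by rewrite -[_ *: _]/(_ * _) mulrC.
Qed.

Lemma continuous_gap : continuous gap.
Proof. by move=> y; apply: differentiable_continuous; exact: differentiable_gap. Qed.

Lemma continuous_dgap v : continuous (dgap ^~ v).
Proof.
have h k : continuous (fun y : 'rV[R]_n => (y 0 k - p 0 k) * v 0 k).
  move=> y; apply: (@continuousM R 'rV[R]_n (fun y : 'rV[R]_n => y 0 k - p 0 k) (cst (v 0 k)));
    last exact: cst_continuous.
  apply: (@continuousB _ _ _ (fun y : 'rV[R]_n => y 0 k) (cst (p 0 k))); last exact: cst_continuous.
  exact: coord_continuous.
have cS : continuous (fun y : 'rV[R]_n => \sum_k (y 0 k - p 0 k) * v 0 k).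
  have := @continuous_big R 'I_n +%R 0 xpredT (@add_continuous R) 'rV[R]_n
    (index_enum 'I_n) (fun k (y : 'rV[R]_n) => (y 0 k - p 0 k) * v 0 k).
  by apply.
move=> y; rewrite /dgap.
rewrite (_ : (fun _ => _) = (fun y : 'rV[R]_n => -2 * \sum_k (y 0 k - p 0 k) * v 0 k)); last first.
  by apply/funext => z; rewrite mulNr.
by apply: (@continuousM R 'rV[R]_n (cst (-2)) (fun y : 'rV[R]_n => \sum_k (y 0 k - p 0 k) * v 0 k));
  [exact: cst_continuous|exact: cS].
Qed.

Lemma continuous_derive_bump N v : continuous ('D_v (bump N)).
Proof.
rewrite (_ : 'D_v (bump N) = (fun y => cutoff' N (gap y) * dgap y v)); last first.
  by apply/funext => y; exact: derive_bump.
move=> y; apply: (@continuousM R 'rV[R]_n (fun y => cutoff' N (gap y)) (dgap ^~ v)).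
  apply: (@continuous_comp _ _ _ gap (cutoff' N)); first exact: continuous_gap.
  exact: continuous_cutoff'.
exact: continuous_dgap.
Qed.

Lemma differentiable_bump_field N y : differentiable (bump_field N) y.
Proof.
apply: (@differentiable_comp _ _ _ _ (bump N) (fun c : R => c *: (delta_mx 0 i : 'rV[R]_n))).
  exact: differentiable_bump.
by have := @is_diff_scalel _ _ (bump N y) (delta_mx 0 i : 'rV[R]_n) => -[].
Qed.

Lemma derive_bump_field N y v :
  'D_v (bump_field N) y = 'D_v (bump N) y *: delta_mx 0 i.
Proof.
have [ds dE] := @is_diff_scalel _ _ (bump N y) (delta_mx 0 i : 'rV[R]_n).
rewrite deriveE; last exact: differentiable_bump_field.
rewrite (_ : bump_field N = (fun c : R => c *: (delta_mx 0 i : 'rV[R]_n)) \o bump N)//.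
rewrite (diff_comp (differentiable_bump N y) ds) /= dE deriveE//.
exact: differentiable_bump.
Qed.

Lemma divergence_bump_field N y :
  divergence (bump_field N) y = 'D_(delta_mx 0 i) (bump N) y.
Proof.
have E j : ('D_(delta_mx 0 j) (bump_field N) y) 0 j =
    'D_(delta_mx 0 j) (bump N) y * (j == i)%:R.
  by rewrite derive_bump_field !mxE /=.
rewrite /divergence (bigD1 i)//= E eqxx mulr1 big1 ?addr0// => j /negbTE ji.
by rewrite E ji mulr0.
Qed.

Lemma divergence_bump_field0 N y : gap y <= 0 -> divergence (bump_field N) y = 0.
Proof. by move=> g0; rewrite divergence_bump_field derive_bump cutoff'_le0// mul0r. Qed.

Lemma bump_le0 N y : gap y <= 0 -> bump N y = 0.
Proof. exact: cutoff_le0. Qed.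

Lemma gap_coord y k : 0 <= r -> 0 <= gap y -> `|y 0 k - p 0 k| <= r.
Proof.
move=> r0; rewrite subr_ge0 (bigD1 k)//= => h.
rewrite -ler_sqr ?nnegrE// real_normK ?num_real//; apply: le_trans h.
by rewrite lerDl; apply: sumr_ge0 => j _; exact: sqr_ge0.
Qed.

Lemma compact_box : compact [set v : 'rV[R]_n | forall k, `[p 0 k - r, p 0 k + r]%classic (v 0 k)].
Proof. exact: (@rV_compact R n _ (fun k => @segment_compact R _ _)). Qed.

Lemma sub_box : 0 <= r -> [set y | 0 <= gap y] `<=`
  [set v : 'rV[R]_n | forall k, `[p 0 k - r, p 0 k + r]%classic (v 0 k)].
Proof.
move=> r0 y gy k; have := gap_coord k r0 gy.
by rewrite /= in_itv /= ler_distl.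
Qed.

Lemma bump_field_C1 N : 0 <= r -> C1_compact_support (bump_field N).
Proof.
move=> r0; split.
- exact: differentiable_bump_field.
- move=> v; rewrite (_ : 'D_v (bump_field N) = (fun y => 'D_v (bump N) y *: delta_mx 0 i)).
    move=> y.
    apply: (@continuous_comp _ _ _ ('D_v (bump N)) (fun c : R => c *: (delta_mx 0 i : 'rV[R]_n))).
      exact: continuous_derive_bump.
    exact: scalel_continuous.
  by apply/funext => y; exact: derive_bump_field.
apply: (subclosed_compact _ compact_box); first exact: closed_closure.
apply: subset_trans (sub_box r0).
have cl : closed [set y | 0 <= gap y].
  rewrite (_ : [set y | 0 <= gap y] = gap @^-1` [set t | 0 <= t])//.
  by apply: closed_comp; [move=> y _; exact: continuous_gap|exact: closed_ge].
rewrite [X in _ `<=` X](closure_id _).1//; apply: closure_subset => y /= Ty.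
rewrite leNgt; apply: contra_neqN Ty => /ltW gy.
by rewrite /bump_field bump_le0// scale0r.
Qed.

Lemma edot_bump_field N y s : edot (bump_field N y) s = bump N y * s 0 i.
Proof.
rewrite /edot (bigD1 i)//= big1 ?addr0; last by move=> j ji; rewrite !mxE /= (negbTE ji) mulr0 mul0r.
by rewrite !mxE !eqxx mulr1.
Qed.

Lemma gap_gt0 y : 0 < r -> (0 < gap y) = (y \in eball p r).
Proof.
by move=> r0; rewrite subr_gt0; apply/idP/idP; rewrite inE; move/(eballP p y r0).
Qed.

End bump_field.

Section gauss_green_null.
Context (R : realType) (n : nat) (E : set 'rV[R]_n).
Variables (m : {measure set 'rV[R]_n -> \bar R}) (sigma : 'rV[R]_n -> 'rV[R]_n).
Hypothesis GG : gauss_green E m sigma.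
Local Notation L := (@lebesgue_rV R n).

Lemma eball_fin (p : 'rV[R]_n) (r : R) : 0 < r -> (m (eball p r) < +oo)%E.
Proof.
move=> r0; have [mK _ _ _] := GG.
apply: le_lt_trans (mK _ (@compact_box R n p r)).
apply: le_measure; rewrite ?inE.
- by apply: open_measurable_rV; exact: open_eball.
- rewrite (_ : [set v | _] = [set v : 'rV[R]_n | forall k, v 0 k \in `[p 0 k - r, p 0 k + r]]).
    exact: measurable_itv_box.
  by apply/seteqP; split.
move=> y hy; apply: sub_box; first exact: ltW.
by apply: ltW; rewrite gap_gt0// inE.
Qed.

(** By the Gauss-Green formula the bumps integrate to 0 against [sigma]. They converge to the
    indicator of the ball and are dominated by it, and the ball has finite measure. *)
Lemma integral_sigma_eball0 (p : 'rV[R]_n) (r : R) i : 0 < r ->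
  (forall N, \int[L]_(x in E) (divergence (bump_field p r i N) x)%:E = 0)%E ->
  (\int[m]_(y in eball p r) (sigma y 0 i)%:E = 0)%E.
Proof.
move=> r0 div0; have [mK ms s1 gg] := GG.
pose f_ N y := (bump p r N y * sigma y 0 i)%:E.
pose f y := (\1_(eball p r) y * sigma y 0 i)%:E.
have mball : measurable (eball p r) by apply: open_measurable_rV; exact: open_eball.
have msi : measurable_fun setT (fun y => sigma y 0 i : measurableTypeR R).
  exact: (measurableT_comp (@measurable_rV_coord R n i) ms).
have f_0 N : (\int[m]_y f_ N y = 0)%E.
  rewrite -(div0 N) (gg _ (bump_field_C1 p i N (ltW r0))).
  by apply: eq_integral => y _; rewrite edot_bump_field.
have mf_ N : measurable_fun setT (f_ N).
  apply/measurable_EFinP; apply: measurable_funM => //.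
  apply: continuous_measurable_rV => y; apply: differentiable_continuous.
  exact: differentiable_bump.
have mf : measurable_fun setT f.
  by apply/measurable_EFinP; apply: measurable_funM => //; exact: measurable_indic.
have f_f : {ae m, forall y, setT y -> f_ ^~ y @ \oo --> f y}.
  apply: aeW => y _; apply/cvg_EFin.
    by apply: nearW => N.
  rewrite /f_ /f /=.
  have [gy|gy] := ltP 0 (gap p r y).
    rewrite indicE -gap_gt0// gy; apply: cvgMl => //.
    exact: cvg_cutoff.
  rewrite (_ : (fun N => _) = cst 0); last first.
    by apply/funext => N /=; rewrite bump_le0// mul0r.
  by rewrite indicE -gap_gt0// ltNge gy mul0r; exact: cvg_cst.
have ig : m.-integrable setT (EFin \o \1_(eball p r)).
  apply/integrableP; split; first by apply/measurable_EFinP; exact: measurable_indic.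
  under eq_integral do rewrite gee0_abs ?lee_fin//.
  by rewrite integral_indic// setIT; exact: eball_fin.
have f_g : {ae m, forall y N, setT y -> `|f_ N y| <= (EFin \o \1_(eball p r)) y}%E.
  move: s1; apply: filterS => y s1 N _; rewrite /f_ /= lee_fin normrM indicE -gap_gt0//.
  have s2 : `|sigma y 0 i| <= 1 by rewrite -s1; exact: coord_le_enorm.
  have [gy|gy] := ltP 0 (gap p r y); last by rewrite bump_le0// normr0 mul0r.
  by rewrite mulr_ile1// ger0_norm ?cutoff_ge0// cutoff_le1.
have [_ _ H] := dominated_convergence measurableT mf_ mf f_f ig f_g.
have : (\int[m]_y f y = 0)%E.
  have H0 : [sequence (\int[m]_y f_ k y)%E]_k = cst 0%E by apply/funext => N; exact: f_0.
  by rewrite H0 in H; apply: (cvg_unique _ H) => //; exact: cvg_cst.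
move=> <-; rewrite [LHS]integral_mkcond; apply: eq_integral => y _.
by rewrite patchE /f indicE; case: (y \in _); rewrite ?mul1r ?mul0r.
Qed.

End gauss_green_null.

Section reduced_boundary_of_tube.
Context (R : realType) (n : nat) (e : 'I_n -> bool) (P : {set 'I_n}) (rho : R).
Local Notation L := (@lebesgue_rV R n).
Local Notation E := (vertex_tube e P rho).
Local Notation sqn := (fun x : 'rV[R]_n => partial_sqnorm P (flip e x)).

(** Makes the divergence theorem on the whole cube an instance of the one on tubes. *)
Lemma vertex_tube_set0 : vertex_tube (fun=> false) (finset.set0 : {set 'I_n}) 0 = @cube R n.
Proof.
have fE (x : 'rV[R]_n) : flip (fun=> false) x = x by apply/rowP => j; rewrite mxE.
apply/seteqP; split => x; rewrite /vertex_tube /= fE; first by case.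
by move=> cx; split => //; rewrite /partial_sqnorm big_set0.
Qed.

Lemma continuous_sqn : continuous sqn.
Proof.
move=> x; apply: (@continuous_comp _ _ _ (@flip R n e) (partial_sqnorm P)).
  exact: continuous_flip.
exact: continuous_partial_sqnorm.
Qed.

Lemma integral_divergence_bump_cube (p : 'rV[R]_n) r i N : 0 <= r ->
  [set y | 0 <= gap p r y] `<=` open_cube ->
  (\int[L]_(x in cube) (divergence (bump_field p r i N) x)%:E = 0)%E.
Proof.
move=> r0 sub; have [dT cT _] := bump_field_C1 p i N r0.
rewrite -vertex_tube_set0 (integral_divergence _ dT cT) big1// => k _.
apply: integral0_eq => z _; congr EFin.
have fE (x : 'rV[R]_n) : flip (fun=> false) x = x by apply/rowP => j; rewrite mxE.
have b0 t : ~~ (0 < t < 1) -> bump_field p r i N (upd k z t) 0 k = 0.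
  move=> t01; rewrite /bump_field bump_le0 ?scale0r ?mxE// leNgt; apply: contra t01 => /ltW h.
  by have := sub _ h k; rewrite mxE eqxx.
rewrite !fE !b0 ?ltxx//; first by rewrite !mulr0 subrr mulr0.
by rewrite /slice_top inE ltxx andbF.
Qed.

(** Around a point of the open cube off the sphere, small balls lie entirely inside or entirely
    outside the tube. Then [sigma] has mean 0 on all of them, and the limit [nu] of these means
    cannot be a unit vector. *)
Lemma reduced_boundary_sub :
  reduced_boundary E `&` open_cube `<=` [set x | open_cube x /\ sqn x = rho].
Proof.
move=> x [[m [sigma [GG mpos [nu nu1 lim]]]] ox]; split => //.
apply: contrapT => /eqP sx.
pose U := open_cube `&` (if sqn x < rho then [set y | sqn y < rho] else [set y | rho < sqn y]).
have oU : open U.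
  apply: openI; first exact: open_open_cube.
  case: ifP => _.
    by apply: (@open_comp _ _ sqn [set t | t < rho]); [move=> y _; exact: continuous_sqn|exact: open_lt].
  by apply: (@open_comp _ _ sqn [set t | rho < t]); [move=> y _; exact: continuous_sqn|exact: open_gt].
have Ux : U x.
  by split => //; case: ifPn => //=; rewrite -leNgt => h; rewrite lt_neqAle eq_sym sx.
have : nbhs x U by exact: open_nbhs_nbhs.
move=> /nbhs_ballP[eps /= eps0 epsU].
(* Half of [eps], because [gap >= 0] describes the closed ball, which must fit in the open sup-norm
   ball of radius [eps]. *)
pose r0 := eps / 2; have r00 : 0 < r0 by rewrite divr_gt0.
have sub r : 0 < r <= r0 -> [set y | 0 <= gap x r y] `<=` U.
  move=> /andP[rp rr0] y hy; apply: epsU; split => // a k; rewrite (ord1 a) /ball /= distrC.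
  by apply: (le_lt_trans (gap_coord k (ltW rp) hy)); rewrite (le_lt_trans rr0)// /r0; lra.
have div0 r i N : 0 < r <= r0 ->
    (\int[L]_(y in E) (divergence (bump_field x r i N) y)%:E = 0)%E.
  move=> rr; have /andP[rp _] := rr; have sU := sub r rr.
  have sO : [set y | 0 <= gap x r y] `<=` open_cube by move=> y /sU[].
  case: (ltP (sqn x) rho) => h.
    have -> : (\int[L]_(y in E) (divergence (bump_field x r i N) y)%:E =
      \int[L]_(y in cube) (divergence (bump_field x r i N) y)%:E)%E.
      rewrite [LHS]integral_mkcond [RHS]integral_mkcond; apply: eq_integral => y _.
      rewrite !patchE; have [gy|gy] := leP (gap x r y) 0.
        by rewrite divergence_bump_field0// !if_same.
      have [oy] := sU y (ltW gy); rewrite h /= => sy.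
      have cy := sub_open_cube oy.
      by rewrite !mem_set//; split; [exact: cube_flip|exact: ltW].
    exact: integral_divergence_bump_cube (ltW rp) sO.
  apply: integral0_eq => y [_ Ey]; rewrite divergence_bump_field0// leNgt; apply/negP => gy.
  have [_] := sU y (ltW gy); rewrite ltNge h /= => sy.
  by move: Ey; rewrite leNgt sy.
have nu0 i : nu 0 i = 0.
  apply/eqP; rewrite -normr_le0; apply/ler_addgt0Pr => d d0; rewrite add0r.
  have := lim i => /cvgrPdist_le/(_ d d0) H.
  near (0 : R)^'+ => r.
  have rr : 0 < r <= r0 by apply/andP; split; near: r; [exact: nbhs_right_gt|exact: nbhs_right_le].
  have rp : 0 < r by case/andP: rr.
  have : `|nu 0 i - (\int[m]_(y in eball x r) (sigma y 0 i)) / fine (m (eball x r))| <= d.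
    by near: r; exact: H.
  rewrite /Rintegral (integral_sigma_eball0 GG rp (fun N => div0 r i N rr)).
  by rewrite mul0r subr0.
have : enorm nu = 0.
  by rewrite (_ : nu = 0) ?enorm0//; apply/rowP => j; rewrite nu0 mxE.
by rewrite nu1 => /eqP; rewrite oner_eq0.
Unshelve. all: by end_near. Qed.

End reduced_boundary_of_tube.

(** * The Gauss-Green measure of a tube *)

Section density_pushforward.
Context d1 d2 (X : measurableType d1) (Y : measurableType d2) (R : realType).
Variables (mu : {measure set X -> \bar R}) (D : set X).
Hypothesis mD : measurable D.
Local Open Scope ereal_scope.

Section one_density.
Variables (c : X -> R) (phi : X -> Y).

(** The push-forward by [phi] of the measure with density [c], written as an integral of Dirac
    masses, whose additivity it inherits. The proofs are arguments so that the measure structure can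
    be attached to the definition. *)
Definition density_push (mc : measurable_fun setT c) (c0 : forall x, (0 <= c x)%R)
    (mphi : measurable_fun setT phi) (A : set Y) : \bar R :=
  \int[mu]_(x in D) ((c x)%:E * \d_(phi x) A).

Hypothesis mc : measurable_fun setT c.
Hypothesis c0 : forall x, (0 <= c x)%R.
Hypothesis mphi : measurable_fun setT phi.

Local Notation m := (density_push mc c0 mphi).

Let mdirac A : measurable A -> measurable_fun setT (fun x => (c x)%:E * \d_(phi x) A).
Proof.
move=> mA; apply: emeasurable_funM; first exact/measurable_EFinP.
under eq_fun do rewrite diracE -indicE.
by apply/measurable_EFinP; apply: (measurableT_comp _ mphi); exact: measurable_indic.
Qed.

Let density_push0 : m set0 = 0.
Proof. by apply: integral0_eq => x _; rewrite measure0 mule0. Qed.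

Let density_push_ge0 A : 0 <= m A.
Proof. by apply: integral_ge0 => x _; rewrite mule_ge0// lee_fin. Qed.

Let density_push_sigma_additive : semi_sigma_additive m.
Proof.
move=> F mF tF mUF.
have E : m (\bigcup_k F k) = \sum_(0 <= k <oo) m (F k).
  rewrite -integral_nneseries//=.
  - apply: eq_integral => x _; rewrite nneseriesZl; last by move=> k _; exact: measure_ge0.
    by rewrite measure_semi_bigcup.
  - by move=> k; apply: measurable_funTS; exact: mdirac.
  - by move=> k x _; rewrite mule_ge0// lee_fin.
by rewrite E; apply: is_cvg_nneseries => k _ _; exact: density_push_ge0.
Qed.

HB.instance Definition _ := isMeasure.Build _ _ _ m
  density_push0 density_push_ge0 density_push_sigma_additive.

Import HBNNSimple.

Lemma ge0_integral_density_push (f : Y -> \bar R) :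
  measurable_fun setT f -> (forall y, 0 <= f y) ->
  \int[m]_y f y = \int[mu]_(x in D) ((c x)%:E * f (phi x)).
Proof.
move=> mf f0; pose f_ := nnsfun_approx measurableT mf.
have f_cvg y : (EFin \o f_ ^~ y) @ \oo --> f y by exact: cvg_nnsfun_approx.
have f_nd y : {homo (fun n => (f_ n y)%:E) : a b / (a <= b)%N >-> a <= b}.
  by move=> a b ab; rewrite lee_fin; exact/lefP/nd_nnsfun_approx.
have mcf k : measurable_fun setT (fun x => (c x)%:E * (f_ k (phi x))%:E).
  apply: emeasurable_funM; apply/measurable_EFinP => //.
  exact: measurableT_comp.
transitivity (limn (fun k => \int[m]_y (f_ k y)%:E)).
  rewrite -monotone_convergence//.
  - by apply: eq_integral => y _; rewrite (cvg_lim _ (f_cvg y)).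
  - by move=> k; exact/measurable_EFinP.
  - by move=> k y _; rewrite lee_fin.
transitivity (limn (fun k => \int[mu]_(x in D) ((c x)%:E * (f_ k (phi x))%:E))); last first.
  rewrite -monotone_convergence//.
  - apply: eq_integral => x _; apply: cvg_lim => //.
    by apply: cvgeZl => //; exact: f_cvg.
  - by move=> k; exact: measurable_funTS.
  - by move=> k x _; rewrite mule_ge0// lee_fin.
  - by move=> x _ a b ab; apply: lee_wpmul2l; [rewrite lee_fin|exact: f_nd].
congr (limn _); apply/funext => k.
have mk r : measurable (f_ k @^-1` [set r]) by rewrite -[X in measurable X]setTI; exact: measurable_funP.
transitivity (\sum_(r \in range (f_ k)) \int[m]_y (r * \1_(f_ k @^-1` [set r]) y)%:E).
  rewrite -ge0_integral_fsum//; last 2 first.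
  - by move=> r; exact/measurable_EFinP/measurable_funM.
  - by move=> r y _; rewrite EFinM nnfun_muleindic_ge0.
  by apply: eq_integral => y _; rewrite fsumEFin// -fimfunE.
transitivity (\sum_(r \in range (f_ k))
   \int[mu]_(x in D) ((c x)%:E * (r * \1_(f_ k @^-1` [set r]) (phi x))%:E)); last first.
  rewrite -ge0_integral_fsum//.
  - apply: eq_integral => x _; rewrite -ge0_mule_fsumr//.
      by congr (_ * _); rewrite fsumEFin// -fimfunE.
    by move=> r; rewrite EFinM nnfun_muleindic_ge0.
  - move=> r; apply: measurable_funTS; apply: emeasurable_funM; apply/measurable_EFinP => //.
    by apply: measurable_funM => //; apply: (measurableT_comp _ mphi); exact: measurable_indic.
  - by move=> r x _; apply: mule_ge0; [rewrite lee_fin|rewrite EFinM nnfun_muleindic_ge0].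
apply: eq_fsbigr => r; rewrite inE => -[y0 _ <-{r}].
have r0 : (0 <= f_ k y0)%R by [].
under [LHS]eq_integral do rewrite EFinM.
rewrite ge0_integralZl//; last first.
  exact/measurable_EFinP/measurable_indic.
rewrite integral_indic// setIT.
under [RHS]eq_integral do rewrite EFinM muleCA.
rewrite ge0_integralZl//.
- apply: measurable_funTS; apply: emeasurable_funM; apply/measurable_EFinP => //.
  by apply: (measurableT_comp _ mphi); exact: measurable_indic.
- by move=> x _; rewrite mule_ge0// lee_fin.
Qed.

End one_density.

Lemma exists_sum_density (I : finType) (c : I -> X -> R) (phi : I -> X -> Y) :
  (forall l, measurable_fun setT (c l)) -> (forall l x, (0 <= c l x)%R) ->
  (forall l, measurable_fun setT (phi l)) ->
  exists m : {measure set Y -> \bar R}, forall f : Y -> \bar R,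
    measurable_fun setT f -> (forall y, 0 <= f y) ->
    \int[m]_y f y = \sum_l \int[mu]_(x in D) ((c l x)%:E * f (phi l x)).
Proof.
move=> mc c0 mphi.
have h (s : seq I) : exists m : {measure set Y -> \bar R}, forall f : Y -> \bar R,
    measurable_fun setT f -> (forall y, 0 <= f y) ->
    \int[m]_y f y = \sum_(l <- s) \int[mu]_(x in D) ((c l x)%:E * f (phi l x)).
  elim: s => [|l s [m hm]].
    exists mzero => f mf f0; rewrite big_nil integral_measure_zero//.
  exists (measure_add (density_push (mc l) (c0 l) (mphi l)) m) => f mf f0.
  rewrite ge0_integral_measure_add// big_cons hm//; congr (_ + _).
  exact: ge0_integral_density_push.
have [m hm] := h (enum I); exists m => f mf f0.
by rewrite hm// big_enum.
Qed.

Section signed.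
Variables (I : finType) (c : I -> X -> R) (phi : I -> X -> Y) (m : {measure set Y -> \bar R}).
Hypothesis c0 : forall l x, (0 <= c l x)%R.
Hypothesis mE : forall f : Y -> \bar R, measurable_fun setT f -> (forall y, 0 <= f y) ->
  \int[m]_y f y = \sum_l \int[mu]_(x in D) ((c l x)%:E * f (phi l x)).

Lemma integral_sum_density (f : Y -> R) : measurable_fun setT f ->
  (forall l, mu.-integrable D (fun x => (c l x * f (phi l x))%:E)) ->
  \int[m]_y (f y)%:E = \sum_l \int[mu]_(x in D) (c l x * f (phi l x))%:E.
Proof.
move=> mf If; pose F y := (f y)%:E.
have mF : measurable_fun setT F by exact/measurable_EFinP.
rewrite integralE mE//; last exact: measurable_funepos.
rewrite mE//; last exact: measurable_funeneg.
have Ep l : \int[mu]_(x in D) ((c l x)%:E * F^\+ (phi l x)) =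
            \int[mu]_(x in D) (fun x => (c l x * f (phi l x))%:E)^\+ x.
  apply: eq_integral => x _; by rewrite !funeposE /F maxe_pMr ?lee_fin// mule0.
have En l : \int[mu]_(x in D) ((c l x)%:E * F^\- (phi l x)) =
            \int[mu]_(x in D) (fun x => (c l x * f (phi l x))%:E)^\- x.
  apply: eq_integral => x _; by rewrite !funenegE /F maxe_pMr ?lee_fin// mule0 EFinM muleN.
rewrite (eq_bigr _ (fun l _ => Ep l)) (eq_bigr _ (fun l _ => En l)).
rewrite -sumeN; last first.
  by move=> i j _ _; rewrite fin_num_adde_defr// integrable_neg_fin_num.
by rewrite -big_split; apply: eq_bigr => l _; rewrite [RHS]integralE.
Qed.

End signed.
End density_pushforward.

(** * Changing the coordinate along which a sphere is projected *)

Section exchange.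
Context (R : realType).
Local Notation lam := (@lebesgue_measure R).

(* Both sides are integrals over the quarter circle of squared radius [s],
   parametrized by each of its two coordinates. *)
Lemma quarter_circle_exchange (h : R -> R -> R) (s : R) : s <= 1 ->
  continuous (fun p : R * R => h p.1 p.2) ->
  (\int[lam]_(t in `[0%R, 1%R]) ((0 <= s - t ^+ 2)%R%:R *
      (Num.sqrt (s - t ^+ 2) * t * h (Num.sqrt (s - t ^+ 2)) t))%:E =
   \int[lam]_(t in `[0%R, 1%R]) ((0 <= s - t ^+ 2)%R%:R *
      (t ^+ 2 * h t (Num.sqrt (s - t ^+ 2))))%:E)%E.
Proof.
move=> s1 ch; have [s0|s0] := leP s 0.
  have z t : 0 <= s - t ^+ 2 -> t = 0.
    rewrite subr_ge0 => ts; apply/eqP; rewrite -sqrf_eq0 eq_le sqr_ge0 andbT.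
    exact: le_trans ts s0.
  apply: eq_integral => t _; congr EFin.
  case: (boolP (0 <= s - t ^+ 2)) => [/z ->|_]; last by rewrite !mul0r.
  by rewrite mulr0 expr0n /= !mul0r.
pose r := Num.sqrt s; have r0 : 0 < r by rewrite sqrtr_gt0.
have r2 : r ^+ 2 = s by rewrite sqr_sqrtr// ltW.
have r1 : r <= 1 by rewrite -sqrtr1 ler_sqrt.
have cut (G : R -> R) : (\int[lam]_(t in `[0%R, 1%R]) ((0 <= s - t ^+ 2)%R%:R * G t)%:E =
    \int[lam]_(t in `[0%R, r]) (G t)%:E)%E.
  rewrite [LHS]integral_mkcond [RHS]integral_mkcond; apply: eq_integral => t _.
  rewrite !patchE !mem_setE !in_itv /=.
  have [t0|t0] /= := leP 0 t; last by [].
  have -> : (0 <= s - t ^+ 2) = (t <= r).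
    by rewrite subr_ge0 -r2 ler_pXn2r// nnegrE// ltW.
  have [tr|tr] := leP t r; first by rewrite (le_trans tr r1) mul1r.
  by rewrite mul0r if_same.
have cpair (a b : R -> R) : continuous a -> continuous b -> continuous (fun t => h (a t) (b t)).
  move=> ca cb t; apply: (@continuous_comp _ _ _ (fun t => (a t, b t)) (fun p : R * R => h p.1 p.2)).
    apply: (@cvg_pair _ _ _ _ (nbhs (a t)) (nbhs (b t))); [exact: ca|exact: cb].
  exact: ch.
(* With t = r cos x on the left and t = r sin x on the right, both integrands become r^3 sin^2 x cos
   x h(r sin x, r cos x). *)
rewrite !cut (@integral_subst_cos R r (fun t => _))//; last first.
  apply: continuous_comp_itv => t.
  apply: (@continuousM R R (fun t => Num.sqrt (s - t ^+ 2) * t)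
    (fun t => h (Num.sqrt (s - t ^+ 2)) t)).
    by apply: (@continuousM R R (fun t => Num.sqrt (s - t ^+ 2)) id);
      [exact: continuous_chord|exact: cvg_id].
  by apply: cpair; [exact: continuous_chord|move=> u; exact: cvg_id].
rewrite (@integral_subst_sin R r (fun t => t ^+ 2 * h t (Num.sqrt (s - t ^+ 2))))//; last first.
  apply: continuous_comp_itv => t.
  apply: (@continuousM R R (fun t => t ^+ 2) (fun t => h t (Num.sqrt (s - t ^+ 2)))); first exact: exprn_continuous.
  by apply: cpair; [move=> u; exact: cvg_id|exact: continuous_chord].
apply: eq_integral => x; rewrite inE /= in_itv /= => /andP[x0 xp]; congr EFin.
have c0 : 0 <= cos x.
  by rewrite cos_ge0_pihalf// xp andbT (le_trans _ x0)// oppr_le0 ltW// pihalf_gt0.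
have s0' : 0 <= sin x.
  rewrite sin_ge0_pi// x0 (le_trans xp)// ler_pdivrMr// ler_peMr ?pi_ge0//.
  by rewrite ler1n.
have -> : s - (r * cos x) ^+ 2 = (r * sin x) ^+ 2.
  by rewrite -r2 !exprMn -{1}(mulr1 (r ^+ 2)) -(cos2Dsin2 x); ring.
have -> : s - (r * sin x) ^+ 2 = (r * cos x) ^+ 2.
  by rewrite -r2 !exprMn -{1}(mulr1 (r ^+ 2)) -(cos2Dsin2 x); ring.
rewrite !sqrtr_sqr !ger0_norm ?mulr_ge0 ?(ltW r0)//.
by ring.
Qed.

End exchange.

Section sphere_points.
Context (R : realType) (n : nat).
Local Notation L := (@lebesgue_rV R n).
Local Notation lam := (@lebesgue_measure R).
Implicit Types (P : {set 'I_n}) (rho : R) (i k : 'I_n) (z : 'rV[R]_n).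

(* The point of the sphere [partial_sqnorm P = rho] on the coordinate line
   through [z] in the direction [i]; junk when [slice_room P rho i z < 0]. *)
Definition sphere_point P rho i z : 'rV[R]_n := upd i z (Num.sqrt (slice_room P rho i z)).

Lemma slice_room_le P rho i z : slice_room P rho i z <= rho.
Proof. by rewrite gerBl sumr_ge0// => j _; exact: sqr_ge0. Qed.

Lemma sqrt_room_le1 P rho i z : rho <= 1 -> Num.sqrt (slice_room P rho i z) <= 1.
Proof.
move=> rho1; rewrite -sqrtr1 ler_wsqrtr//.
exact: le_trans (slice_room_le _ _ _ _) rho1.
Qed.

Lemma slice_top_sqrt P rho i z : rho <= 1 -> i \in P ->
  slice_top P rho i z = Num.sqrt (slice_room P rho i z).
Proof. by move=> rho1 iP; rewrite /slice_top iP; apply/min_idPr; exact: sqrt_room_le1. Qed.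

Lemma cube_sphere_point P rho i z : rho <= 1 -> cube z -> cube (sphere_point P rho i z).
Proof. by move=> rho1 cz; apply: cube_upd => //; rewrite sqrtr_ge0 sqrt_room_le1. Qed.

Lemma sphere_point_sqnorm P rho i z : i \in P -> 0 <= slice_room P rho i z ->
  partial_sqnorm P (sphere_point P rho i z) = rho.
Proof. by move=> iP w0; rewrite partial_sqnorm_updE iP sqr_sqrtr//; rewrite /slice_room; ring. Qed.

Lemma measurable_sqrt_room P rho i :
  measurable_fun setT (fun z => Num.sqrt (slice_room P rho i z) : measurableTypeR R).
Proof.
apply: (@measurableT_comp _ _ _ _ _ _ (@Num.sqrt R)); last exact: measurable_slice_room.
by apply: continuous_measurable_fun; exact: sqrt_continuous.
Qed.

Lemma measurable_sphere_point P rho i : measurable_fun setT (sphere_point P rho i).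
Proof. exact: measurable_upd_fun (measurable_sqrt_room _ _ _). Qed.

Lemma slice_room_upd_other P rho i k z t : i != k -> k \in P ->
  slice_room P rho i (upd k z t) = rho - partial_sqnorm (P :\ i :\ k) z - t ^+ 2.
Proof.
move=> ik kP; rewrite /slice_room partial_sqnorm_updE in_setD1 eq_sym ik kP /=.
by ring.
Qed.

(** The projection along a coordinate j turns surface measure into y_j/r times itself, so both sides
    are the surface integral of y_i^2 y_k f / r. The proof averages the left side along [k] and the
    right side along [i], which leaves a quarter circle in the plane of these two coordinates. *)
Lemma sphere_point_exchange P rho i k (f : 'rV[R]_n -> R) : rho <= 1 ->
  i \in P -> k \in P -> continuous f ->
  (\int[L]_(z in cube) ((0 <= slice_room P rho i z)%R%:R *
     (let y := sphere_point P rho i z in y 0 i * y 0 k * f y))%:E =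
   \int[L]_(z in cube) ((0 <= slice_room P rho k z)%R%:R *
     (let y := sphere_point P rho k z in y 0 i ^+ 2 * f y))%:E)%E.
Proof.
move=> rho1 iP kP cf; have [->|ik] := eqVneq i k.
  by apply: eq_integral => z _; rewrite /= expr2.
have [M fM] := continuous_bounded_cube cf.
have mf : measurable_fun setT (f : _ -> measurableTypeR R) by exact: continuous_measurable_rV.
have mc j l : measurable_fun setT (fun z => sphere_point P rho j z 0 l : measurableTypeR R).
  exact: (measurableT_comp (@measurable_rV_coord R n l) (@measurable_sphere_point P rho j)).
have bnd (b : bool) x y u : 0 <= x <= 1 -> 0 <= y <= 1 -> `|u| <= M -> `|b%:R * (x * y * u)| <= M.
  move=> /andP[x0 x1] /andP[y0 y1] uM.
  rewrite !normrM (ger0_norm x0) (ger0_norm y0).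
  have h : 0 <= x * y * `|u| <= M.
    rewrite !mulr_ge0//= (le_trans _ uM)// ler_piMl//.
    by rewrite mulr_ile1.
  by case: b; rewrite ?normr1 ?mul1r ?normr0 ?mul0r; case/andP: h => // h1; exact: le_trans.
rewrite (@cube_integral_upd_bounded _ _ k _ M); last 2 first.
- apply: measurable_funM; first exact: measurable_room_indic.
  apply: measurable_funM; first by apply: measurable_funM; exact: mc.
  exact: (measurableT_comp mf (@measurable_sphere_point P rho i)).
- by move=> z cz; apply: bnd; [..|apply: fM]; exact: cube_sphere_point.
rewrite [RHS](@cube_integral_upd_bounded _ _ i _ M); last 2 first.
- apply: measurable_funM; first exact: measurable_room_indic.
  apply: measurable_funM; first exact: (measurableT_comp (exprn_measurable _) (mc k i)).
  exact: (measurableT_comp mf (@measurable_sphere_point P rho k)).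
- by move=> z cz; rewrite /= expr2; apply: bnd; [..|apply: fM]; exact: cube_sphere_point.
apply: eq_integral => z _.
pose s := rho - partial_sqnorm (P :\ i :\ k) z.
pose h (a b : R) := f (upd i (upd k z b) a).
have s1 : s <= 1.
  by rewrite (le_trans _ rho1)// gerBl sumr_ge0// => j _; exact: sqr_ge0.
have ch : continuous (fun p : R * R => h p.1 p.2).
  move=> p; apply: (@continuous_comp _ _ _ (fun p : R * R => upd i (upd k z p.2) p.1) f);
    last exact: cf.
  move: p; apply: continuous_rV => j.
  under eq_fun do rewrite !mxE.
  case: (j == i); first by move=> p; exact: cvg_fst.
  by case: (j == k); [move=> p; exact: cvg_snd|exact: cst_continuous].
have := quarter_circle_exchange s1 ch; congr (_ = _); apply: eq_integral => t _; congr EFin.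
  rewrite slice_room_upd_other// -/s /sphere_point slice_room_upd_other// -/s.
  by rewrite /h !mxE eqxx eq_sym (negbTE ik) eqxx.
rewrite slice_room_upd_other 1?eq_sym// /sphere_point slice_room_upd_other 1?eq_sym//.
rewrite (_ : P :\ k :\ i = P :\ i :\ k); last first.
  by rewrite !finset.setDDl finset.setUC.
by rewrite -/s /h !mxE eqxx (negbTE ik) upd_swap.
Qed.

End sphere_points.

(** * Means of bounded functions over the cube *)

Section cube_mean.
Context (R : realType) (n : nat).
Local Notation L := (@lebesgue_rV R n).
Implicit Types f g : 'rV[R]_n -> R.

Definition cube_bounded f :=
  measurable_fun setT (f : _ -> measurableTypeR R) /\ exists M, forall x, cube x -> `|f x| <= M.

Definition cube_mean f := \int[L]_(x in cube) f x.

Lemma cube_bounded_integrable f : cube_bounded f -> L.-integrable cube (EFin \o f).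
Proof. by move=> [mf [M fM]]; exact: integrable_cube mf fM. Qed.

Lemma cube_meanE f : cube_bounded f -> (\int[L]_(x in cube) (f x)%:E = (cube_mean f)%:E)%E.
Proof.
move=> bf; rewrite fineK//; apply: integrable_fin_num; first exact: measurable_cube.
exact: cube_bounded_integrable.
Qed.

(** The formulas for the normal are valid over the open cube, whereas averaging along coordinates is
    done on the closed one; the faces in between are null. *)
Lemma cube_mean_open f : cube_bounded f ->
  (\int[L]_(x in open_cube) (f x)%:E = (cube_mean f)%:E)%E.
Proof.
move=> bf; rewrite -cube_meanE// [RHS](@negligible_integral _ _ _ _ _ (cube `\` open_cube))//.
- by rewrite setDD (setIidr (@sub_open_cube R n)).
- by apply: measurableD; [exact: measurable_cube|exact: measurable_open_cube].
- exact: cube_bounded_integrable.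
- exact: cube_boundary_null.
Qed.

Lemma cube_bounded_cst c : cube_bounded (fun=> c).
Proof. by split; [exact: measurable_cst|exists `|c|]. Qed.

Lemma cube_bounded_continuous f : continuous f -> cube_bounded f.
Proof.
by move=> cf; split; [exact: continuous_measurable_rV|exact: continuous_bounded_cube].
Qed.

Lemma cube_boundedM f g : cube_bounded f -> cube_bounded g -> cube_bounded (fun x => f x * g x).
Proof.
move=> [mf [M fM]] [mg [N gN]]; split; first exact: measurable_funM.
exists (M * N) => x cx; rewrite normrM.
by apply: ler_pM => //; [exact: fM|exact: gN].
Qed.

Lemma cube_boundedD f g : cube_bounded f -> cube_bounded g -> cube_bounded (fun x => f x + g x).
Proof.
move=> [mf [M fM]] [mg [N gN]]; split; first exact: measurable_funD.
exists (M + N) => x cx; apply: (le_trans (ler_normD _ _)).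
by apply: lerD; [exact: fM|exact: gN].
Qed.

Lemma cube_boundedZ c f : cube_bounded f -> cube_bounded (fun x => c * f x).
Proof. exact: cube_boundedM (cube_bounded_cst c). Qed.

Lemma cube_bounded_sum (I : Type) (s : seq I) (Q : pred I) (f : I -> 'rV[R]_n -> R) :
  (forall i, cube_bounded (f i)) -> cube_bounded (fun x => \sum_(i <- s | Q i) f i x).
Proof.
move=> bf; elim: s => [|i s ih].
  by under eq_fun do rewrite big_nil; exact: cube_bounded_cst.
under eq_fun do rewrite big_cons; case: (Q i) => //.
exact: cube_boundedD.
Qed.

Lemma cube_bounded_comp f (phi : 'rV[R]_n -> 'rV[R]_n) : measurable_fun setT phi ->
  (forall z, cube z -> cube (phi z)) -> cube_bounded f -> cube_bounded (fun z => f (phi z)).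
Proof.
move=> mphi cphi [mf [M fM]]; split; first exact: (measurableT_comp mf mphi).
by exists M => z cz; apply: fM; exact: cphi.
Qed.

Lemma cube_bounded_coord k : cube_bounded (fun z => z 0 k).
Proof. by apply: cube_bounded_continuous => z; exact: coord_continuous. Qed.

Lemma cube_mean0 : cube_mean (fun=> 0) = 0.
Proof. by rewrite /cube_mean /Rintegral integral0. Qed.

Lemma cube_meanZ c f : cube_bounded f -> cube_mean (fun x => c * f x) = c * cube_mean f.
Proof.
move=> bf; apply: RintegralZl; first exact: measurable_cube.
exact: cube_bounded_integrable.
Qed.

Lemma cube_meanB f g : cube_bounded f -> cube_bounded g ->
  cube_mean (fun x => f x - g x) = cube_mean f - cube_mean g.
Proof.
move=> bf bg; apply: RintegralB; first exact: measurable_cube.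
  exact: cube_bounded_integrable.
exact: cube_bounded_integrable.
Qed.

Lemma cube_mean_sum (I : Type) (s : seq I) (Q : pred I) (f : I -> 'rV[R]_n -> R) :
  (forall i, cube_bounded (f i)) ->
  cube_mean (fun x => \sum_(i <- s | Q i) f i x) = \sum_(i <- s | Q i) cube_mean (f i).
Proof.
move=> bf; apply: EFin_inj; rewrite -cube_meanE; last exact: cube_bounded_sum.
under eq_integral do rewrite -sumEFin.
rewrite integral_sum; first last.
- by move=> i; exact: cube_bounded_integrable.
- exact: measurable_cube.
by rewrite -sumEFin; apply: eq_bigr => i _; rewrite cube_meanE.
Qed.

Lemma eq_cube_mean f g : (forall z, cube z -> f z = g z) -> cube_mean f = cube_mean g.
Proof. by move=> fg; apply: eq_Rintegral => z; rewrite inE; exact: fg. Qed.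

End cube_mean.

(** * The boundary measure of a tube and its Gauss-Green formula *)

Section tube_boundary_measure.
Context (R : realType) (n : nat) (e : 'I_n -> bool) (P : {set 'I_n}) (r : R).
Hypotheses (r0 : 0 < r) (r1 : r < 1).
Local Notation L := (@lebesgue_rV R n).
Implicit Types (i k : 'I_n) (x y z : 'rV[R]_n).

Local Notation sgn k := (@flip_sign R n e k).
Local Notation room k z := (slice_room P (r ^+ 2) k z).
Local Notation point i z := (sphere_point P (r ^+ 2) i z).

Let r21 : r ^+ 2 <= 1. Proof. by rewrite expr_le1// ltW. Qed.
Let r21' : r ^+ 2 < 1. Proof. by rewrite exprn_ilt1 ?ltW//. Qed.

(* [inl i] indexes the spherical part of the boundary seen along the direction
   [i], [inr (k, b)] the part of the boundary in the facet [x_k = b] of the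
   cube (after [flip e]). *)
Definition boundary_index := ('I_n + 'I_n * bool)%type.

(** Projected along [i], surface measure on the sphere has the unbounded density r/sqrt(room).
    Weighting it by the square room/r^2 of the [i]-th component of the normal gives the bounded
    density used here, and since these squares add up to 1 over [P], the pieces together form the
    surface measure. The facet with [b] true is absent for [k] in [P], because the tube does not
    reach it when [r < 1]. *)
Definition boundary_density (l : boundary_index) z : R :=
  match l with
  | inl i => (i \in P)%:R * (0 <= room i z)%R%:R * (Num.sqrt (room i z) / r)
  | inr (k, b) => (~~ (b && (k \in P)))%:R * (0 <= room k z)%R%:R
  end.

Definition boundary_map (l : boundary_index) z : 'rV[R]_n :=
  match l with
  | inl i => flip e (point i z)
  | inr (k, b) => flip e (upd k z b%:R)
  end.

(** One formula on the whole open cube, continuous near the sphere, so that its means over small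
    balls converge. Where it fails to be a unit vector, as off the sphere or where facets meet, the
    boundary measure has no mass. *)
Definition boundary_normal x : 'rV[R]_n :=
  \row_k (if x \in open_cube then (k \in P)%:R * ((x 0 k - (e k)%:R) / r)
          else (x 0 k == 1)%:R - (x 0 k == 0)%:R).

Lemma boundary_density_ge0 l z : 0 <= boundary_density l z.
Proof.
case: l => [i|[k b]] /=; last by rewrite mulr_ge0.
by rewrite !mulr_ge0// ?sqrtr_ge0// invr_ge0 ltW.
Qed.

Lemma measurable_boundary_density l :
  measurable_fun setT (boundary_density l : _ -> measurableTypeR R).
Proof.
case: l => [i|[k b]] /=; last first.
  by apply: measurable_funM; [exact: measurable_cst|exact: measurable_room_indic].
apply: measurable_funM.
  by apply: measurable_funM; [exact: measurable_cst|exact: measurable_room_indic].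
by apply: measurable_funM; [exact: measurable_sqrt_room|exact: measurable_cst].
Qed.

Lemma measurable_boundary_map l : measurable_fun setT (boundary_map l).
Proof.
case: l => [i|[k b]] /=; apply: (measurableT_comp (@measurable_flip R n e)).
  exact: measurable_sphere_point.
exact: (@measurable_upd_fun R n k (fun=> b%:R) (measurable_cst _)).
Qed.

Lemma cube_boundary_map l z : cube z -> cube (boundary_map l z).
Proof.
move=> cz; case: l => [i|[k b]] /=; apply: cube_flip; first exact: cube_sphere_point.
by apply: cube_upd => //; case: b; rewrite ?lexx ?ler01.
Qed.

Lemma measurable_coord_eq k (a : R) :
  measurable_fun setT (fun x : 'rV[R]_n => (x 0 k == a)%:R : measurableTypeR R).
Proof.
rewrite (_ : (fun x => _) = \1_[set a] \o (fun x : 'rV[R]_n => x 0 k)); last first.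
  apply/funext => x /=; rewrite indicE; congr (nat_of_bool _)%:R.
  by apply/eqP/idP; rewrite inE.
exact: (measurableT_comp (measurable_indic _) (@measurable_rV_coord R n k)).
Qed.

Lemma measurable_boundary_normal : measurable_fun setT boundary_normal.
Proof.
apply: measurable_rV => k.
under eq_fun do rewrite mxE.
apply: measurable_fun_ifT.
- apply: (@measurable_fun_bool _ _ _ _ true).
  rewrite setTI (_ : _ @^-1` _ = open_cube); first exact: measurable_open_cube.
  by apply/seteqP; split => x /=; [move=> /set_mem|move=> h; exact: mem_set].
- apply: measurable_funM; first exact: measurable_cst.
  apply: measurable_funM; last exact: measurable_cst.
  by apply: measurable_funB; [exact: measurable_rV_coord|exact: measurable_cst].
- by apply: measurable_funB; exact: measurable_coord_eq.
Qed.

Lemma boundary_density_le l z : boundary_density l z <= r^-1.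
Proof.
have i1 : 1 <= r^-1 by rewrite invf_ge1// ltW.
case: l => [i|[k b]] /=; last first.
  by apply: le_trans i1; rewrite -natrM mulnb; case: (_ && _) ; rewrite ?lexx ?ler01.
case: (i \in P); last by rewrite !mul0r invr_ge0 ltW.
case: (0 <= _); last by rewrite mulr0 mul0r invr_ge0 ltW.
rewrite !mul1r ler_piMl ?invr_ge0 ?(ltW r0)//.
exact: sqrt_room_le1.
Qed.

Lemma cube_bounded_density l : cube_bounded (boundary_density l).
Proof.
split; first exact: measurable_boundary_density.
exists r^-1 => z _; rewrite ger0_norm ?boundary_density_ge0//.
exact: boundary_density_le.
Qed.

Lemma cube_bounded_normal k : cube_bounded (fun x => boundary_normal x 0 k).
Proof.
split; first exact: (measurableT_comp (@measurable_rV_coord R n k) measurable_boundary_normal).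
exists (r^-1 + 1) => x cx; rewrite mxE.
have /andP[x0 x1] := cx k; have ri : 0 < r^-1 by rewrite invr_gt0.
case: (x \in open_cube); last first.
  have : `|(x 0 k == 1)%:R - (x 0 k == 0)%:R| <= 1 :> R.
    case: (x 0 k == 1); case: (x 0 k == 0);
    by rewrite ?subrr ?sub0r ?subr0 ?normrN ?normr0 ?normr1 ?lexx ?ler01.
  by move=> /le_trans; apply; rewrite lerDr ltW.
case: (k \in P); last by rewrite mul0r normr0 addr_ge0// ltW.
rewrite mul1r normrM (gtr0_norm ri).
have : `|x 0 k - (e k)%:R| <= 1.
  by case: (e k); rewrite /= ?subr0 ler_norml; apply/andP; split; move: x0 x1 => /=; lra.
by move=> h; rewrite -[leLHS]addr0; apply: lerD => //; rewrite ler_piMl// ltW.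
Qed.

Lemma open_cube_flip x : open_cube x -> open_cube (flip e x).
Proof.
move=> ox j; rewrite mxE; have /andP[a b] := ox j.
by case: (e j); rewrite ?a ?b// subr_gt0 b /= ltrBlDr ltrDl.
Qed.

Lemma open_cube_sphere_point i z : open_cube z -> 0 < room i z -> open_cube (point i z).
Proof.
move=> oz w0 j; rewrite mxE; case: (j == i); last exact: oz.
rewrite sqrtr_gt0 w0 /= -sqrtr1 ltr_sqrt//.
exact: le_lt_trans (slice_room_le _ _ _ _) r21'.
Qed.

Lemma flip_offset x k : flip e x 0 k - (e k)%:R = sgn k * x 0 k.
Proof. by rewrite mxE /flip_sign; case: (e k) => /=; ring. Qed.

Lemma boundary_normal_sphere i z k : open_cube z -> 0 < room i z ->
  boundary_normal (flip e (point i z)) 0 k =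
  (k \in P)%:R * (sgn k * point i z 0 k / r).
Proof.
move=> oz w0; rewrite mxE mem_set; last exact/open_cube_flip/open_cube_sphere_point.
by rewrite flip_offset.
Qed.

Lemma boundary_normal_facet k (b : bool) z : open_cube z ->
  boundary_normal (flip e (upd k z b%:R)) = (sgn k * (if b then 1 else -1)) *: delta_mx 0 k.
Proof.
move=> oz; apply/rowP => j; rewrite mxE memNset; last first.
  by move=> /(_ k); rewrite !mxE eqxx; case: (e k); case: b => /=;
    rewrite ?subr0 ?subrr ?ltxx ?andbF.
rewrite !mxE /=; have [->|jk] := eqVneq j k.
  rewrite mulr1 /flip_sign; case: (e k); case: b => /=;
  by rewrite ?subr0 ?subrr ?eqxx ?oner_eq0 1?eq_sym ?oner_eq0 /= ?subr0 ?sub0r ?mulN1r ?mul1r ?opprK.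
rewrite mulr0; have /andP[a1 a2] := oz j.
have h u : 0 < u < 1 -> (u == 1)%:R - (u == 0)%:R = 0 :> R.
  by move=> /andP[u0 u1]; rewrite (lt_eqF u1) (gt_eqF u0) subrr.
by apply: h; case: (e j); rewrite ?a1// subr_gt0 a2 /= ltrBlDr ltrDl.
Qed.

Lemma enorm_boundary_normal l z : open_cube z -> boundary_density l z != 0 ->
  enorm (boundary_normal (boundary_map l z)) = 1.
Proof.
move=> oz; case: l => [i|[k b]] /= c0; last first.
  rewrite boundary_normal_facet// enormZ /enorm /edot (bigD1 k)//= big1 ?addr0; last first.
    by move=> j /negbTE jk; rewrite mxE jk mulr0.
  rewrite mxE !eqxx /= mulr1 sqrtr1 mulr1 normrM /flip_sign.
  by case: (e k); case: b {c0}; rewrite ?normrN ?normr1 mulr1.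
have iP : i \in P by apply: contraNT c0 => /negbTE ->; rewrite !mul0r.
have w0 : 0 < room i z.
  rewrite lt_neqAle; apply/andP; split.
    by apply: contraNneq c0 => <-; rewrite sqrtr0 mul0r mulr0.
  by apply: contraNT c0 => /negbTE ->; rewrite mulr0 mul0r.
rewrite /enorm /edot.
under eq_bigr do rewrite boundary_normal_sphere//.
rewrite -[RHS]sqrtr1; congr Num.sqrt.
transitivity ((r ^+ 2)^-1 * partial_sqnorm P (point i z)); last first.
  by rewrite sphere_point_sqnorm ?ltW// mulVf// expf_neq0// gt_eqF.
rewrite /partial_sqnorm mulr_sumr [RHS]big_mkcond; apply: eq_bigr => j _ /=.
case: (j \in P); last by rewrite !mul0r.
have : sgn j * sgn j = 1 by rewrite /flip_sign; case: (e j); ring.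
rewrite !mul1r => s2; rewrite [LHS](_ : _ = sgn j * sgn j *
  (point i z 0 j ^+ 2 * (r^-1 * r^-1))); last by ring.
by rewrite s2 mul1r mulrC expr2 invfM.
Qed.

Section boundary_measure.
Variable m : {measure set 'rV[R]_n -> \bar R}.
Hypothesis mE : forall f : 'rV[R]_n -> \bar R, measurable_fun setT f -> (forall y, (0 <= f y)%E) ->
  (\int[m]_y f y =
   \sum_l \int[L]_(z in open_cube) ((boundary_density l z)%:E * f (boundary_map l z)))%E.

Lemma integral_boundary_measure (f : 'rV[R]_n -> R) : cube_bounded f ->
  (\int[m]_y (f y)%:E =
   (\sum_l cube_mean (fun z => boundary_density l z * f (boundary_map l z)))%:E)%E.
Proof.
move=> bf.
have bl l : cube_bounded (fun z => boundary_density l z * f (boundary_map l z)).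
  apply: cube_boundedM; first exact: cube_bounded_density.
  apply: cube_bounded_comp bf; first exact: measurable_boundary_map.
  by move=> z; exact: cube_boundary_map.
rewrite (integral_sum_density (measurable_open_cube (n:=n)) boundary_density_ge0 mE bf.1).
  by rewrite -sumEFin; apply: eq_bigr => l _; rewrite -cube_mean_open.
move=> l; apply: (@integrableS _ _ _ L cube).
- exact: measurable_cube.
- exact: measurable_open_cube.
- exact: sub_open_cube.
- exact: cube_bounded_integrable.
Qed.

Lemma cube_bounded_indic (A : set 'rV[R]_n) : measurable A -> cube_bounded (\1_A : _ -> R).
Proof.
move=> mA; split; first exact: measurable_indic.
by exists 1 => x _; rewrite indicE; case: (_ \in _); rewrite ?normr1 ?normr0 ?ler01 ?lexx.
Qed.

Lemma boundary_measureE (A : set 'rV[R]_n) : measurable A ->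
  m A = (\sum_l cube_mean (fun z => boundary_density l z * \1_A (boundary_map l z)))%:E.
Proof.
move=> mA; rewrite -integral_boundary_measure; last exact: cube_bounded_indic.
by rewrite integral_indic// setIT.
Qed.

Lemma boundary_measure_fin (A : set 'rV[R]_n) : measurable A -> (m A < +oo)%E.
Proof. by move=> mA; rewrite boundary_measureE// ltry. Qed.

Lemma boundary_measure_normal : {ae m, forall x, enorm (boundary_normal x) = 1}.
Proof.
pose A := [set x | enorm (boundary_normal x) != 1].
have mA : measurable A.
  have mn : measurable_fun setT (fun x => enorm (boundary_normal x) : measurableTypeR R).
    apply: (@measurableT_comp _ _ _ _ _ _ (@Num.sqrt R)).
      by apply: continuous_measurable_fun; exact: sqrt_continuous.
    apply: measurable_sum => k.
    by apply: measurable_funM; exact: (cube_bounded_normal k).1.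
  have := mn measurableT (~` [set 1]) (measurableC (measurable_set1 _)).
  rewrite setTI; congr measurable; apply/seteqP; split => x; rewrite /A /=; first by move/eqP.
  by move/eqP.
exists A; split => //; last by move=> x /= /eqP.
rewrite boundary_measureE//; congr EFin; apply: big1 => l _.
rewrite -(@cube_mean0 R n); apply: EFin_inj.
rewrite -cube_mean_open; last first.
  apply: cube_boundedM; first exact: cube_bounded_density.
  apply: cube_bounded_comp; first exact: measurable_boundary_map.
    by move=> z; exact: cube_boundary_map.
  exact: cube_bounded_indic.
rewrite -cube_mean_open; last exact: cube_bounded_cst.
apply: eq_integral => z; rewrite inE => oz; congr EFin.
have [->|c0] := eqVneq (boundary_density l z) 0; first by rewrite mul0r.
by rewrite indicE memNset ?mulr0// /A /= enorm_boundary_normal// eqxx.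
Qed.

Section gauss_green.
Variable T : 'rV[R]_n -> 'rV[R]_n.
Hypotheses (dT : forall x, differentiable T x) (cT : forall v, continuous ('D_v T)).

Let f k z := sgn k * T (flip e z) 0 k.

Let cf k : continuous (f k).
Proof.
move=> z; apply: (@continuousM R 'rV[R]_n (cst (sgn k)) (fun z => T (flip e z) 0 k)).
  exact: cst_continuous.
apply: (@continuous_comp _ _ _ (@flip R n e) (fun x => T x 0 k)).
  exact: continuous_flip.
exact: continuous_field.
Qed.

Let bf k : cube_bounded (f k). Proof. exact: cube_bounded_continuous. Qed.

Let ind k z : R := (0 <= room k z)%R%:R.

Let bind k : cube_bounded (ind k).
Proof.
split; first exact: measurable_room_indic.
by exists 1 => x _; rewrite /ind; case: (0 <= _); rewrite ?normr1 ?normr0 ?ler01 ?lexx.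
Qed.

Let bpoint i g : cube_bounded g -> cube_bounded (fun z => g (point i z)).
Proof.
apply: cube_bounded_comp; first exact: measurable_sphere_point.
by move=> z; exact: cube_sphere_point.
Qed.

Let bface k (b : bool) g : cube_bounded g -> cube_bounded (fun z => g (upd k z b%:R)).
Proof.
apply: cube_bounded_comp; first exact: (@measurable_upd_fun R n k (fun=> b%:R) (measurable_cst _)).
by move=> z cz; apply: cube_upd => //; case: b; rewrite ?lexx ?ler01.
Qed.

Let sphere_part k := cube_mean (fun z => ind k z * f k (point k z)).
Let face_part k (b : bool) := cube_mean (fun z => ind k z * f k (upd k z b%:R)).

Let divergence_parts :
  (\int[L]_(x in vertex_tube e P (r ^+ 2)) (divergence T x)%:E =
   (\sum_k ((if k \in P then sphere_part k else face_part k true) - face_part k false))%:E)%E.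
Proof.
rewrite (integral_divergence e dT cT) -sumEFin; apply: eq_bigr => k _.
have b1 := cube_boundedM (bind k) (bface k false (bf k)).
case: (boolP (k \in P)) => kP.
  have b2 := cube_boundedM (bind k) (bpoint k (bf k)).
  rewrite -cube_meanB// -cube_meanE; last first.
    by apply: cube_boundedD => //; rewrite (_ : (fun x => _) = (fun x => -1 * (ind k x * f k (upd k x false%:R))));
      [exact: cube_boundedZ|apply/funext => x; rewrite mulN1r].
  by apply: eq_integral => z _; rewrite slice_top_sqrt// mulrBr.
have b2 := cube_boundedM (bind k) (bface k true (bf k)).
rewrite -cube_meanB// -cube_meanE; last first.
  by apply: cube_boundedD => //; rewrite (_ : (fun x => _) = (fun x => -1 * (ind k x * f k (upd k x false%:R))));
    [exact: cube_boundedZ|apply/funext => x; rewrite mulN1r].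
by apply: eq_integral => z _; rewrite /slice_top (negbTE kP) mulrBr.
Qed.

Let bTn : cube_bounded (fun x => edot (T x) (boundary_normal x)).
Proof.
apply: cube_bounded_sum => k; apply: cube_boundedM; last exact: cube_bounded_normal.
by apply: cube_bounded_continuous; exact: continuous_field.
Qed.

Let flux l := cube_mean (fun z => boundary_density l z *
  edot (T (boundary_map l z)) (boundary_normal (boundary_map l z))).

Let bflux l : cube_bounded (fun z => boundary_density l z *
  edot (T (boundary_map l z)) (boundary_normal (boundary_map l z))).
Proof.
apply: cube_boundedM; first exact: cube_bounded_density.
apply: cube_bounded_comp bTn; first exact: measurable_boundary_map.
by move=> z; exact: cube_boundary_map.
Qed.

Let flux_face k b :
  flux (inr (k, b)) = if b && (k \in P) then 0 else (if b then 1 else -1) * face_part k b.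
Proof.
have b1 := cube_boundedM (bind k) (bface k b (bf k)).
transitivity (cube_mean (fun z => (~~ (b && (k \in P)))%:R * (if b then 1 else -1) *
   (ind k z * f k (upd k z b%:R)))).
  apply: EFin_inj; rewrite -!cube_mean_open//; last exact: cube_boundedZ.
  apply: eq_integral => z; rewrite inE => oz; congr EFin => /=.
  rewrite boundary_normal_facet// /edot (bigD1 k)//= big1 ?addr0; last first.
    by move=> j /negbTE jk; rewrite !mxE jk !mulr0.
  by rewrite mxE mxE !eqxx /= /f /ind; ring.
rewrite cube_meanZ//; case: (b && _); first by rewrite !mul0r.
by rewrite mul1r.
Qed.

(** The piece seen along [i] carries all components of the field. The exchange of coordinates
    rewrites the [k]-th one as an integral along [k], with weight the square of the [i]-th
    coordinate. *)
Let flux_sphere i : flux (inl i) = if i \in P then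
  \sum_(k in P) r ^- 2 * cube_mean (fun z => ind k z * (point k z 0 i ^+ 2 * f k (point k z)))
  else 0.
Proof.
have by2 j l k : cube_bounded (fun z => ind l z * (point l z 0 i * point l z 0 j * f k (point l z))).
  apply: cube_boundedM => //; apply: (bpoint l (g := fun y => y 0 i * y 0 j * f k y)).
  by apply: cube_boundedM => //; apply: cube_boundedM; exact: cube_bounded_coord.
case: (boolP (i \in P)) => iP; last first.
  rewrite -(@cube_mean0 R n); apply: eq_cube_mean => z _ /=.
  by rewrite (negbTE iP) !mul0r.
transitivity (cube_mean (fun z => \sum_(k in P) r ^- 2 *
    (ind i z * (point i z 0 i * point i z 0 k * f k (point i z))))).
  apply: EFin_inj; rewrite -!cube_mean_open//; last first.
    by apply: cube_bounded_sum => k; apply: cube_boundedZ.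
  apply: eq_integral => z; rewrite inE => oz; congr EFin => /=.
  rewrite iP mul1r /ind; case: (boolP (0 <= room i z)) => w0; last first.
    by rewrite !mul0r big1// => k _; rewrite mul0r mulr0.
  have yi : point i z 0 i = Num.sqrt (room i z) by rewrite mxE eqxx.
  move: w0; rewrite le_eqVlt => /predU1P[w0|w0].
    rewrite -w0 sqrtr0 !mul0r mulr0 mul0r big1// => k _.
    by rewrite yi -w0 sqrtr0 !mul0r !mulr0.
  rewrite /edot mul1r mulr_sumr [RHS]big_mkcond; apply: eq_bigr => k _ /=.
  rewrite boundary_normal_sphere// -yi /f; case: (k \in P); last by rewrite mul0r !mulr0.
  by rewrite !mul1r; field; rewrite gt_eqF.
rewrite cube_mean_sum; last by move=> k; apply: cube_boundedZ.
apply: eq_bigr => k kP; rewrite cube_meanZ//; congr (_ * _).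
apply: EFin_inj; rewrite -cube_meanE// sphere_point_exchange// cube_meanE//.
by have := by2 i k k; congr cube_bounded; apply/funext => z; rewrite expr2.
Qed.

Lemma tube_gauss_green :
  (\int[L]_(x in vertex_tube e P (r ^+ 2)) (divergence T x)%:E =
   \int[m]_x (edot (T x) (boundary_normal x))%:E)%E.
Proof.
rewrite divergence_parts integral_boundary_measure//; congr EFin.
rewrite -/(flux _) big_sumType /= (eq_bigr _ (fun i _ => flux_sphere i)).
have -> : \sum_(p : 'I_n * bool) flux (inr p) = \sum_k (flux (inr (k, true)) + flux (inr (k, false))).
  rewrite (eq_bigr (fun p => flux (inr (p.1, p.2)))); last by case.
  rewrite -(pair_bigA _ (fun k b => flux (inr (k, b)))) /=.
  by apply: eq_bigr => k _; rewrite big_bool.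
rewrite -big_mkcond exchange_big [X in X + _]big_mkcond -big_split /=; apply: eq_bigr => k _.
rewrite !flux_face /= mul1r mulN1r; case: (boolP (k \in P)) => kP; last by rewrite add0r.
rewrite add0r; congr (_ - _).
have bk i : cube_bounded (fun z => ind k z * (point k z 0 i ^+ 2 * f k (point k z))).
  apply: cube_boundedM => //; apply: (bpoint k (g := fun y => y 0 i ^+ 2 * f k y)).
  apply: cube_boundedM => //; under eq_fun do rewrite expr2.
  by apply: cube_boundedM; exact: cube_bounded_coord.
rewrite -mulr_sumr -cube_mean_sum// -cube_meanZ; last exact: cube_bounded_sum.
(* On the sphere the squared coordinates over [P] add up to r^2, which cancels the factor r^-2 and
   leaves the spherical term of the divergence formula. *)
apply: eq_cube_mean => z _; rewrite -mulr_sumr -mulr_suml /ind.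
case: (boolP (0 <= room k z)) => w0; last by rewrite !mul0r mulr0.
rewrite !mul1r -[X in X * f k _]/(partial_sqnorm P (point k z)) sphere_point_sqnorm// mulrA.
by rewrite mulVf ?mul1r// expf_neq0// gt_eqF.
Qed.

End gauss_green.
End boundary_measure.
End tube_boundary_measure.

(** * The sphere lies in the reduced boundary *)

Section sphere_in_reduced_boundary.
Context (R : realType) (n : nat) (e : 'I_n -> bool) (P : {set 'I_n}) (r : R).
Hypotheses (r0 : 0 < r) (r1 : r < 1).
Local Notation L := (@lebesgue_rV R n).
Local Notation room k z := (slice_room P (r ^+ 2) k z).
Local Notation point i z := (sphere_point P (r ^+ 2) i z).
Implicit Types (x y z : 'rV[R]_n).

Lemma continuous_sphere_point i : continuous (fun z => point i z).
Proof.
apply: continuous_rV => j; under eq_fun do rewrite mxE.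
case: (j == i); last exact: coord_continuous.
move=> z; apply: (@continuous_comp _ _ _ (fun z => room i z) (@Num.sqrt R)); last exact: sqrt_continuous.
apply: (@continuousB R R 'rV[R]_n (cst (r ^+ 2)) (partial_sqnorm (P :\ i))).
  exact: cst_continuous.
exact: continuous_partial_sqnorm.
Qed.

Lemma continuous_slice_room i : continuous (fun z => room i z).
Proof.
move=> z; apply: (@continuousB R R 'rV[R]_n (cst (r ^+ 2)) (partial_sqnorm (P :\ i))).
  exact: cst_continuous.
exact: continuous_partial_sqnorm.
Qed.

(** One piece, along some [i] in [P], suffices: near the reflected point [y] its density is at least
    [sqrt c / r], with [c] half of the room at [y], and a nonempty open set is mapped into the
    ball. *)
Lemma boundary_measure_eball_gt0 (m : {measure set 'rV[R]_n -> \bar R}) x (s : R) :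
  (forall A, measurable A -> m A =
    (\sum_l cube_mean (fun z => boundary_density P r l z * \1_A (boundary_map e P r l z)))%:E) ->
  open_cube x -> partial_sqnorm P (flip e x) = r ^+ 2 -> 0 < s -> (0 < m (eball x s))%E.
Proof.
move=> mE ox xr s0; set y := flip e x.
have oy : open_cube y by exact: open_cube_flip.
have [i iP] : exists i, i \in P.
  apply/set0Pn; apply/eqP => P0; move: xr.
  by rewrite P0 /partial_sqnorm big_set0 => /esym/eqP; rewrite sqrf_eq0 gt_eqF.
have roomy : room i y = y 0 i ^+ 2.
  rewrite /slice_room -xr /partial_sqnorm -/y (big_setD1 i)//=; ring.
have yi0 : 0 < y 0 i by have /andP[] := oy i.
have pointy : point i y = y.
  by rewrite /sphere_point roomy sqrtr_sqr gtr0_norm// upd_id.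
pose c := room i y / 2.
have c0 : 0 < c by rewrite divr_gt0// roomy exprn_gt0.
pose U := open_cube `&` [set z | c < room i z] `&` [set z | eball x s (flip e (point i z))].
have oU : open U.
  apply: openI; last first.
    apply: (@open_comp _ _ (fun z => flip e (point i z)) (eball x s)); last exact: open_eball.
    move=> z _; apply: continuous_comp; first exact: continuous_sphere_point.
    exact: continuous_flip.
  apply: openI; first exact: open_open_cube.
  apply: (@open_comp _ _ (fun z => room i z) [set t | c < t]); last exact: open_gt.
  by move=> z _; exact: continuous_slice_room.
have mU : measurable U by exact: open_measurable_rV.
have Uy : U y.
  split; first split => //.
    by rewrite /= /c ltr_pdivrMr// ltr_pMr ?roomy ?exprn_gt0// ltr1n.
  by rewrite /= pointy flipK; exact: eball_center.
have LU : (0 < L U)%E by apply: lebesgue_rV_open_gt0 => //; exists y.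
have mB : measurable (eball x s) by apply: open_measurable_rV; exact: open_eball.
have bl l : cube_bounded (fun z => boundary_density P r l z * \1_(eball x s) (boundary_map e P r l z)).
  apply: cube_boundedM; first exact: cube_bounded_density.
  apply: cube_bounded_comp; first exact: measurable_boundary_map.
    by move=> z; exact: cube_boundary_map.
  exact: cube_bounded_indic.
have l0 l z : 0 <= boundary_density P r l z * \1_(eball x s) (boundary_map e P r l z).
  by rewrite mulr_ge0 ?boundary_density_ge0// indicE.
rewrite mE//; apply: (@lt_le_trans _ _ ((Num.sqrt c / r)%:E * L U)%E).
  by rewrite mule_gt0// lte_fin divr_gt0// sqrtr_gt0.
apply: (@le_trans _ _ (cube_mean (fun z => boundary_density P r (inl i) z *
   \1_(eball x s) (boundary_map e P r (inl i) z)))%:E); last first.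
  rewrite lee_fin (bigD1 (inl i : boundary_index n))//= lerDl sumr_ge0// => l _.
  by apply: Rintegral_ge0 => z _.
rewrite -cube_mean_open// -integral_cst//.
apply: (@le_trans _ _ (\int[L]_(z in U) (boundary_density P r (inl i) z *
   \1_(eball x s) (boundary_map e P r (inl i) z))%:E)%E).
  apply: ge0_le_integral => //.
  - by move=> z _; rewrite lee_fin divr_ge0 ?sqrtr_ge0 ?ltW.
  - by apply/measurable_EFinP; apply: measurable_funTS; exact: (bl _).1.
  move=> z [[_ cz] Bz]; rewrite lee_fin /= iP mul1r indicE mem_set// mulr1.
  rewrite (ltW (lt_trans c0 cz)) mul1r ler_pM2r ?invr_gt0// ler_wsqrtr//.
  exact: ltW.
apply: ge0_subset_integral => //.
- exact: measurable_open_cube.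
- by apply/measurable_EFinP; apply: measurable_funTS; exact: (bl _).1.
- by move=> z _; rewrite lee_fin.
- by move=> z [[]].
Qed.

Lemma eball_sub_open_cube x : open_cube x ->
  exists2 s0 : R, 0 < s0 & forall s, s <= s0 -> eball x s `<=` open_cube.
Proof.
move=> ox.
have : nbhs x open_cube by apply: open_nbhs_nbhs; split => //; exact: open_open_cube.
move=> /nbhs_ballP[s0 /= s00 sub]; exists s0 => // s ss0 y hy; apply: sub; split => // i j.
rewrite (ord1 i) /ball /= distrC.
by have := coord_le_enorm (y - x) j; rewrite !mxE => /le_lt_trans; apply; exact: lt_le_trans ss0.
Qed.

(** In the open cube each component of [boundary_normal] varies by at most [s / r] over a distance
    [s], so its mean over a small ball is close to its value at the centre. *)
Lemma boundary_normal_average (m : {measure set 'rV[R]_n -> \bar R}) x i :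
  (forall A, measurable A -> (m A < +oo)%E) -> (forall s : R, 0 < s -> (0 < m (eball x s))%E) ->
  open_cube x ->
  (fun s : R => (\int[m]_(y in eball x s) (boundary_normal e P r y 0 i)) / fine (m (eball x s)))
    @ 0^'+ --> boundary_normal e P r x 0 i.
Proof.
move=> mfin mpos ox; have [s0 s00 sub] := eball_sub_open_cube ox.
set nu := boundary_normal e P r x 0 i.
have mn : measurable_fun setT (fun y => boundary_normal e P r y 0 i : measurableTypeR R).
  exact: (cube_bounded_normal e P r0 i).1.
have close s y : s <= s0 -> eball x s y -> `|boundary_normal e P r y 0 i - nu| <= s / r.
  move=> ss0 Bs; rewrite /nu !mxE !mem_set//; last exact: sub Bs.
  rewrite -mulrBr -mulrBl opprB addrA subrK.
  have h : `|y 0 i - x 0 i| <= s.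
    by have := coord_le_enorm (y - x) i; rewrite !mxE => /le_trans; apply; exact: ltW.
  have s_0 : 0 <= s by apply: le_trans h.
  case: (i \in P); last by rewrite mul0r normr0 divr_ge0// ltW.
  by rewrite mul1r normrM (@gtr0_norm _ r^-1) ?invr_gt0// ler_pM2r ?invr_gt0.
apply/cvgrPdist_le => eps eps0; near=> s.
have s_0 : 0 < s by near: s; exact: nbhs_right_gt.
have ss0 : s <= s0 by near: s; exact: nbhs_right_le.
have se : s <= eps * r by near: s; apply: nbhs_right_le; rewrite mulr_gt0.
have mB : measurable (eball x s) by apply: open_measurable_rV; exact: open_eball.
have fB : m (eball x s) \is a fin_num by rewrite ge0_fin_numE// mfin.
have B0 : 0 < fine (m (eball x s)) by rewrite fine_gt0// mpos//= mfin.
have bi (g : 'rV[R]_n -> R) M : measurable_fun setT (g : _ -> measurableTypeR R) ->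
    (forall y, eball x s y -> `|g y| <= M) -> m.-integrable (eball x s) (EFin \o g).
  move=> mg gM; apply: measurable_bounded_integrable => //.
  - exact: mfin.
  - exact: measurable_funTS.
  - exists M; split; first exact: num_real.
    by move=> t Mt y By /=; apply: le_trans (ltW Mt); exact: gM.
have iN : m.-integrable (eball x s) (EFin \o (fun y => boundary_normal e P r y 0 i)).
  have [_ [M bM]] := cube_bounded_normal e P r0 i; apply: (bi _ M) => // y By; apply: bM.
  by apply: sub_open_cube; exact: sub By.
have iC (c : R) : m.-integrable (eball x s) (EFin \o (fun=> c)).
  by apply: (bi _ `|c|) => //; exact: measurable_cst.
rewrite distrC -(mulfK (lt0r_neq0 B0) nu) -mulrBl -Rintegral_cst// -RintegralB//.
rewrite normrM (@gtr0_norm _ (_^-1)) ?invr_gt0// ler_pdivrMr//.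
apply: (@le_trans _ _ (\int[m]_(y in eball x s) (s / r))); last first.
  by rewrite Rintegral_cst// ler_pM2r// ler_pdivrMr.
have iD : m.-integrable (eball x s) (EFin \o (fun y => boundary_normal e P r y 0 i - nu)).
  by apply: (bi _ (s / r)) => [|y By]; [exact: measurable_funB|exact: close].
apply: le_trans (le_normr_Rintegral mB iD) _.
apply: le_Rintegral => //.
- apply: (bi _ (s / r)) => [|y By]; last by rewrite normr_id; exact: close.
  by apply: measurableT_comp => //; exact: measurable_funB.
- by move=> y By; exact: close.
Unshelve. all: by end_near.
Qed.

Lemma sphere_sub_reduced_boundary (E : set 'rV[R]_n) :
  (forall T, C1_compact_support T -> \int[L]_(x in E) (divergence T x)%:E =
     \int[L]_(x in vertex_tube e P (r ^+ 2)) (divergence T x)%:E)%E ->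
  [set x | open_cube x /\ partial_sqnorm P (flip e x) = r ^+ 2] `<=` reduced_boundary E.
Proof.
move=> hE x [ox xr].
have [m mE] := exists_sum_density L (@measurable_open_cube R n)
  (measurable_boundary_density P r) (boundary_density_ge0 P r0) (measurable_boundary_map e P r).
have mfin A : measurable A -> (m A < +oo)%E by exact: (boundary_measure_fin r0 r1 mE).
have mpos s : 0 < s -> (0 < m (eball x s))%E.
  by apply: boundary_measure_eball_gt0 => // A; exact: (boundary_measureE r0 r1 mE).
exists m, (boundary_normal e P r); split => //.
  split.
  - move=> K cK; apply: mfin; rewrite -[K]setCK; apply: measurableC; apply: open_measurable_rV.
    by rewrite openC; apply: compact_closed => //; exact: norm_hausdorff.
  - exact: measurable_boundary_normal.
  - exact: (boundary_measure_normal r0 r1 mE).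
  - by move=> T cT; rewrite hE//; have [dT cdT _] := cT; exact: (tube_gauss_green r0 r1 mE).
exists (boundary_normal e P r x); last by move=> i; exact: boundary_normal_average.
have [i iP] : exists i, i \in P.
  apply/set0Pn; apply/eqP => P0; move: xr.
  by rewrite P0 /partial_sqnorm big_set0 => /esym/eqP; rewrite sqrf_eq0 gt_eqF.
set y := flip e x; have oy : open_cube y by exact: open_cube_flip.
have roomy : room i y = y 0 i ^+ 2.
  rewrite /slice_room -xr /partial_sqnorm -/y (big_setD1 i)//=; ring.
have yi0 : 0 < y 0 i by have /andP[] := oy i.
have pointy : point i y = y.
  by rewrite /sphere_point roomy sqrtr_sqr gtr0_norm// upd_id.
have := @enorm_boundary_normal R n e P r r0 r1 (inl i) y oy.
rewrite /= pointy flipK; apply; rewrite iP roomy sqrtr_sqr sqr_ge0 !mul1r.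
by rewrite mulf_neq0 ?invr_eq0 ?normr_eq0 ?gt_eqF.
Qed.

End sphere_in_reduced_boundary.

(** * Comparison of areas *)

Section numerics.
Context (R : realType).
Local Notation B := (@ball_orthant R).
Local Notation W := (@wallis R).

Lemma ball_orthantS d : B d.+1 = B d * W d.+1. Proof. by []. Qed.

Lemma pi_bounds : 0 < (pi : R) < 629 / 200.
Proof. by rewrite pi_gt0 pi_lt. Qed.

Lemma wallis_even_bounds :
  [/\ 0 < W 2 < 787 / 1000, 0 < W 4 < 59 / 100, 0 < W 6 < 492 / 1000,
      0 < W 8 < 43 / 100 & 0 < W 10 < 387 / 1000].
Proof.
have /andP[p0 p1] := pi_bounds.
by split; rewrite !wallisSS wallis0; apply/andP; split; lra.
Qed.

Lemma wallis_odd : [/\ W 3 = 2 / 3, W 5 = 8 / 15, W 7 = 16 / 35 & W 9 = 128 / 315].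
Proof. by split; rewrite !wallisSS wallis1; field. Qed.

(** The quotient B_10/B_d is the product of [wallis k] for k from d+1 to 10, bounded downwards from
    d = 9. That case is the tight one: 387/1000 times (10/9)^9 is about 0.9989. *)
Lemma ball_orthant_ratio d : (0 < d <= 9)%N ->
  (10 / d%:R) ^+ d * (B 10 / B d) < 999 / 1000.
Proof.
move=> /andP[d0 d9].
have B0 k : B k != 0 by rewrite gt_eqF// ball_orthant_gt0.
have [/andP[w2 w2'] /andP[w4 w4'] /andP[w6 w6'] /andP[w8 w8'] /andP[w10 w10']] :=
  wallis_even_bounds.
have [w3 w5 w7 w9] := wallis_odd.
pose q d := B 10 / B d.
have qS k : q k = W k.+1 * q k.+1.
  by rewrite /q (ball_orthantS k); field; rewrite B0 gt_eqF ?wallis_gt0.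
have q10 : q 10 = 1 by rewrite /q divff.
have q0 k : 0 < q k by rewrite divr_gt0 ?ball_orthant_gt0.
rewrite -/(q d); move: d0 d9; clearbody q; move: q qS q10 q0 => q qS q10 q0 d0 d9.
clear B0.
have step k a b c : W k.+1 <= a -> q k.+1 < b -> a * b <= c -> q k < c.
  move=> Wa qb abc; rewrite qS; apply: lt_le_trans abc.
  apply: (@le_lt_trans _ _ (a * q k.+1)); first by rewrite ler_pM2r.
  by rewrite ltr_pM2l// (lt_le_trans (wallis_gt0 R k.+1)).
have q9 : q 9 < 387 / 1000 by rewrite qS q10 mulr1.
have q8 : q 8 < 158 / 1000.
  by apply: (step _ _ _ _ _ q9); [by rewrite w9|clear; lra].
have q7 : q 7 < 68 / 1000 by apply: (step _ _ _ _ (ltW w8') q8); clear; lra.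
have q6 : q 6 < 312 / 100 / 100.
  by apply: (step _ _ _ _ _ q7); [by rewrite w7|clear; lra].
have q5 : q 5 < 154 / 100 / 100 by apply: (step _ _ _ _ (ltW w6') q6); clear; lra.
have q4 : q 4 < 83 / 100 / 100.
  by apply: (step _ _ _ _ _ q5); [by rewrite w5|clear; lra].
have q3 : q 3 < 50 / 100 / 100 by apply: (step _ _ _ _ (ltW w4') q4); clear; lra.
have q2 : q 2 < 34 / 100 / 100.
  by apply: (step _ _ _ _ _ q3); [by rewrite w3|clear; lra].
have q1 : q 1 < 27 / 100 / 100 by apply: (step _ _ _ _ (ltW w2') q2); clear; lra.
have fin k (u : R) : q k < u -> (10 / k%:R) ^+ k * u <= 999 / 1000 -> 0 < 10 / k%:R :> R ->
    (10 / k%:R) ^+ k * q k < 999 / 1000.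
  by move=> qu c0; move/(exprn_gt0 k) => e0; apply: lt_le_trans c0; rewrite ltr_pM2l.
move: d0 d9; case: d => // -[|[|[|[|[|[|[|[|[|//]]]]]]]]] _ _.
- by apply: fin q1 _ _; clear; rewrite ?exprS ?expr0; lra.
- by apply: fin q2 _ _; clear; rewrite ?exprS ?expr0; lra.
- by apply: fin q3 _ _; clear; rewrite ?exprS ?expr0; lra.
- by apply: fin q4 _ _; clear; rewrite ?exprS ?expr0; lra.
- by apply: fin q5 _ _; clear; rewrite ?exprS ?expr0; lra.
- by apply: fin q6 _ _; clear; rewrite ?exprS ?expr0; lra.
- by apply: fin q7 _ _; clear; rewrite ?exprS ?expr0; lra.
- by apply: fin q8 _ _; clear; rewrite ?exprS ?expr0; lra.
- by apply: fin q9 _ _; clear; rewrite ?exprS ?expr0; lra.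
Qed.

(** Bernoulli's inequality turned into an upper bound on a power, used to estimate the 81st power of
    the competitor's radius. *)
Lemma expr_le_inv (x : R) k : 0 <= x -> (1 + x) ^+ k * (1 - k%:R * x) <= 1.
Proof.
move=> x0; elim: k => [|k ih]; first by rewrite expr0 mul0r subr0 mulr1.
apply: le_trans ih; rewrite exprSr -mulrA ler_pM2l ?exprn_gt0//; last by lra.
rewrite -natr1; have k0 : 0 <= k%:R :> R by []; nra.
Qed.

End numerics.

(** * Volumes and areas of tubes about faces *)

Section tubes_of_faces.
Context (R : realType) (n : nat).
Implicit Types (e : 'I_n -> bool) (P : {set 'I_n}).
Local Notation L := (@lebesgue_rV R n).
Local Notation h P := (hausdorff n.-1 (@sphere_box R n P 1%R (fun=> 1%R))).

Lemma flip_offset_sqr e (x : 'rV[R]_n) i : flip e x 0 i ^+ 2 = (x 0 i - (e i)%:R) ^+ 2.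
Proof. by rewrite mxE; case: (e i) => /=; ring. Qed.

Lemma edist_face e P (x : 'rV[R]_n) : cube x ->
  Defs.edist x [set y | cube y /\ forall i, i \in P -> y 0 i = (e i)%:R] =
  Num.sqrt (partial_sqnorm P (flip e x)).
Proof.
move=> cx; set F := [set y | _].
have dist y : F y -> Num.sqrt (partial_sqnorm P (flip e x)) <= enorm (x - y).
  move=> [_ yP]; apply: ler_wsqrtr; rewrite /partial_sqnorm big_mkcond.
  apply: ler_sum => i _; rewrite !mxE -expr2; case: (boolP (i \in P)) => iP; last exact: sqr_ge0.
  by rewrite yP// -flip_offset_sqr mxE.
(* The orthogonal projection of [x] to the face, which stays in the cube and realizes the
   distance. *)
pose p : 'rV[R]_n := \row_i (if i \in P then (e i)%:R else x 0 i).
have Fp : F p.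
  split=> [i|i iP]; rewrite mxE; last by rewrite iP.
  by case: (i \in P) => //; case: (e i); rewrite ?lexx ?ler01.
have distp : enorm (x - p) = Num.sqrt (partial_sqnorm P (flip e x)).
  rewrite /enorm /edot /partial_sqnorm [in RHS]big_mkcond; congr Num.sqrt; apply: eq_bigr => i _.
  by rewrite flip_offset_sqr !mxE -expr2; case: (i \in P) => //; rewrite subrr expr0n.
apply/eqP; rewrite eq_le; apply/andP; split.
  apply: ge_inf; last by exists p.
  by exists (Num.sqrt (partial_sqnorm P (flip e x))) => _ [y Fy <-]; exact: dist.
by apply: lb_le_inf; [exists (enorm (x - p)), p|move=> _ [y Fy <-]; exact: dist].
Qed.

Lemma tube_face e P (r : R) : 0 <= r ->
  tube [set y | cube y /\ forall i, i \in P -> y 0 i = (e i)%:R] r = vertex_tube e P (r ^+ 2).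
Proof.
move=> r0; apply/seteqP; split => x.
  move=> [cx]; rewrite edist_face// => d; split; first exact: cube_flip.
  by rewrite -(@sqr_sqrtr _ (partial_sqnorm P (flip e x))) ?sumr_ge0// => [|i _];
    [rewrite ler_pXn2r ?nnegrE ?sqrtr_ge0|exact: sqr_ge0].
move=> [cx d]; have cx' : cube x by rewrite -(flipK e x); exact: cube_flip.
split => //; rewrite edist_face//.
by rewrite -(@ler_pXn2r _ 2) ?nnegrE ?sqrtr_ge0// sqr_sqrtr// sumr_ge0// => i _; exact: sqr_ge0.
Qed.

Lemma volume_vertex_tube e P (r : R) : 0 <= r <= 1 ->
  volume (vertex_tube e P (r ^+ 2)) = (ball_orthant R #|P| * r ^+ #|P|)%:E.
Proof.
move=> /andP[r0 r1]; rewrite /volume lebesgue_vertex_tube orthant_ball_volumeE.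
  by rewrite sqrtr_sqr ger0_norm.
by rewrite sqr_ge0 expr_le1.
Qed.

Lemma enorm_flip e (x y : 'rV[R]_n) : enorm (flip e x - flip e y) = enorm (x - y).
Proof.
rewrite /enorm /edot; congr Num.sqrt; apply: eq_bigr => i _; rewrite !mxE.
by case: (e i); ring.
Qed.

Lemma hausdorff_flip s e (A : set 'rV[R]_n) :
  (hausdorff s (flip e @` A) <= hausdorff s A)%E.
Proof.
have := @hausdorff_lipschitz R n n s (flip e) A 1 ltr01.
by rewrite expr1n mul1e; apply => x y _ _; rewrite enorm_flip mul1r.
Qed.

(* Stated for any [E] with the divergence integrals of the tube, because the
   complement of a tube agrees with a tube only up to a null set. *)
Lemma area_ge e P (r : R) (E : set 'rV[R]_n) : 0 < r < 1 -> (0 < #|P|)%N ->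
  (forall T, C1_compact_support T -> \int[L]_(x in E) (divergence T x)%:E =
     \int[L]_(x in vertex_tube e P (r ^+ 2)) (divergence T x)%:E)%E ->
  ((r ^+ #|P|.-1)%:E * h P <= area E)%E.
Proof.
move=> /andP[r0 r1] P0 hE; rewrite /area; case: asboolP => _; last by rewrite leey.
apply: le_trans (sphere_box_power_ge P0 r0) _.
pose A := [set x : 'rV[R]_n | open_cube x /\ partial_sqnorm P (flip e x) = r ^+ 2].
apply: (@le_trans _ _ (hausdorff n.-1 (flip e @` A))); last first.
  apply: le_trans (hausdorff_flip _ _ _) _; apply: hausdorff_sub => x Ax; split; last by case: Ax.
  exact: (sphere_sub_reduced_boundary r0 r1 hE).
apply: hausdorff_sub => z [z1 z2 z3]; exists (flip e z); last exact: flipK.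
split; last by rewrite flipK.
apply: open_cube_flip => i; case: (boolP (i \in P)) => iP; last exact: z3.
rewrite z1//= -(ltr_pXn2r (n:=2)) ?nnegrE ?ltW ?z1// expr1n.
apply: (@le_lt_trans _ _ (r ^+ 2)); last by rewrite expr_lt1// ltW.
rewrite -z2 /partial_sqnorm (bigD1 i)//= lerDl sumr_ge0// => j _; exact: sqr_ge0.
Qed.

(** Also for radii above 1: [sphere_box] does not bound the coordinates in [P] by 1, so it contains
    the part of the sphere in the open cube and possibly more. *)
Lemma area_vertex_tube_le e P (c : R) : 0 < c -> (0 < #|P|)%N ->
  (area (vertex_tube e P (c ^+ 2)) <= (c ^+ #|P|.-1)%:E * h P)%E.
Proof.
move=> c0 P0; rewrite /area asboolT; last exact: vertex_tube_finite_perimeter.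
apply: (@le_trans _ _ (hausdorff n.-1 (flip e @` sphere_box P c (fun=> 1)))).
  apply: hausdorff_sub => x /reduced_boundary_sub [ox xc].
  exists (flip e x); last exact: flipK.
  have oz : open_cube (flip e x) by exact: open_cube_flip.
  by split => // i _; have /andP[] := oz i => // ->.
apply: le_trans (hausdorff_flip _ _ _) _.
have := @sphere_box_power R n P P0 c (fun=> 1) c0 (fun=> ltr01).
by rewrite big1// mulr1.
Qed.

(** Adds coordinates one at a time with the band estimate. The recursion for the Wallis integrals
    turns its constant W_(m-1) into (m+1)/m times B_(m+1)/B_m, and the product telescopes. *)
Lemma sphere_box_chain P d : (0 < #|P|)%N -> (#|P| <= d <= n)%N ->
  exists2 Q : {set 'I_n}, #|Q| = d &
    (h Q <= (d%:R / #|P|%:R * (ball_orthant R d / ball_orthant R #|P|))%:E * h P)%E.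
Proof.
move=> P0 /andP[Pd]; rewrite -(subnKC Pd); elim: (d - #|P|)%N => [|k ih] dn.
  exists P; rewrite addn0// !divff ?mulr1 ?mul1e//; first by rewrite gt_eqF// ball_orthant_gt0.
  by rewrite pnatr_eq0 -lt0n.
have [|Q Qc Qh] := ih; first by rewrite (leq_trans _ dn)// addnS.
have [j jQ] : exists j, j \notin Q.
  apply/existsP; rewrite -negb_forall; apply/negP => /forallP QT.
  have : #|Q| = n by rewrite -[RHS]card_ord; apply: eq_card => j; rewrite QT.
  by rewrite Qc => hn; move: dn; rewrite addnS hn ltnn.
have Q0 : (0 < #|Q|)%N by rewrite Qc addn_gt0 P0.
exists (j |: Q)%SET; first by rewrite cardsU1 jQ Qc addnS.
apply: (le_trans (@sphere_box_band R n Q j jQ Q0)).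
apply: (@le_trans _ _ ((wallis R #|Q|.-1)%:E * ((#|P| + k)%:R / #|P|%:R *
  (ball_orthant R (#|P| + k) / ball_orthant R #|P|))%:E * h P))%E.
  by rewrite -muleA lee_pmul2l// lte_fin wallis_gt0.
rewrite -EFinM addnS Qc; set m := (#|P| + k)%N.
have m0 : (0 < m)%N by rewrite addn_gt0 P0.
apply: lee_wpmul2r; first exact: hausdorff_ge0.
rewrite lee_fin le_eqVlt; apply/orP; left; apply/eqP.
rewrite (ball_orthantS R m) -[in wallis R m.+1](prednK m0) wallisSS (prednK m0).
field; rewrite !gt_eqF ?ball_orthant_gt0 ?ltr0n//.
Qed.

(** Flat in codimension 1; each further coordinate multiplies the bound by a Wallis integral. *)
Lemma sphere_box_finite P : (0 < #|P|)%N -> (h P < +oo)%E.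
Proof.
have chain k (Q : {set 'I_n}) : #|Q| = k.+1 -> (h Q < +oo)%E.
  elim: k Q => [|k ih] Q Qk.
    have /cards1P[i ->] : #|Q| == 1%N by rewrite Qk.
    exact: sphere_box_hausdorff_fin.
  have [j jQ] : exists j, j \in Q by apply/set0Pn; rewrite -card_gt0 Qk.
  have Q'k : #|Q :\ j| = k.+1 by move: Qk; rewrite (cardsD1 j) jQ => -[].
  have jQ' : j \notin Q :\ j by rewrite in_setD1 eqxx.
  rewrite -(finset.setD1K jQ); apply: le_lt_trans (@sphere_box_band R n _ j jQ' _) _.
    by rewrite Q'k.
  apply: lte_mul_pinfty; rewrite ?lee_fin ?ltW ?wallis_gt0//.
  exact: ih.
by move=> P0; apply: (chain #|P|.-1); rewrite prednK.
Qed.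

End tubes_of_faces.

(** * The competitor and the failure of every tube *)

Section competitor.
Context (R : realType) (n : nat).
Hypothesis n10 : (10 <= n)%N.
Local Notation L := (@lebesgue_rV R n).
Local Notation B := (@ball_orthant R).
Local Notation h P := (hausdorff n.-1 (@sphere_box R n P 1%R (fun=> 1%R))).

(* The radius of the competitor, a tube of codimension 10. *)
Let c : R := 1 + 1 / (100 * 1000).

(** The exponent 81 is the largest value of 9 d for d <= 9, and 1.001 times 0.999 is less than 1. *)
Let c81 : c ^+ 81 <= 1001 / 1000.
Proof.
have x0 : 0 <= 1 / (100 * 1000) :> R by lra.
have := expr_le_inv 81 x0; rewrite -/c => hc.
have : 0 < c ^+ 81 by rewrite exprn_gt0// /c; lra.
set y := c ^+ 81 in hc *; move: hc; clearbody y; move=> hc y0; nra.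
Qed.

Let c1 : 1 < c. Proof. by rewrite /c; lra. Qed.
Let c0 : 0 < c. Proof. by rewrite (lt_trans ltr01). Qed.

(** The volume of the tube of codimension 10 and radius [c] in any cube of dimension at least 10.
    Beyond radius 1 it is not B_10 c^10; the bounds below enclose it between B_10 and that value. *)
Definition competitor_volume : R := fine (orthant_ball_volume 10 (c ^+ 2)).
Local Notation v := competitor_volume.

Lemma competitor_volumeE : (v%:E = orthant_ball_volume 10 (c ^+ 2))%E.
Proof.
rewrite fineK// ge0_fin_numE ?orthant_ball_volume_ge0//.
apply: le_lt_trans (orthant_ball_volume_le _ _) _; first exact: sqr_ge0.
exact: ltry.
Qed.

Lemma competitor_volume_le : v <= B 10 * c ^+ 10.
Proof.
rewrite -lee_fin competitor_volumeE.
apply: le_trans (orthant_ball_volume_le _ _) _; first exact: sqr_ge0.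
by rewrite sqrtr_sqr gtr0_norm.
Qed.

Lemma competitor_volume_gt : B 10 < v.
Proof.
pose P : {set 'I_10} := [set: 'I_10]%SET.
have P10 : #|P| = 10%N by rewrite cardsT card_ord.
pose U := @open_cube R 10 `&` [set z | 1 < partial_sqnorm P z] `&`
  [set z | partial_sqnorm P z < c ^+ 2].
have cs : continuous (@partial_sqnorm R 10 P) by exact: continuous_partial_sqnorm.
have oU : open U.
  apply: openI; last first.
    by apply: (@open_comp _ _ (partial_sqnorm P) [set t | t < c ^+ 2]);
      [move=> z _; exact: cs|exact: open_lt].
  apply: openI; first exact: open_open_cube.
  by apply: (@open_comp _ _ (partial_sqnorm P) [set t | 1 < t]);
    [move=> z _; exact: cs|exact: open_gt].
have c21 : 1 < c ^+ 2 by rewrite exprn_egt1.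
have c22 : c ^+ 2 < 2.
  by rewrite expr2 /c; lra.
(* Ten equal coordinates with squared norm halfway between 1 and [c ^+ 2] give a point of the open
   cube strictly between the two spheres, hence an open set of positive volume there. *)
pose t := Num.sqrt ((1 + c ^+ 2) / 20).
have t2 : t ^+ 2 = (1 + c ^+ 2) / 20 by rewrite sqr_sqrtr//; lra.
pose p : 'rV[R]_10 := const_mx t.
have pP : partial_sqnorm P p = (1 + c ^+ 2) / 2.
  rewrite /partial_sqnorm (eq_bigr (fun=> t ^+ 2)) => [|i _]; last by rewrite mxE.
  rewrite sumr_const P10 t2 -mulr_natr; by move: (c ^+ 2) => u; lra.
have Up : U p.
  split; last by rewrite /= pP; lra.
  split; last by rewrite /= pP; lra.
  move=> i; rewrite mxE sqrtr_gt0; apply/andP; split; first by lra.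
  by rewrite -sqrtr1 ltr_sqrt//; lra.
have mU : measurable U by exact: open_measurable_rV.
have LU : (0 < @lebesgue_rV R 10 U)%E by apply: lebesgue_rV_open_gt0 => //; exists p.
have := lebesgue_orthant_tube P (c ^+ 2); rewrite P10 -competitor_volumeE => vE.
have := lebesgue_orthant_tube P (1 : R); rewrite P10 orthant_ball_volumeE ?ler01 ?lexx//.
rewrite sqrtr1 expr1n mulr1 => BE.
rewrite -lte_fin -vE -BE.
apply: (@lt_le_trans _ _ (@lebesgue_rV R 10 (orthant_tube P 1 `|` U))).
  rewrite measureU//; last first.
  - rewrite -subset0 => z [[_ z1] [[_ z2] _]].
    by move: z2; rewrite /= ltNge z1.
  - exact: measurable_orthant_tube.
  by rewrite [X in (_ < X + _)%E]BE [X in (X < _)%E]BE lteDl.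
apply: le_measure; rewrite ?inE.
- by apply: measurableU => //; exact: measurable_orthant_tube.
- exact: measurable_orthant_tube.
move=> z [[cz z1]|[[oz z1] z2]]; split => //.
- exact: le_trans z1 (ltW c21).
- exact: sub_open_cube.
- exact: ltW.
Qed.

Lemma ball_orthant_10 d : (0 < d <= 9)%N -> B 10 / B d < 999 / 1000.
Proof.
move=> /andP[d0 d9]; apply: le_lt_trans (@ball_orthant_ratio R d _); last first.
  by rewrite d0.
apply: ler_peMl; first by rewrite divr_ge0 ?(ltW (ball_orthant_gt0 _ _)).
rewrite exprn_ege1// ler_pdivlMr ?ltr0n// mul1r ler_nat.
by rewrite (leq_trans d9).
Qed.

Let c_pow k : (k <= 81)%N -> c ^+ k <= 1001 / 1000.
Proof. by move=> k81; apply: le_trans c81; rewrite ler_eXn2l. Qed.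

(** The ratio estimate for d = 1 reads 10 B_10 < 999/1000. The bound ensures 1 - v > B_2, which
    rules out complements of tubes of codimension at least 2. *)
Lemma competitor_volume_small : v < 1 / 9.
Proof.
apply: le_lt_trans competitor_volume_le _.
have b10 : B 10 < 1 / 10.
  have := @ball_orthant_ratio R 1 isT; rewrite expr1.
  have -> : B 1 = 1 by rewrite /= wallis1 mul1r.
  by move: (B 10) => b; lra.
have := c_pow (isT : 10 <= 81)%N; have := ball_orthant_gt0 R 10.
move: (B 10) b10 (c ^+ 10) => b b10 y bp yc; nra.
Qed.

Lemma exists_competitor (P : {set 'I_n}) : (0 < #|P| <= 9)%N ->
  exists E : set 'rV[R]_n, [/\ measurable E, E `<=` cube, volume E = v%:E &
    (area E <= (c ^+ 9 * (10 / #|P|%:R * (B 10 / B #|P|)))%:E * h P)%E].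
Proof.
move=> /andP[P0 P9]; have [|Q Q10 Qh] := @sphere_box_chain R n P 10 P0.
  by rewrite n10 (leq_trans P9).
exists (vertex_tube (fun=> false) Q (c ^+ 2)); split.
- exact: measurable_vertex_tube.
- exact: vertex_tube_cube.
- by rewrite /volume lebesgue_vertex_tube Q10 competitor_volumeE.
apply: le_trans (area_vertex_tube_le _ c0 _) _; first by rewrite Q10.
by rewrite Q10 /= (EFinM (c ^+ 9)) -muleA lee_pmul2l// lte_fin exprn_gt0.
Qed.

(* Raised to the power [d], this follows from [c ^+ (9 * d) * (10 / d) ^+ d * b < 1]
   with [b = B 10 / B d]. *)
Lemma competitor_factor d (r : R) : (0 < d <= 9)%N -> 0 < r -> B 10 / B d <= r ^+ d ->
  c ^+ 9 * (10 / d%:R * (B 10 / B d)) < r ^+ d.-1.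
Proof.
move=> d09 r0 br; have /andP[d0 d9] := d09.
have b0 : 0 < B 10 / B d by rewrite divr_gt0// ball_orthant_gt0.
have ratio := @ball_orthant_ratio R d d09.
move: b0 br ratio; move: (B 10 / B d) => b b0 br ratio.
have d00 : (0 : R) < d%:R by rewrite ltr0n.
rewrite -(@ltr_pXn2r _ d) ?nnegrE//; first last.
- by rewrite exprn_ge0// ltW.
- apply: mulr_ge0; first by rewrite exprn_ge0// ltW.
  by apply: mulr_ge0; [apply: divr_ge0|exact: ltW].
rewrite -exprM mulnC exprM; apply: (@lt_le_trans _ _ (b ^+ d.-1)); last first.
  by apply: lerXn2r => //; rewrite nnegrE ?exprn_ge0// ltW.
have -> : (c ^+ 9 * (10 / d%:R * b)) ^+ d = c ^+ (9 * d) * ((10 / d%:R) ^+ d * b) * b ^+ d.-1.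
  have key (x y : R) : (x * (y * b)) ^+ d = x ^+ d * (y ^+ d * b) * b ^+ d.-1.
    by rewrite !exprMn -{3}(prednK d0) exprS; ring.
  by rewrite key -exprM.
rewrite gtr_pMl ?exprn_gt0//.
have cd : c ^+ (9 * d) <= 1001 / 1000.
  by apply: c_pow; rewrite (leq_trans (leq_mul (leqnn 9) d9)).
have rb0 : 0 < (10 / d%:R) ^+ d * b by rewrite mulr_gt0// exprn_gt0// divr_gt0.
by move: (_ ^+ d * b) rb0 ratio (c ^+ _) cd => y y0 y1 x x1; nra.
Qed.

Lemma not_minimizer e (P : {set 'I_n}) (r : R) (E : set 'rV[R]_n) :
  (0 < #|P| <= 9)%N -> 0 < r < 1 -> B 10 / B #|P| <= r ^+ #|P| ->
  (forall T, C1_compact_support T -> \int[L]_(x in E) (divergence T x)%:E =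
     \int[L]_(x in vertex_tube e P (r ^+ 2)) (divergence T x)%:E)%E ->
  ~ isoperimetric_minimizer v E.
Proof.
move=> P09 r01 br hE [_ _ _ minE]; have /andP[P0 _] := P09; have /andP[r0 _] := r01.
have [G [mG subG vG aG]] := exists_competitor P09.
have := le_trans (area_ge r01 P0 hE) (le_trans (minE G mG subG vG) aG).
have [i iP] : exists i, i \in P by apply/set0Pn; rewrite -card_gt0.
(* The common factor [h P] is positive and finite, so it cancels. *)
have h0 := sphere_box_hausdorff_gt0 R iP; have hfin := sphere_box_finite R P0.
rewrite -(@fineK _ (h P)); last by rewrite ge0_fin_numE// ltW.
rewrite -!EFinM lee_fin leNgt ltr_pM2r; last by rewrite fine_gt0// h0.
by rewrite competitor_factor.
Qed.

Lemma not_minimizer_tube e (P : {set 'I_n}) (r : R) : (0 < #|P|)%N -> 0 < r <= 1 ->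
  ~ isoperimetric_minimizer v (vertex_tube e P (r ^+ 2)).
Proof.
move=> P0 /andP[r0 r1] minE; have [_ _ vE _] := minE.
move: vE; rewrite volume_vertex_tube ?(ltW r0)//= => -[vE].
have B0 := ball_orthant_gt0 R #|P|.
have v0 := competitor_volume_gt.
have P9 : (#|P| <= 9)%N.
  rewrite leqNgt; apply/negP => P10; move: v0; rewrite -vE ltNge => /negP; apply.
  apply: le_trans (ball_orthant_nonincreasing R P10).
  by rewrite ler_piMr ?exprn_ile1// ltW.
have P09 : (0 < #|P| <= 9)%N by rewrite P0.
have rv : r ^+ #|P| = v / B #|P| by rewrite -vE mulrC mulKf// gt_eqF.
apply: (@not_minimizer e P r _ P09 _ _ _ minE) => //.
  (* The area bound requires [r < 1]. Radius 1 would force v = B_d, whereas v <= B_10 c^10 < B_d. *)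
  rewrite r0 lt_neqAle r1 andbT; apply/negP => /eqP req.
  move: rv; rewrite req expr1n => /esym/eqP; rewrite lt_eqF//.
  apply: (@le_lt_trans _ _ (B 10 / B #|P| * c ^+ 10)).
    by rewrite mulrAC ler_pM2r ?invr_gt0//; exact: competitor_volume_le.
  have := ball_orthant_10 P09; have := c_pow (isT : 10 <= 81)%N.
  have : 0 < B 10 / B #|P| by rewrite divr_gt0// ball_orthant_gt0.
  by move: (B 10 / _) (c ^+ 10) => b y b0 y1 b1; nra.
by rewrite rv ler_pM2r ?invr_gt0// ltW.
Qed.

Lemma not_minimizer_cotube e (P : {set 'I_n}) (r : R) : (0 < #|P|)%N -> 0 < r <= 1 ->
  ~ isoperimetric_minimizer v (cube `\` vertex_tube e P (r ^+ 2)).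
Proof.
move=> P0 /andP[r0 r1] minE; have [mE _ vE _] := minE.
have r01 : 0 <= r <= 1 by rewrite ltW.
have B0 := ball_orthant_gt0 R #|P|.
have v0 : 0 < v by rewrite (lt_trans (ball_orthant_gt0 R 10))// competitor_volume_gt.
have v1 := competitor_volume_small.
have mV := measurable_vertex_tube e P (r ^+ 2).
have vr : B #|P| * r ^+ #|P| = 1 - v.
  have : (L cube - L (vertex_tube e P (r ^+ 2)) = v%:E)%E.
    rewrite -vE /volume measureD//.
    - by rewrite (setIidr (@vertex_tube_cube R n e P _)).
    - by rewrite [X in (X < _)%E]cube_cst ltry.
  rewrite [X in (X - _)%E]cube_cst [X in (_ - X)%E]volume_vertex_tube// => -[<-].
  by ring.
have P1 : #|P| = 1%N.
  (* In codimension at least 2 a tube of radius at most 1 has volume at most B_2 < 787/1000, less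
     than 1 - v. *)
  apply/eqP; rewrite eqn_leq P0 andbT leqNgt; apply/negP => P2.
  have : B #|P| * r ^+ #|P| <= B 2.
    apply: le_trans (ball_orthant_nonincreasing R P2).
    by rewrite ler_piMr ?exprn_ile1// ltW.
  rewrite vr /= wallis1 !mul1r leNgt => /negP; apply.
  have [/andP[_ w2] _ _ _ _] := wallis_even_bounds R.
  by move: (wallis R 2) w2 => w; lra.
have rv : r = 1 - v by move: vr; rewrite P1 expr1 /= wallis1 !mul1r.
have /cards1P[i Pi] : #|P| == 1%N by rewrite P1.
pose e' j := ~~ e j.
(* Only an inclusion: the slice at distance exactly [r] from the facet belongs to the opposite tube
   alone. As both sets have volume [v], the difference is null. *)
have sub : cube `\` vertex_tube e P (r ^+ 2) `<=` vertex_tube e' P (v ^+ 2).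
  move=> x [cx]; have cx' : cube (flip e' x) by exact: cube_flip.
  have cxe : cube (flip e x) by exact: cube_flip.
  rewrite /vertex_tube /= /orthant_tube /= /partial_sqnorm Pi !big_set1 => hx; split => //.
  have ee : flip e' x 0 i = 1 - flip e x 0 i by rewrite !mxE /e'; case: (e i) => /=; ring.
  have /andP[y0 y1] := cxe i.
  have : ~~ (flip e x 0 i ^+ 2 <= r ^+ 2) by apply/negP => hh; apply: hx.
  rewrite ler_pXn2r ?nnegrE ?(ltW r0)// -ltNge => ry.
  rewrite ler_pXn2r ?nnegrE ?(ltW v0)//; rewrite ee; last by rewrite subr_ge0.
  by move: ry; rewrite rv; lra.
have v01 : 0 < v < 1 by rewrite v0; lra.
apply: (@not_minimizer e' P v _ _ v01 _ _ minE).
- by rewrite P1.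
- have B1 : B 1 = 1 by rewrite /= wallis1 mul1r.
  rewrite P1 expr1 B1 divr1; apply: ltW; exact: competitor_volume_gt.
move=> T [dT cT _].
have mV' := measurable_vertex_tube e' P (v ^+ 2).
have vV' : L (vertex_tube e' P (v ^+ 2)) = v%:E.
  rewrite [LHS]volume_vertex_tube; last by have /andP[v00 v11] := v01; rewrite !ltW.
  by rewrite P1 expr1 /= wallis1 !mul1r.
set V := vertex_tube e' P (v ^+ 2) in sub mV' vV' *.
set E := cube `\` _ in mE vE sub *.
have N0 : L (V `\` E) = 0%E.
  rewrite measureD//; first by rewrite (setIidr sub) [X in (_ - X)%E]vE [X in (X - _)%E]vV' subee.
  by rewrite [X in (X < _)%E]vV' ltry.
rewrite [RHS](@negligible_integral _ _ _ _ _ (V `\` E))//.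
- by rewrite setDD (setIidr sub).
- exact: measurableD.
apply: (@integrableS _ _ _ L cube) => //; first exact: vertex_tube_cube.
apply: cube_bounded_integrable; apply: cube_bounded_sum => k.
by apply: cube_bounded_continuous; exact: continuous_derive_coord.
Qed.

End competitor.

Theorem theorem1p6 (R : realType) (n : nat) (hn : (10 <= n)%N) :
  exists v : R, 0 < v < 1 /\
    forall (k : nat) (r : R) (F : set 'rV[R]_n),
      (k < n)%N -> 0 < r <= 1 -> is_face k F ->
      ~ isoperimetric_minimizer v (tube F r) /\
      ~ isoperimetric_minimizer v (cube `\` tube F r).
Proof.
exists (competitor_volume R); split.
  rewrite (lt_trans (ball_orthant_gt0 R 10) (competitor_volume_gt R)) /=.
  by have := competitor_volume_small R; lra.
move=> k r F kn r01 [S [e [Sk ->]]].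
have P0 : (0 < #|~: S|)%N.
  rewrite lt0n; apply/negP => /eqP S0; move: kn.
  by have := cardsC S; rewrite card_ord Sk S0 addn0 => ->; rewrite ltnn.
have -> : [set x : 'rV[R]_n | cube x /\ forall i, i \notin S -> x 0 i = (e i)%:R] =
    [set x | cube x /\ forall i, i \in (~: S)%SET -> x 0 i = (e i)%:R].
  by apply/seteqP; split => x [cx xS]; split => // i iS; apply: xS; move: iS; rewrite finset.in_setC.
have /andP[r0 _] := r01.
rewrite (tube_face e (~: S)%SET (ltW r0)).
by split; [exact: not_minimizer_tube|exact: not_minimizer_cotube].
Qed.
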